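(* Let $G=Spin_7(\mathbb{C})$, let $T$ be a maximal torus of $G$, and let $P_{\alpha_3}$ be the maximal parabolic subgroup of $G$ associated to the simple root $\alpha_3$. The GIT quotient $T\backslash\backslash(G/P_{\alpha_3})^{ss}_T(\mathcal{L}_{4\varpi_3})$ is projectively normal with respect to the descent of the line bundle $\mathcal{L}_{4\varpi_3}$.
   Context: All varieties are over $\mathbb{C}$. $G=Spin_7$ is the simple simply connected group of type $B_3$, with a Borel subgroup $B\supseteq T$, simple roots $\alpha_1,\alpha_2,\alpha_3$ in the standard (Bourbaki) numbering ($\alpha_3$ is the short simple root) and fundamental weights $\varpi_1,\varpi_2,\varpi_3$. $P_{\alpha_i}$ is the maximal parabolic subgroup generated by $B$ and representatives of the simple reflections $s_{\alpha_j}$, $j\ne i$. $\mathcal{L}_{\lambda}$ denotes the ample homogeneous line bundle on $G/P_\lambda$ associated to the dominant weight $\lambda$ ($P_\lambda$ the associated parabolic subgroup), with its $G$-linearization restricted to $T$. GIT quotient: for a projective variety $X$ with an action of $T$ and a $T$-linearized very ample line bundle $\mathcal{L}$, $X^{ss}_T(\mathcal{L})$ is the open set of semistable points and $T\backslash\backslash X^{ss}_T(\mathcal{L})$ is its uniform categorical quotient by $T$. $\mathcal{L}$ descends to the quotient if there is a line bundle $\mathcal{L}'$ on the quotient whose pullback to $X^{ss}_T(\mathcal{L})$ is $T$-equivariantly isomorphic to $\mathcal{L}|_{X^{ss}_T(\mathcal{L})}$; $\mathcal{L}'$ is called the descent of $\mathcal{L}$. Then the polarized variety $(T\backslash\backslash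 X^{ss}_T(\mathcal{L}),\mathcal{L}')$ is $\mathrm{Proj}\big(\bigoplus_{k\ge0}H^0(X,\mathcal{L}^{\otimes k})^T\big)$, and its homogeneous coordinate ring is $\bigoplus_{k\ge 0}H^0(X,\mathcal{L}^{\otimes k})^T$, graded by $k$. The line bundle $\mathcal{L}_{4\varpi_3}$ is known to descend. Projective normality: a polarized variety $(Y,\mathcal{M})$ ($\mathcal{M}$ a very ample line bundle) is projectively normal if its homogeneous coordinate ring $\bigoplus_{k\ge0}H^0(Y,\mathcal{M}^{\otimes k})$ is integrally closed and is generated as a $\mathbb{C}$-algebra by its degree one part $H^0(Y,\mathcal{M})$. *)

(* Defs.v *)
From HB Require Import structures.
From mathcomp Require Import all_boot all_order all_algebra.
From mathcomp Require Import complex mpoly boolp classical_sets functions reals.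

Set Implicit Arguments.
Unset Strict Implicit.
Unset Printing Implicit Defensive.

Import GRing.Theory.

Local Open Scope classical_set_scope.
Local Open Scope ring_scope.

Section Clifford.
Variable C : fieldType.

(* [v] has coordinates [(a1, a2, a3, c, b3, b2, b1)] in a Witt basis
   [(e1, e2, e3, e0, f3, f2, f1)] of the quadratic space C^7. *)
Definition qform (v : 'rV[C]_7) : C :=
  v 0 (inord 3) ^+ 2 + v 0 (inord 0) * v 0 (inord 6)
  + v 0 (inord 1) * v 0 (inord 5) + v 0 (inord 2) * v 0 (inord 4).

(* If [X] squares to the scalar [r], then [clifford_step X a b] squares to
   the scalar [r + a * b]. *)
Definition clifford_step n (X : 'M[C]_n) (a b : C) : 'M[C]_(n + n) :=
  block_mx X a%:M b%:M (- X).

(* The Clifford action of [v] on the 8-dimensional spin module.  It extends to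
   the Clifford algebra of [qform], and restricts to an isomorphism of the even
   Clifford algebra onto the algebra of 8 x 8 matrices.
   The basis vector of index [4 * x + 2 * y + z] ([x, y, z] binary digits) has
   weight [(1/2) * ((-1)^x eps1 + (-1)^y eps2 + (-1)^z eps3)], where [eps1],
   [eps2], [eps3] are the weights of [e1], [e2], [e3]. *)
Definition gamma (v : 'rV[C]_7) : 'M[C]_8 :=
  @clifford_step 4
    (@clifford_step 2
      (@clifford_step 1 (v 0 (inord 3))%:M (v 0 (inord 2)) (v 0 (inord 4)))
      (v 0 (inord 1)) (v 0 (inord 5)))
    (v 0 (inord 0)) (v 0 (inord 6)).

Lemma clifford_step_sqr n (X : 'M[C]_n) (r a b : C) :
  X *m X = r%:M ->
  clifford_step X a b *m clifford_step X a b = (r + a * b)%:M.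
Proof.
move=> XX; rewrite /clifford_step mulmx_block !mulmxN !mulNmx opprK XX.
rewrite !mul_mx_scalar !mul_scalar_mx !subrr !scale_scalar_mx.
by rewrite (addrC _ r%:M) (mulrC b) -!raddfD /= -scalar_mx_block.
Qed.

Lemma gamma_sqr (v : 'rV[C]_7) : gamma v * gamma v = (qform v)%:M.
Proof.
have XX : (v 0 (inord 3))%:M *m (v 0 (inord 3))%:M
    = (v 0 (inord 3) ^+ 2)%:M :> 'M[C]_1.
  by rewrite -scalar_mxM expr2.
have := clifford_step_sqr (v 0 (inord 0)) (v 0 (inord 6))
  (clifford_step_sqr (v 0 (inord 1)) (v 0 (inord 5))
    (clifford_step_sqr (v 0 (inord 2)) (v 0 (inord 4)) XX)).
move=> H; rewrite [LHS]H; congr (_%:M).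
by rewrite /qform -!addrA; congr (_ + _); rewrite addrC -addrA addrCA.
Qed.

Definition spin7_pred : {pred 'M[C]_8} := fun g =>
  `[< exists s : seq 'rV[C]_7,
        [/\ ~~ odd (size s), all (fun v => qform v == 1) s
          & g = \prod_(v <- s) gamma v] >].

(* Products of an even number of vectors of norm 1.  Over a field in which
   every element is a square this is the usual spin group. *)
Record Spin7 := MkSpin7 {
  spin_val :> 'M[C]_8;
  _ : spin_val \in spin7_pred }.

HB.instance Definition _ := [isSub for spin_val].
HB.instance Definition _ := [Choice of Spin7 by <:].

Lemma spin7_pred1 : 1 \in spin7_pred.
Proof. by apply/asboolP; exists [::]; split=> //; rewrite big_nil. Qed.

Lemma spin7_predM g g' :
  g \in spin7_pred -> g' \in spin7_pred -> g * g' \in spin7_pred.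
Proof.
move=> /asboolP[s [os us ->]] /asboolP[s' [os' us' ->]].
apply/asboolP; exists (s ++ s'); split; last by rewrite big_cat.
- by rewrite size_cat oddD (negbTE os) (negbTE os').
- by rewrite all_cat us us'.
Qed.

Lemma gamma_prod_rev (s : seq 'rV[C]_7) :
  all (fun v => qform v == 1) s ->
  (\prod_(v <- rev s) gamma v) * (\prod_(v <- s) gamma v) = 1.
Proof.
elim: s => [|v s IH] /=; first by rewrite !big_nil mulr1.
case/andP=> /eqP qv /IH {}IH.
rewrite rev_cons -cats1 big_cat !big_cons big_nil /= mulr1.
by rewrite -mulrA (mulrA (gamma v)) gamma_sqr qv mul1r.
Qed.

Lemma spin7_predV g :
  g \in spin7_pred -> g \in unitmx /\ invmx g \in spin7_pred.
Proof.
move=> /asboolP[s [os us ->]].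
have H := gamma_prod_rev us; have [_ u] := mulmx1_unit H.
split=> //; apply/asboolP; exists (rev s); split.
- by rewrite size_rev.
- by rewrite all_rev.
- by rewrite -[RHS]mulmx1 -(mulmxV u) mulmxA (H : _ *m _ = 1%:M) mul1mx.
Qed.

Definition spin_one : Spin7 := MkSpin7 spin7_pred1.
Definition spin_mul (g g' : Spin7) : Spin7 :=
  MkSpin7 (spin7_predM (valP g) (valP g')).
Definition spin_inv (g : Spin7) : Spin7 :=
  MkSpin7 (spin7_predV (valP g)).2.

Lemma spin_mulA : associative spin_mul.
Proof. by move=> x y z; apply: val_inj; exact: mulrA. Qed.
Lemma spin_mul1 : left_id spin_one spin_mul.
Proof. by move=> x; apply: val_inj; exact: mul1r. Qed.
Lemma spin_1mul : right_id spin_one spin_mul.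
Proof. by move=> x; apply: val_inj; exact: mulr1. Qed.
Lemma spin_mulV : left_inverse spin_one spin_inv spin_mul.
Proof.
by move=> x; apply: val_inj; apply: mulVmx; have [] := spin7_predV (valP x).
Qed.
Lemma spin_Vmul : right_inverse spin_one spin_inv spin_mul.
Proof.
by move=> x; apply: val_inj; apply: mulmxV; have [] := spin7_predV (valP x).
Qed.

HB.instance Definition _ := isGroup.Build Spin7
  spin_mulA spin_mul1 spin_1mul spin_mulV spin_Vmul.
HB.instance Definition _ := isPointed.Build Spin7 spin_one.

End Clifford.

Section Quotient.
Variable C : numClosedFieldType.
Local Notation G := (Spin7 C).

(* [h] in [G] selects the pair (B, T) obtained from the standard one by
   conjugation by [h]; all pairs of a Borel subgroup and a maximal torus in it
   are of this form. *)
Variable h : G.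

(* The matrix of [g] in the basis of the spin module formed by the columns
   of [h]. *)
Definition frame (g : G) : 'M[C]_8 := val (g ^ h)%g.
Definition dcoef (k : nat) (g : G) : C := frame g (inord k) (inord k).

Definition torus : set G := [set t | is_diag_mx (frame t)].

Definition borel : set G :=
  [set g | forall i j : 'I_8, (j < i)%N -> frame g i j = 0].

(* alpha1 = eps1 - eps2, alpha2 = eps2 - eps3, alpha3 = eps3, written as
   differences of two weights of the spin module and indexed from 0. *)
Definition simple_root (i : 'I_3) (t : G) : C :=
  match val i with
  | 0 => dcoef 2 t / dcoef 4 t
  | 1 => dcoef 1 t / dcoef 2 t
  | _ => dcoef 0 t / dcoef 1 t
  end.

(* The entry (i, j) is <alpha_i, alpha_j^vee>. *)
Definition cartan_B3 : 'M[int]_3 :=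
  \matrix_(i < 3, j < 3)
    nth 0 (nth [::] [:: [:: 2; -1; 0]; [:: -1; 2; -2]; [:: 0; -1; 2]] i) j.

(* Elements [n] of the normalizer of the torus whose action
   chi |-> (t |-> chi (n^-1 t n)) on characters is the simple reflection
   s_j : alpha_i |-> alpha_i - <alpha_i, alpha_j^vee> alpha_j. *)
Definition reflection_rep (j : 'I_3) : set G :=
  [set n | forall t, torus t -> torus (t ^ n)%g /\
     forall i, simple_root i (t ^ n)%g
               = simple_root i t * simple_root j t ^ (- cartan_B3 i j)].

Definition subgroup (H : set G) : Prop :=
  H 1%g /\ forall x y, H x -> H y -> H (x * y^-1)%g.

Definition maximal_parabolic (r : 'I_3) : set G :=
  smallest subgroup
    (borel `|` \bigcup_(j in [set j | j != r]) reflection_rep j).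

(* The third simple root has index [ord_max : 'I_3]. *)
Definition P_alpha3 : set G := maximal_parabolic ord_max.

(* P_alpha3 preserves the line of weight
   varpi3 = (eps1 + eps2 + eps3) / 2 and acts on it by this character. *)
Definition varpi3 (p : G) : C := dcoef 0 p.

Definition regular (f : G -> C) : Prop :=
  exists p : {mpoly C[8 * 8]},
    forall g : G, f g = p.@[fun k => mxvec (val g) 0 k].

(* H^0(G / P_alpha3, L_(m varpi3)).  With [B] attached to the positive roots,
   this sign convention is the one for which L_(varpi3) is ample. *)
Definition sections (m : nat) : set (G -> C) :=
  [set f | regular f /\
     forall g p, P_alpha3 p -> f (g * p)%g = varpi3 p ^+ m * f g].

(* The sections fixed by T, which acts by left translation. *)
Definition invariants (m : nat) : set (G -> C) :=
  [set f | sections m f /\ forall t g, torus t -> f (t * g)%g = f g].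

Lemma regular_cst c : regular (cst c).
Proof. by exists c%:MP => g; rewrite mevalC. Qed.

Lemma regularD f f' : regular f -> regular f' -> regular (f + f').
Proof.
by move=> [p fp] [p' fp']; exists (p + p') => g; rewrite mevalD -fp -fp'.
Qed.

Lemma regularN f : regular f -> regular (- f).
Proof. by move=> [p fp]; exists (- p) => g; rewrite mevalN -fp. Qed.

Lemma regularM f f' : regular f -> regular f' -> regular (f * f').
Proof.
by move=> [p fp] [p' fp']; exists (p * p') => g; rewrite mevalM -fp -fp'.
Qed.

Lemma invariants1 : invariants 0 1.
Proof.
split=> //; split; first exact: regular_cst.
by move=> g p _; rewrite expr0 mul1r.
Qed.

Lemma invariants0 m : invariants m 0.
Proof.
split=> //; split; first exact: regular_cst.
by move=> g p _; rewrite mulr0.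
Qed.

Lemma invariantsB m f f' :
  invariants m f -> invariants m f' -> invariants m (f - f').
Proof.
move=> [[rf sf] tf] [[rf' sf'] tf']; split; last first.
  by move=> t g Tt; rewrite !fctE tf // tf'.
split; first by apply: regularD => //; exact: regularN.
by move=> g p Pp; rewrite !fctE sf // sf' // mulrBr.
Qed.

Lemma invariantsD m f f' :
  invariants m f -> invariants m f' -> invariants m (f + f').
Proof.
move=> If If'; rewrite -[f']opprK; apply: invariantsB => //.
by rewrite -sub0r; apply: invariantsB => //; exact: invariants0.
Qed.

Lemma invariantsM m m' f f' :
  invariants m f -> invariants m' f' -> invariants (m + m') (f * f').
Proof.
move=> [[rf sf] tf] [[rf' sf'] tf']; split; last first.
  by move=> t g Tt; rewrite !fctE tf // tf'.
split; first exact: regularM.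
by move=> g p Pp; rewrite !fctE sf // sf' // exprD mulrACA.
Qed.

(* The direct sum over k of H^0(G / P_alpha3, L_(d varpi3)^k)^T, realized
   inside polynomials: the dummy variable records the degree k. *)
Definition git_pred (d : nat) : {pred {poly (G -> C)}} :=
  fun u => `[< forall k, invariants (d * k) u`_k >].

Lemma git_pred_subring d : subring_closed (git_pred d).
Proof.
split.
- apply/asboolP => k; rewrite coef1; case: k => [|k] /=.
    by rewrite muln0; exact: invariants1.
  exact: invariants0.
- move=> u v /asboolP iu /asboolP iv; apply/asboolP => k.
  by rewrite coefB; exact: invariantsB.
- move=> u v /asboolP iu /asboolP iv; apply/asboolP => k.
  rewrite coefM; elim/big_rec: _ => [|j f _ If]; first exact: invariants0.
  apply: invariantsD => //.
  have -> : (d * k = d * j + d * (k - j))%N.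
    by rewrite -mulnDr subnKC // -ltnS.
  exact: invariantsM.
Qed.

HB.instance Definition _ d :=
  GRing.isSubringClosed.Build _ (git_pred d) (git_pred_subring d).

Record git_ring (d : nat) := MkGitRing {
  git_val :> {poly (G -> C)};
  _ : git_val \in git_pred d }.

HB.instance Definition _ d := [isSub for @git_val d].
HB.instance Definition _ d := [Choice of git_ring d by <:].
HB.instance Definition _ d :=
  [SubChoice_isSubComNzRing of git_ring d by <:].

Definition Csubalgebra (S : set {poly (G -> C)}) : Prop :=
  [/\ forall c : C, S (cst c)%:P,
      forall u v, S u -> S v -> S (u + v)
    & forall u v, S u -> S v -> S (u * v)].

Definition generated_in_degree_one (d : nat) : Prop :=
  forall u : git_ring d,
    smallest Csubalgebra [set f *: 'X | f in invariants d] (git_val u).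

End Quotient.

(* [A] is a domain, and every element of its field of fractions that is
   integral over [A] lies in [A]; [K] ranges over all the realizations of that
   field. *)
Definition integrally_closed (A : comNzRingType) : Prop :=
  (forall x y : A, x * y = 0 -> x = 0 \/ y = 0) /\
  forall (K : fieldType) (iota : {rmorphism A -> K}),
    injective iota ->
    (forall u : K, exists a b : A, u = iota a / iota b) ->
    forall u : K, integralOver iota u -> exists a : A, u = iota a.

(* Projective normality of the GIT quotient of G / P_alpha3 by T, polarized by
   the descent of L_(d varpi3): the homogeneous coordinate ring of this
   polarized variety is [git_ring h d]. *)
Definition git_quotient_projectively_normal
    (C : numClosedFieldType) (h : Spin7 C) (d : nat) : Prop :=
  integrally_closed (git_ring h d) /\ generated_in_degree_one h d.

(* Main.v *)
From HB Require Import structures.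
Require Import Defs.
From mathcomp Require Import all_boot all_order all_algebra.
From mathcomp Require Import complex reals.
From mathcomp Require Import mpoly boolp classical_sets functions ring zify.

(** Let X_0, ..., X_7 be the coordinates of the image of the highest weight vector
under g.  They satisfy X_0 X_7 = X_1 X_6 - X_2 X_5 + X_3 X_4, and the
monomials of weight zero in them are generated by the products
Y_i = X_i X_(7-i) and by the two tetrahedra T_0 = X_0 X_3 X_5 X_6 and
T_1 = X_1 X_2 X_4 X_7, with T_0 T_1 = Y_0 Y_1 Y_2 Y_3.  As Y_0 is a linear
combination of Y_1, Y_2, Y_3, the expected ring of invariants is
S = C[Y_1, Y_2, Y_3, T_0, T_1] / (T_0 T_1 - Y_0 Y_1 Y_2 Y_3), and its degrees
divisible by 4 are visibly generated by the Y_i Y_j, T_0 and T_1.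

Restricting an invariant f to a slice X_0 = X_3 = X_5 = X_6 = 1 of the open
cell gives an even polynomial in Y_1, Y_2, Y_3, so T_0^N f is a polynomial in
Y and T_0 on a nonempty open set, hence everywhere because the group is
irreducible.  The longest Weyl group element exchanges T_0 and T_1, so T_1^N f
is a polynomial in Y and T_1.  Comparing the two expressions as Laurent
polynomials in T_0 shows that f is the sum of a polynomial in Y, T_0 and of a
polynomial in Y, T_1.

Likewise, if a / b is integral over the ring, then b divides a after
restriction to the slice, since polynomial rings are integrally closed; thus b
divides both T_0^N a and T_1^N a, and the same comparison shows that b divides
a. *)

Set Implicit Arguments.
Unset Strict Implicit.
Unset Printing Implicit Defensive.
Import Order.TTheory GRing.Theory Num.Theory.
Local Open Scope ring_scope.

(** * Integral closedness of polynomial rings *)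

(** Behind the restriction to the slice is a factorization: for generic g and a fourth root s of
    T_0(g), some t in the torus gives t g = u p, with u in the slice and p in the parabolic acting
    by s on the highest weight line, so that f(g) = s^m f(u). The slice coordinates of u are Y_i /
    s^2. Replacing s by i s changes their signs but not T_0 = s^4; this is the source of the
    evenness when 4 divides m. The obstacle is that the parabolic is given only by generators. That
    it preserves the highest weight line is checked on them; conversely, an element preserving this
    line is brought into the Borel subgroup by explicit lower root elements, at the price of the
    non-vanishing of some minors. The group itself consists of words in unit vectors, so its
    irreducibility is obtained by joining elements along rational curves. Comparing Laurent
    polynomials is legitimate because (Y, T_0) takes every value with T_0 nonzero. Each chart leaves
    a power of one tetrahedron in the denominator, and only the comparison of two charts removes
    it. *)

Definition hom_eq (R : comNzRingType) (p : {poly R}) (a b : R) : R :=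
  \sum_(i < size p) p`_i * a ^+ i * b ^+ ((size p).-1 - i).

(** Integral closedness written inside [R]: for [p] monic of degree n, [hom_eq p a b] is b^n p(a /
    b), so no fraction field has to be carried along ring morphisms. *)
Definition quot_closed (R : idomainType) : Prop :=
  forall (p : {poly R}) (a b : R), p \is monic -> b != 0 ->
    hom_eq p a b = 0 -> exists q, a = b * q.

Lemma hom_eq_map (R S : comNzRingType) (f : {rmorphism R -> S}) p a b :
  p \is monic -> hom_eq (map_poly f p) (f a) (f b) = f (hom_eq p a b).
Proof.
move=> mp; rewrite /hom_eq rmorph_sum size_map_poly_id0; last first.
  by rewrite (monicP mp) rmorph1 oner_neq0.
by apply: eq_bigr => i _; rewrite !rmorphM !rmorphXn coef_map.
Qed.

Lemma hom_eqM (R : comNzRingType) (p : {poly R}) a b d :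
  hom_eq p (a * d) (b * d) = hom_eq p a b * d ^+ (size p).-1.
Proof.
rewrite /hom_eq mulr_suml; apply: eq_bigr => i _.
have -> : d ^+ (size p).-1 = d ^+ i * d ^+ ((size p).-1 - i).
  rewrite -exprD subnKC //; case: (size p) i => [[]//|n [i Hi]]; exact: Hi.
by rewrite !exprMn; ring.
Qed.

(** Rational root argument: once the gcd is divided out, the leading term shows that [b1] divides a
    power of [a1], and coprimality makes [b1] a unit. *)
Lemma hom_eq_divides (F : fieldType) (p : {poly {poly F}}) (a b : {poly F}) :
  p \is monic -> b != 0 -> hom_eq p a b = 0 -> (b %| a)%R.
Proof.
move=> mp b0.
have [d [a1 [b1 [d0 -> Eb cop]]]] : exists d a1 b1,
    [/\ d != 0, a = a1 * d, b = b1 * d & coprimep b1 a1].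
  exists (gcdp a b), (a %/ gcdp a b), (b %/ gcdp a b); split.
  - by rewrite gcdp_eq0 negb_and b0 orbT.
  - by rewrite divpK ?dvdp_gcdl.
  - by rewrite divpK ?dvdp_gcdr.
  - by rewrite coprimep_sym coprimep_div_gcd // b0 orbT.
rewrite {}Eb in b0 *; rewrite hom_eqM => /eqP.
rewrite mulf_eq0 expf_eq0 (negbTE d0) andbF orbF => /eqP E.
have [n sp] : exists n, size p = n.+1.
  exists (size p).-1; rewrite prednK // size_poly_gt0; exact: monic_neq0.
have pn : p`_n = 1 by have := monicP mp; rewrite /lead_coef sp.
have D : (b1 %| a1 ^+ n)%R.
  move: E; rewrite /hom_eq sp big_ord_recr /= subnn expr0 mulr1 pn mul1r.
  move/eqP; rewrite addrC addr_eq0 => /eqP ->; rewrite dvdpNr.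
  elim/big_rec: _ => [|i x _ Dx]; first exact: dvdp0.
  apply: dvdp_add => //; apply: dvdp_mull.
  by rewrite -(@prednK (n - i)%N) ?subn_gt0 // exprS dvdp_mulr.
have cn : coprimep b1 (a1 ^+ n) by exact: coprimep_expr.
have b1_1 : b1 %= 1.
  have := dvdp_gcd_idl D; rewrite /eqp => /andP[_ H].
  rewrite /eqp dvd1p andbT; apply: (dvdp_trans H).
  by move: cn; rewrite coprimep_def size_poly_eq1 /eqp => /andP[].
by apply: dvdp_mul => //; rewrite (eqp_dvdl _ b1_1) dvd1p.
Qed.

(** Differences of distinct integers become units, so the integers can serve as interpolation nodes
    over a ring that is not a field. *)
Definition char0_units (R : unitRingType) : Prop :=
  forall n, n.+1%:R \is a @GRing.unit R.

Lemma natr_sub_unit (R : unitRingType) (m n : nat) :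
  char0_units R -> m != n -> (m%:R - n%:R : R) \is a GRing.unit.
Proof.
move=> H; case: (ltngtP m n) => // [lt|lt] _.
  rewrite -opprB unitrN -natrB ?(ltnW lt) // -(@prednK (n - m)) ?subn_gt0 //.
rewrite -natrB ?(ltnW lt) // -(@prednK (m - n)) ?subn_gt0 //.
Qed.

(* Newton interpolation with nodes whose differences are units. *)
Lemma interpolation_over (R : idomainType) (F : fieldType)
    (f : {rmorphism R -> F}) (s : seq R) (q : {poly F}) :
  pairwise (fun x y => x - y \is a GRing.unit) s ->
  (size q <= size s)%N ->
  (forall x, x \in s -> exists r, q.[f x] = f r) ->
  exists q' : {poly R}, q = map_poly f q'.
Proof.
elim: s q => [|x s IH] q /=.
  by move=> _; rewrite leqn0 size_poly_eq0 => /eqP -> _; exists 0; rewrite rmorph0.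
case/andP=> /allP xs ps sz ev.
have [c Ec] := ev x (mem_head _ _).
have : root (q - (f c)%:P) (f x) by rewrite rootE !hornerE Ec subrr.
case/factor_theorem => q1 E.
have {}E : q = q1 * ('X - (f x)%:P) + (f c)%:P by rewrite -E subrK.
have sz1 : (size q1 <= size s)%N.
  have [->|q1n] := eqVneq q1 0; first by rewrite size_poly0.
  rewrite -ltnS; apply: leq_trans sz; rewrite E.
  rewrite size_polyDl size_Mmonic ?monicXsubC // ?size_XsubC ?addn2 //=.
  by apply: leq_ltn_trans (size_polyC_leq1 _) _; rewrite ltnS size_poly_gt0.
have [|q1' Eq1] := IH q1 ps sz1; last first.
  by exists (q1' * ('X - x%:P) + c%:P);
    rewrite E Eq1 rmorphD rmorphM rmorphB /= map_polyX !map_polyC.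
move=> y ys; have [d Ed] := ev y (mem_behead (s := x :: s) ys).
have u := xs y ys.
exists ((d - c) / (y - x)).
have u' : y - x \is a GRing.unit by rewrite -opprB unitrN.
have fu : f (y - x) != 0 by rewrite -unitfE rmorph_unit.
apply: (mulIf fu); rewrite -rmorphM divrK // [RHS]rmorphB -Ed E !hornerE addrK.
by rewrite rmorphB.
Qed.

(* The values of the quotient at scalars lie in [R]; interpolation recovers its
   coefficients. *)
Lemma quot_closed_poly (R : idomainType) :
  char0_units R -> quot_closed R -> quot_closed {poly R}.
Proof.
move=> ch qc p a b mp b0 E.
pose f : {rmorphism R -> {fraction R}} := @FracField.tofrac R.
have fI : injective f by move=> x y /eqP; rewrite tofrac_eq => /eqP.
pose F := map_poly f.
have FI : injective F by exact: map_inj_poly (rmorph0 f).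
have : (F b %| F a)%R.
  apply: (@hom_eq_divides _ (map_poly F p)).
  - exact: monic_map.
  - by rewrite -(rmorph0 F) (inj_eq FI).
  - by rewrite (hom_eq_map F) // E rmorph0.
case/dvdpP => q Eq.
have [s [ps sb ss]] : exists s : seq R,
    [/\ pairwise (fun x y => x - y \is a GRing.unit) s,
        all (fun x => b.[x] != 0) s & (size q <= size s)%N].
  have rn : forall m n, m != n -> (m%:R - n%:R : R) \is a GRing.unit.
    by move=> m n; exact: natr_sub_unit.
  (* At most [size b] of these integers are roots of [b], so at least [size q] nodes remain. *)
  pose t := [seq (i%:R : R) | i <- iota 0 (size b + size q)].
  have pt : pairwise (fun x y : R => x - y \is a GRing.unit) t.
    rewrite pairwise_map.
    have := iota_uniq 0 (size b + size q); rewrite uniq_pairwise.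
    by apply: sub_pairwise => i j; exact: rn.
  have ut : uniq t.
    rewrite uniq_pairwise; apply: sub_pairwise pt => x y /=.
    by apply: contraTneq => ->; rewrite subrr unitr0.
  exists (filter (fun x => b.[x] != 0) t); split.
  - exact: pairwise_filter.
  - exact: filter_all.
  have H1 : (count (root b) t <= size b)%N.
    rewrite -size_filter; apply: ltnW; apply: max_poly_roots => //.
      by apply/allP => x; rewrite mem_filter => /andP[].
    by rewrite filter_uniq.
  rewrite size_filter -(leq_add2l (count (root b) t)).
  have -> : count (fun x => b.[x] != 0) t = count (predC (root b)) t by [].
  by rewrite count_predC size_map size_iota leq_add2r.
have [x xs|q' Eq'] := @interpolation_over R _ f s q ps ss.
  have bx := allP sb x xs.
  have [|||r Er] := qc (map_poly (horner_eval x) p) a.[x] b.[x].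
  - exact: monic_map.
  - exact: bx.
  - by rewrite (hom_eq_map (horner_eval x)) // E rmorph0.
  exists r; have fb : f b.[x] != 0 by rewrite -(rmorph0 f) (inj_eq fI).
  have Er' : f a.[x] = f b.[x] * f r by rewrite Er rmorphM.
  apply: (mulIf fb); rewrite [RHS]mulrC -Er'.
  by rewrite -!horner_map -/F Eq hornerM.
have FM : F (b * q') = F b * F q' by exact: rmorphM.
by exists q'; apply: FI; rewrite FM Eq mulrC Eq'.
Qed.

Lemma quot_closed_field (F : fieldType) : quot_closed F.
Proof. by move=> p a b _ b0 _; exists (a / b); rewrite mulrC divfK. Qed.

(** * Multivariate polynomials as polynomials in their last variable *)

Section Muni.
Variables (n : nat) (R : comNzRingType).

(** Inverse of [muni]; through it integral closedness climbs one variable at a time. *)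
Definition mmulti_hom : {poly {mpoly R[n]}} -> {mpoly R[n.+1]} :=
  horner_eval 'X_ord_max \o map_poly (@mwiden n R).

HB.instance Definition _ := GRing.RMorphism.on mmulti_hom.

Lemma mmulti_homX : mmulti_hom 'X = 'X_ord_max.
Proof. by rewrite /mmulti_hom /= map_polyX /horner_eval hornerX. Qed.

Lemma mmulti_homC p : mmulti_hom p%:P = mwiden p.
Proof. by rewrite /mmulti_hom /= map_polyC /horner_eval hornerC. Qed.

Lemma muniX_max : muni ('X_ord_max : {mpoly R[n.+1]}) = 'X.
Proof.
rewrite muniE msuppX big_seq1 mcoeffX eqxx scale1r mnm1E eqxx expr1.
rewrite (_ : [multinom _ | _ < _] = 0%MM) ?mpolyX0 ?scale1r //.
by apply/mnmP => i; rewrite !mnmE -val_eqE /= gtn_eqF.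
Qed.

Lemma muni_widen (p : {mpoly R[n]}) : muni (mwiden p) = p%:P.
Proof.
elim/mpolyind: p => [|c m p _ _ IH]; first by rewrite !rmorph0.
rewrite !rmorphD /= IH; congr (_ + _).
rewrite mwidenZ muniZ mwidenX muniE msuppX big_seq1 mcoeffX eqxx scale1r.
rewrite mnmwiden_ordmax expr0 alg_polyC -mul_polyC -polyCM mul_mpolyC.
congr (_ *: 'X_[_])%:P; apply/mnmP => i; rewrite mnmE.
exact: mnmwiden_widen.
Qed.

Lemma mmulti_homK : cancel mmulti_hom (@muni n R).
Proof.
elim/poly_ind => [|p c IH]; first by rewrite !rmorph0.
rewrite !rmorphD !rmorphM /= IH mmulti_homX mmulti_homC.
by rewrite muniX_max muni_widen.
Qed.

Lemma mmulti_homD : {morph mmulti_hom : p q / p + q}.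
Proof. exact: rmorphD. Qed.

Lemma mmulti_homZ (q : {mpoly R[n]}) (u : {poly {mpoly R[n]}}) :
  mmulti_hom (q *: u) = mwiden q * mmulti_hom u.
Proof. by rewrite -[q *: u]mul_polyC rmorphM /= mmulti_homC. Qed.

Lemma muniK : cancel (@muni n R) mmulti_hom.
Proof.
elim/mpolyind => [|c m p _ _ IH]; first by rewrite !rmorph0.
have E : mmulti_hom (muni 'X_[m]) = 'X_[m].
  rewrite muniE msuppX big_seq1 mcoeffX eqxx scale1r mmulti_homZ rmorphXn /=.
  rewrite mmulti_homX mwidenX mpolyXn -mpolyXD; congr 'X_[_]; apply/mnmP => i.
  rewrite mnmDE mulmnE mnm1E.
  case: (unliftP ord_max i) => [j ->|->]; last first.
    by rewrite mnmwiden_ordmax eqxx mul1n.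
  have -> : lift ord_max j = widen_ord (leqnSn n) j.
    by apply: val_inj; rewrite /= /bump leqNgt ltn_ord.
  rewrite mnmwiden_widen mnmE (_ : ord_max == _ = false) ?addn0 //.
  by rewrite -val_eqE /= gtn_eqF.
rewrite muniD mmulti_homD muniZ mmulti_homZ.
apply: etrans (congr2 +%R (congr1 ( *%R _) E) IH) _.
by rewrite mwidenC mul_mpolyC.
Qed.

End Muni.

Lemma char0_units_mpoly (R : idomainType) n :
  char0_units R -> char0_units {mpoly R[n]}.
Proof.
move=> H m; rewrite -(rmorph_nat (@mpolyC n R)); exact: rmorph_unit.
Qed.

Lemma mpoly0_const (R : comNzRingType) (v : 'I_0 -> R) (p : {mpoly R[0]}) :
  (p.@[v])%:MP = p.
Proof.
elim/mpolyind: p => [|c m p _ _ IH]; first by rewrite !raddf0.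
rewrite !rmorphD /= IH mevalZ mevalX big_ord0 mulr1.
rewrite (_ : m = 0%MM) ?mpolyX0 ?alg_mpolyC //.
by apply/mnmP; case.
Qed.

Lemma quot_closed_mpoly (R : idomainType) n :
  char0_units R -> quot_closed R -> quot_closed {mpoly R[n]}.
Proof.
move=> ch qR; elim: n => [|n IH] p a b mp b0 E.
  pose f := @mpolyC 0 R; pose g : {mpoly R[0]} -> R := meval (fun=> 0).
  have gK x : f (g x) = x by exact: mpoly0_const.
  have [|||q Eq] := qR (map_poly g p) (g a) (g b).
  - exact: monic_map.
  - by apply: contraNneq b0 => gb; rewrite -(gK b) gb /f mpolyC0.
  - by rewrite hom_eq_map // E rmorph0.
  by exists (f q); rewrite -(gK a) Eq /f mpolyCM -/f gK.
have QP := quot_closed_poly (@char0_units_mpoly R n ch) IH.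
pose f : {rmorphism {mpoly R[n.+1]} -> {poly {mpoly R[n]}}} := @muni n R.
have fI : injective f := can_inj (@muniK n R).
have [|||q Eq] := QP (map_poly f p) (f a) (f b).
- exact: monic_map.
- by rewrite -(rmorph0 f) (inj_eq fI).
- by rewrite hom_eq_map // E rmorph0.
exists (mmulti_hom q); apply: fI.
have -> : f (b * mmulti_hom q) = f b * f (mmulti_hom q) by exact: muniM.
by rewrite Eq; congr (_ * _); rewrite [RHS]mmulti_homK.
Qed.

Lemma meval_muni n (R : comNzRingType) (v : 'I_n.+1 -> R) (p : {mpoly R[n.+1]}) :
  p.@[v] = (map_poly (meval (v \o widen_ord (leqnSn n))) (muni p)).[v ord_max].
Proof.
set v' := v \o _; pose F u := (map_poly (meval v') u).[v ord_max].
have FD x y : F (x + y) = F x + F y by rewrite /F rmorphD hornerD.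
have FZ c x : F (c *: x) = c.@[v'] * F x.
  by rewrite /F -mul_polyC rmorphM /= map_polyC hornerM hornerC.
rewrite -/(F _); elim/mpolyind: p => [|c m p _ _ IH].
  by rewrite muni0 /F !raddf0 horner0.
have E : ('X_[m]).@[v] = F (muni 'X_[m]).
  rewrite muniE msuppX big_seq1 mcoeffX eqxx scale1r FZ.
  rewrite /F map_polyXn hornerXn !mevalX big_ord_recr /=; congr (_ * _).
  by apply: eq_bigr => i _; rewrite mnmE.
rewrite mevalD mevalZ muniD FD muniZ FZ mevalC.
by apply: congr2 IH; apply: congr1 E.
Qed.

Lemma poly_eval_eq0 (R : idomainType) (p : {poly R}) :
  char0_units R -> (forall x : R, p.[x] = 0) -> p = 0.
Proof.
move=> ch H; apply/eqP; apply: contraT => p0.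
pose t := [seq (i%:R : R) | i <- iota 0 (size p)].
have := @max_poly_roots _ p t p0; rewrite size_map size_iota ltnn => ->//.
  by apply/allP => x _; apply/rootP.
rewrite map_inj_uniq ?iota_uniq // => i j Eij.
apply/eqP; apply: contraT => /(natr_sub_unit ch).
by rewrite Eij subrr unitr0.
Qed.

Lemma meval_eq0 (R : idomainType) n (p : {mpoly R[n]}) :
  char0_units R -> (forall v, p.@[v] = 0) -> p = 0.
Proof.
move=> ch; elim: n p => [|n IH] p H.
  by rewrite -[p](mpoly0_const (fun=> 0)) H mpolyC0.
apply: (can_inj (@muniK n R)); rewrite rmorph0; apply/polyP => i.
rewrite coef0; apply: IH => v.
have : map_poly (meval v) (muni p) = 0.
  apply: poly_eval_eq0 => // x.
  pose w (i : 'I_n.+1) := if unlift ord_max i is Some j then v j else x.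
  have := H w; rewrite meval_muni /w unlift_none.
  rewrite (_ : map_poly _ _ = map_poly (meval v) (muni p)) //.
  apply: eq_map_poly => q; apply: meval_eq => j /=.
  have -> : widen_ord (leqnSn n) j = lift ord_max j.
    by apply: val_inj; rewrite /= /bump leqNgt ltn_ord.
  by rewrite liftK.
by move/polyP/(_ i); rewrite coef_map coef0.
Qed.

(** * The spin module in coordinates *)

Section SpinModule.
Variable C : fieldType.
Implicit Types (v w : 'rV[C]_7) (A B : 'M[C]_8).

Definition coln n (s : seq C) : 'cV[C]_n := \col_i s`_i.

Lemma coln_cat n s s' : size s = n ->
  coln (n + n) (s ++ s') = col_mx (coln n s) (coln n s').
Proof.
move=> sz; apply/colP => i; rewrite mxE nth_cat sz mxE.
by case: splitP => j ->; rewrite mxE // addKn.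
Qed.

Lemma colnD n s s' : size s = n -> size s' = n ->
  coln n s + coln n s' = coln n [seq x.1 + x.2 | x <- zip s s'].
Proof.
move=> sz sz'; apply/colP => i; rewrite !mxE (nth_map 0) ?nth_zip ?sz ?sz' //.
by rewrite size_zip sz sz' minnn.
Qed.

Lemma colnN n s : size s = n -> - coln n s = coln n [seq - x | x <- s].
Proof. by move=> sz; apply/colP => i; rewrite !mxE (nth_map 0) ?sz. Qed.

Lemma scalar_coln n a s : size s = n ->
  a%:M *m coln n s = coln n [seq a * x | x <- s].
Proof.
by move=> sz; rewrite mul_scalar_mx; apply/colP => i; rewrite !mxE (nth_map 0) ?sz.
Qed.

Lemma clifford_step_col n (X : 'M[C]_n) a b s s' :
  size s = n -> size s' = n ->
  clifford_step X a b *m coln (n + n) (s ++ s') =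
  col_mx (X *m coln n s + coln n [seq a * x | x <- s'])
         (coln n [seq b * x | x <- s] - X *m coln n s').
Proof.
move=> sz sz'; rewrite coln_cat // /clifford_step mul_block_col.
by rewrite !scalar_coln // mulNmx.
Qed.

Definition vec7 (a1 a2 a3 c b3 b2 b1 : C) : 'rV[C]_7 :=
  \row_i [:: a1; a2; a3; c; b3; b2; b1]`_i.

(** Matrix identities are checked on a column with explicit entries, which turns each of them into
    eight ring identities. *)
Definition c8 (x0 x1 x2 x3 x4 x5 x6 x7 : C) : 'cV[C]_8 :=
  coln 8 [:: x0; x1; x2; x3; x4; x5; x6; x7].

Lemma gamma_c8_subproof a1 a2 a3 c b3 b2 b1 x0 x1 x2 x3 x4 x5 x6 x7 :
  gamma (vec7 a1 a2 a3 c b3 b2 b1) *m c8 x0 x1 x2 x3 x4 x5 x6 x7 =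
  c8 (c * x0 + a3 * x1 + a2 * x2 + a1 * x4)
     (b3 * x0 - c * x1 + a2 * x3 + a1 * x5)
     (b2 * x0 - c * x2 - a3 * x3 + a1 * x6)
     (b2 * x1 - b3 * x2 + c * x3 + a1 * x7)
     (b1 * x0 - c * x4 - a3 * x5 - a2 * x6)
     (b1 * x1 - b3 * x4 + c * x5 - a2 * x7)
     (b1 * x2 - b2 * x4 + c * x6 + a3 * x7)
     (b1 * x3 - b2 * x5 + b3 * x6 - c * x7).
Proof.
rewrite /gamma !mxE !inordK //=.
have E1 y z : @clifford_step C 1 c%:M a3 b3 *m coln 2 [:: y; z] =
    coln 2 [:: c * y + a3 * z; b3 * y - c * z].
  rewrite (@clifford_step_col 1 c%:M a3 b3 [:: y] [:: z]) // !scalar_coln //=.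
  by rewrite colnN // !colnD //= -coln_cat.
have E2 y0 y1 y2 y3 : @clifford_step C 2 (@clifford_step C 1 c%:M a3 b3) a2 b2
    *m coln 4 [:: y0; y1; y2; y3] =
    coln 4 [:: c * y0 + a3 * y1 + a2 * y2; b3 * y0 - c * y1 + a2 * y3;
      b2 * y0 - (c * y2 + a3 * y3); b2 * y1 - (b3 * y2 - c * y3)].
  rewrite (@clifford_step_col 2 _ a2 b2 [:: y0; y1] [:: y2; y3]) //.
  by rewrite !E1 /= colnN // !colnD //= -coln_cat.
rewrite /c8 (@clifford_step_col 4 _ a1 b1 [:: x0; x1; x2; x3] [:: x4; x5; x6; x7]) //.
rewrite !E2 /= colnN // !colnD //= -coln_cat //=.
congr (coln _ [:: _; _; _; _; _; _; _; _]); ring.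
Qed.

Lemma c8P (u : 'cV[C]_8) : exists x0 x1 x2 x3 x4 x5 x6 x7,
  u = c8 x0 x1 x2 x3 x4 x5 x6 x7.
Proof.
exists (u (inord 0) 0), (u (inord 1) 0), (u (inord 2) 0), (u (inord 3) 0).
exists (u (inord 4) 0), (u (inord 5) 0), (u (inord 6) 0), (u (inord 7) 0).
apply/colP => i; rewrite mxE -[in LHS](inord_val i).
by case: i; do 8![case=> //].
Qed.

Lemma vec7P v : exists a1 a2 a3 c b3 b2 b1, v = vec7 a1 a2 a3 c b3 b2 b1.
Proof.
exists (v 0 (inord 0)), (v 0 (inord 1)), (v 0 (inord 2)), (v 0 (inord 3)).
exists (v 0 (inord 4)), (v 0 (inord 5)), (v 0 (inord 6)).
apply/rowP => i; rewrite mxE -[in LHS](inord_val i).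
by case: i; do 7![case=> //].
Qed.

Lemma c8_inj x0 x1 x2 x3 x4 x5 x6 x7 y0 y1 y2 y3 y4 y5 y6 y7 :
  c8 x0 x1 x2 x3 x4 x5 x6 x7 = c8 y0 y1 y2 y3 y4 y5 y6 y7 ->
  [/\ x0 = y0, x1 = y1, x2 = y2 & x3 = y3] /\
  [/\ x4 = y4, x5 = y5, x6 = y6 & x7 = y7].
Proof.
move=> /colP E.
have := (E (inord 0), E (inord 1), E (inord 2), E (inord 3)).
have := (E (inord 4), E (inord 5), E (inord 6), E (inord 7)).
by rewrite !mxE !inordK //= => -[[[-> ->] ->] ->] [[[-> ->] ->] ->].
Qed.

Lemma mx8P A B :
  (forall x0 x1 x2 x3 x4 x5 x6 x7,
    A *m c8 x0 x1 x2 x3 x4 x5 x6 x7 = B *m c8 x0 x1 x2 x3 x4 x5 x6 x7) -> A = B.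
Proof.
move=> E; apply/trmx_inj/row_matrixP => i; rewrite -!tr_col; congr _^T.
rewrite !colE; case: (c8P (delta_mx i 0)) => x0 [x1 [x2 [x3 [x4 [x5 [x6 [x7 ->]]]]]]].
exact: E.
Qed.

Lemma c8D x0 x1 x2 x3 x4 x5 x6 x7 y0 y1 y2 y3 y4 y5 y6 y7 :
  c8 x0 x1 x2 x3 x4 x5 x6 x7 + c8 y0 y1 y2 y3 y4 y5 y6 y7 =
  c8 (x0 + y0) (x1 + y1) (x2 + y2) (x3 + y3)
     (x4 + y4) (x5 + y5) (x6 + y6) (x7 + y7).
Proof. by rewrite /c8 colnD. Qed.

Lemma c8Z a x0 x1 x2 x3 x4 x5 x6 x7 :
  a *: c8 x0 x1 x2 x3 x4 x5 x6 x7 =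
  c8 (a * x0) (a * x1) (a * x2) (a * x3) (a * x4) (a * x5) (a * x6) (a * x7).
Proof. by rewrite /c8 -mul_scalar_mx scalar_coln. Qed.

Lemma vec7D a1 a2 a3 c b3 b2 b1 a1' a2' a3' c' b3' b2' b1' :
  vec7 a1 a2 a3 c b3 b2 b1 + vec7 a1' a2' a3' c' b3' b2' b1' =
  vec7 (a1 + a1') (a2 + a2') (a3 + a3') (c + c')
       (b3 + b3') (b2 + b2') (b1 + b1').
Proof. by apply/rowP => i; rewrite !mxE; case: i; do 7![case=> //]. Qed.

Lemma vec7Z a a1 a2 a3 c b3 b2 b1 :
  a *: vec7 a1 a2 a3 c b3 b2 b1 =
  vec7 (a * a1) (a * a2) (a * a3) (a * c) (a * b3) (a * b2) (a * b1).
Proof. by apply/rowP => i; rewrite !mxE; case: i; do 7![case=> //]. Qed.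

Lemma qform_vec7 a1 a2 a3 c b3 b2 b1 :
  qform (vec7 a1 a2 a3 c b3 b2 b1) = c ^+ 2 + a1 * b1 + a2 * b2 + a3 * b3.
Proof. by rewrite /qform !mxE !inordK. Qed.

(* [gamma] is sealed so that unification never unfolds its block structure. *)
Fact gam_key : {f : 'rV[C]_7 -> 'M[C]_8 | f = @gamma C}.
Proof. by exists (@gamma C). Qed.

Definition gam : 'rV[C]_7 -> 'M[C]_8 := sval gam_key.

Lemma gamE : gam = @gamma C.
Proof. exact: svalP gam_key. Qed.

Lemma gam_c8 a1 a2 a3 c b3 b2 b1 x0 x1 x2 x3 x4 x5 x6 x7 :
  gam (vec7 a1 a2 a3 c b3 b2 b1) *m c8 x0 x1 x2 x3 x4 x5 x6 x7 =
  c8 (c * x0 + a3 * x1 + a2 * x2 + a1 * x4)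
     (b3 * x0 - c * x1 + a2 * x3 + a1 * x5)
     (b2 * x0 - c * x2 - a3 * x3 + a1 * x6)
     (b2 * x1 - b3 * x2 + c * x3 + a1 * x7)
     (b1 * x0 - c * x4 - a3 * x5 - a2 * x6)
     (b1 * x1 - b3 * x4 + c * x5 - a2 * x7)
     (b1 * x2 - b2 * x4 + c * x6 + a3 * x7)
     (b1 * x3 - b2 * x5 + b3 * x6 - c * x7).
Proof. by rewrite gamE gamma_c8_subproof. Qed.

Lemma gam_sqr v : gam v * gam v = (qform v)%:M.
Proof. by rewrite gamE; exact: gamma_sqr. Qed.

Lemma gamD v w : gam (v + w) = gam v + gam w.
Proof.
have [a1 [a2 [a3 [c [b3 [b2 [b1 ->]]]]]]] := vec7P v.
have [a1' [a2' [a3' [c' [b3' [b2' [b1' ->]]]]]]] := vec7P w.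
apply: mx8P => *; rewrite vec7D mulmxDl; erewrite !gam_c8.
by rewrite c8D; congr c8; ring.
Qed.

Lemma gamZ a v : gam (a *: v) = a *: gam v.
Proof.
have [a1 [a2 [a3 [c [b3 [b2 [b1 ->]]]]]]] := vec7P v.
apply: mx8P => *; rewrite vec7Z -scalemxAl.
erewrite !gam_c8.
by rewrite c8Z; congr c8; ring.
Qed.

Lemma gamN v : gam (- v) = - gam v.
Proof. by rewrite -scaleN1r gamZ scaleN1r. Qed.

Definition polar v w := qform (v + w) - qform v - qform w.

Lemma gamma_anticomm v w :
  gam v * gam w + gam w * gam v = (polar v w)%:M.
Proof.
have H (R : nzRingType) (a b x y z : R) :
    (a + b) * (a + b) = x -> a * a = y -> b * b = z -> a * b + b * a = x - y - z.
  move=> <- <- <-.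
  by rewrite mulrDl !mulrDr addrA [RHS]addrAC addrK -(addrA (a * a)) [RHS]addrC addKr.
rewrite /polar !raddfB.
apply: H; [rewrite -gamD| |]; exact: gam_sqr.
Qed.

(** Conjugation by a unit vector is minus the reflection in its orthogonal hyperplane. *)
Lemma gamma_reflection v w : qform v = 1 ->
  gam v * gam w = gam (polar v w *: v - w) * gam v.
Proof.
move=> qv; rewrite gamD gamN gamZ mulrDl mulNr -scalerAl gam_sqr qv.
by rewrite scalemx1 -gamma_anticomm addrK.
Qed.

Lemma spinP A : A \in spin7_pred (C := C) <->
  exists s : seq 'rV[C]_7, [/\ ~~ odd (size s), all (fun v => qform v == 1) s
    & A = \prod_(v <- s) gam v].
Proof. by rewrite gamE; split=> [/asboolP|/asboolP]. Qed.

(** The vector representation: conjugation by each factor maps vectors to vectors, hence so does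
    conjugation by the product. *)
Lemma spin_conj A w : A \in spin7_pred (C := C) ->
  exists w', A * gam w = gam w' * A.
Proof.
move=> /spinP[s [_ us ->]]; elim: s us => [_|v s IH] /=.
  by exists w; rewrite big_nil mul1r mulr1.
case/andP=> /eqP qv /IH[w' E].
exists (polar v w' *: v - w').
by rewrite big_cons -mulrA E mulrA gamma_reflection // mulrA.
Qed.

(** The invariant symmetric form of the spin module, pairing opposite weights. A vector v rescales
    it by -q(v), so an even number of unit vectors preserves it. *)
Definition bform (x y : 'cV[C]_8) : C :=
  x (inord 0) 0 * y (inord 7) 0 - x (inord 1) 0 * y (inord 6) 0
  + x (inord 2) 0 * y (inord 5) 0 - x (inord 3) 0 * y (inord 4) 0
  - x (inord 4) 0 * y (inord 3) 0 + x (inord 5) 0 * y (inord 2) 0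
  - x (inord 6) 0 * y (inord 1) 0 + x (inord 7) 0 * y (inord 0) 0.

Lemma bform_c8 x0 x1 x2 x3 x4 x5 x6 x7 y0 y1 y2 y3 y4 y5 y6 y7 :
  bform (c8 x0 x1 x2 x3 x4 x5 x6 x7) (c8 y0 y1 y2 y3 y4 y5 y6 y7) =
  x0 * y7 - x1 * y6 + x2 * y5 - x3 * y4 - x4 * y3 + x5 * y2 - x6 * y1 + x7 * y0.
Proof. by rewrite /bform !mxE !inordK. Qed.

Lemma bform_gamma v x y :
  bform (gam v *m x) (gam v *m y) = - qform v * bform x y.
Proof.
have [a1 [a2 [a3 [c [b3 [b2 [b1 ->]]]]]]] := vec7P v.
have [x0 [x1 [x2 [x3 [x4 [x5 [x6 [x7 ->]]]]]]]] := c8P x.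
have [y0 [y1 [y2 [y3 [y4 [y5 [y6 [y7 ->]]]]]]]] := c8P y.
erewrite !gam_c8; erewrite !bform_c8; rewrite qform_vec7; ring.
Qed.

Lemma bform_spin A x y : A \in spin7_pred (C := C) ->
  bform (A *m x) (A *m y) = bform x y.
Proof.
move=> /spinP[s [os us ->]].
suff -> : bform ((\prod_(v <- s) gam v) *m x) ((\prod_(v <- s) gam v) *m y)
    = (-1) ^+ odd (size s) * bform x y by rewrite (negbTE os) mul1r.
elim: s us {os} => [_|v s IH] /=; first by rewrite big_nil !mul1mx mul1r.
case/andP=> /eqP qv /IH E; rewrite big_cons -!mulmxA bform_gamma E qv.
by rewrite mulN1r; case: (odd _); rewrite /= ?expr1 ?expr0 ?mulN1r ?mul1r ?opprK.
Qed.

Lemma gamma_pair_spin v w : qform v = 1 -> qform w = 1 ->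
  gam v * gam w \in spin7_pred (C := C).
Proof.
move=> qv qw; apply/spinP; exists [:: v; w]; split=> //=.
  by rewrite qv qw eqxx.
by rewrite !big_cons big_nil mulr1.
Qed.

Lemma qformD v w : qform (v + w) = qform v + qform w + polar v w.
Proof. by rewrite /polar; ring. Qed.

(** Adding to [u] an isotropic vector orthogonal to it gives another unit vector, and the product of
    the two is this unipotent element. *)
Lemma unipotent_spin u e : qform u = 1 -> qform e = 0 -> polar u e = 0 ->
  1 + gam u * gam e \in spin7_pred (C := C).
Proof.
move=> qu qe ue.
have <- : gam u * gam (u + e) = 1 + gam u * gam e.
  by rewrite gamD mulrDr gam_sqr qu.
by apply: gamma_pair_spin => //; rewrite qformD qu qe ue !addr0.
Qed.

(** For long roots [w] is isotropic, so the preceding lemma does not apply to it; it applies to u +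
    w and to -u, and the two elements multiply to the required one. *)
Lemma unipotent_spin2 u w e : qform u = 1 -> qform e = 0 -> polar u e = 0 ->
  qform (u + w) = 1 -> polar w e = 0 -> 1 + gam w * gam e \in spin7_pred (C := C).
Proof.
move=> qu qe ue quw we.
have -> : 1 + gam w * gam e =
    (1 + gam (u + w) * gam e) * (1 + gam (- u) * gam e).
  have ae : gam e * gam u = - (gam u * gam e).
    by apply/eqP; rewrite -addr_eq0 addrC gamma_anticomm ue raddf0.
  (* The cross term contains the square of [gam e], since [gam e] and [gam u] anticommute. *)
  have Z : gam (u + w) * gam e * (gam u * gam e) = 0.
    rewrite -mulrA [gam e * _]mulrA ae mulNr -mulrA gam_sqr qe raddf0.
    by rewrite mulr0 oppr0 mulr0.
  rewrite gamN mulNr mulrDl mul1r mulrDr mulr1 mulrN Z oppr0 addr0.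
  rewrite gamD mulrDl; set x := gam u * _; set y := gam w * _.
  by rewrite -(addrA 1) addKr.
have quN : qform (- u) = 1.
  rewrite -qu; have [a1 [a2 [a3 [c [b3 [b2 [b1 ->]]]]]]] := vec7P u.
  by rewrite -scaleN1r vec7Z; erewrite !qform_vec7; ring.
have pN x : polar (- x) e = - polar x e.
  have [a1 [a2 [a3 [c [b3 [b2 [b1 ->]]]]]]] := vec7P x.
  have [a1' [a2' [a3' [c' [b3' [b2' [b1' ->]]]]]]] := vec7P e.
  by rewrite /polar -scaleN1r vec7Z; erewrite !vec7D; erewrite !qform_vec7; ring.
apply: spin7_predM; apply: unipotent_spin => //.
  rewrite -[RHS](addr0 0) -{1}ue -we.
  have [a1 [a2 [a3 [c [b3 [b2 [b1 ->]]]]]]] := vec7P u.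
  have [a1' [a2' [a3' [c' [b3' [b2' [b1' ->]]]]]]] := vec7P w.
  have [a1_ [a2_ [a3_ [c_ [b3_ [b2_ [b1_ ->]]]]]]] := vec7P e.
  by rewrite /polar; erewrite !vec7D; erewrite !qform_vec7; ring.
by rewrite pN ue oppr0.
Qed.
End SpinModule.

(** * Root subgroups, one-parameter tori and Weyl group representatives *)

Section RootElements.
Variable C : fieldType.
Local Notation spin := (spin7_pred (C := C)).

Definition e1 : 'rV[C]_7 := vec7 1 0 0 0 0 0 0.
Definition e2 : 'rV[C]_7 := vec7 0 1 0 0 0 0 0.
Definition e3 : 'rV[C]_7 := vec7 0 0 1 0 0 0 0.
Definition e0 : 'rV[C]_7 := vec7 0 0 0 1 0 0 0.
Definition f3 : 'rV[C]_7 := vec7 0 0 0 0 1 0 0.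
Definition f2 : 'rV[C]_7 := vec7 0 0 0 0 0 1 0.
Definition f1 : 'rV[C]_7 := vec7 0 0 0 0 0 0 1.

(** For [e] isotropic and orthogonal to [w] the Clifford product squares to zero and this is its
    exponential: a short root element for w = e0, a long one for an isotropic basis vector. *)
Definition unip (w e : 'rV[C]_7) (a : C) : 'M[C]_8 :=
  1 + a *: (gam w * gam e).

Ltac qsolve :=
  rewrite /polar /e0 /e1 /e2 /e3 /f1 /f2 /f3; repeat (erewrite vec7Z || erewrite vec7D);
  repeat erewrite qform_vec7; ring.

Lemma unip_c8 w e a x0 x1 x2 x3 x4 x5 x6 x7 :
  unip w e a *m c8 x0 x1 x2 x3 x4 x5 x6 x7 =
  c8 x0 x1 x2 x3 x4 x5 x6 x7 +
  a *: (gam w *m (gam e *m c8 x0 x1 x2 x3 x4 x5 x6 x7)).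
Proof. by rewrite mulmxDl mul1mx -scalemxAl -mulmxA. Qed.

(** The auxiliary unit vector is [e0]: the other basis vectors are isotropic and orthogonal to it,
    so e0 + w still has norm 1. *)
Lemma unip_spin w e a : w \in [:: e0; e1; e2; e3; f1; f2; f3] ->
  qform e = 0 -> polar e0 e = 0 -> polar w e = 0 -> unip w e a \in spin.
Proof.
move=> ww qe e0e we; rewrite /unip scalerAr -gamZ.
have Z x : polar x (a *: e) = a * polar x e.
  have [a1 [a2 [a3 [c [b3 [b2 [b1 ->]]]]]]] := vec7P x.
  have [a1' [a2' [a3' [c' [b3' [b2' [b1' ->]]]]]]] := vec7P e.
  by qsolve.
have qZ : qform (a *: e) = 0.
  have [a1' [a2' [a3' [c' [b3' [b2' [b1' Ee]]]]]]] := vec7P e.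
  transitivity (a ^+ 2 * qform e); last by rewrite qe mulr0.
  by rewrite Ee; qsolve.
have q0 : qform e0 = 1 by qsolve.
move: ww; rewrite inE => /orP[/eqP ->|ww].
  by apply: unipotent_spin => //; rewrite Z e0e mulr0.
apply: (@unipotent_spin2 _ e0) => //; rewrite ?Z ?e0e ?we ?mulr0 //.
by move: ww; rewrite !inE; do ![case/orP=> [/eqP ->|]]; last move/eqP ->; qsolve.
Qed.

Ltac unip_tac := apply: unip_spin; rewrite ?inE ?eqxx ?orbT //; qsolve.
Ltac act_tac :=
  rewrite /e0 /e1 /e2 /e3 /f1 /f2 /f3;
  repeat (erewrite unip_c8 || erewrite gam_c8 || erewrite c8Z || erewrite c8D);
  congr c8; ring.

(* The arguments of the last three factors are those for which the coordinates
   3, 5 and 6 of the image of the highest weight vector are equal to 1. *)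
Definition chart (y1 y2 y3 : C) : 'M[C]_8 :=
  unip e0 f1 (- y3) * unip e0 f2 (- y2) * unip e0 f3 (- y1) * unip f2 f3 (1 + y1 * y2) *
  unip f1 f3 (1 + y1 * y3) * unip f1 f2 (1 + y2 * y3).

Lemma chart_spin y1 y2 y3 : chart y1 y2 y3 \in spin.
Proof. by repeat apply: spin7_predM; unip_tac. Qed.

Lemma short1_c8 a x0 x1 x2 x3 x4 x5 x6 x7 :
  unip e0 f1 a *m c8 x0 x1 x2 x3 x4 x5 x6 x7 =
  c8 x0 x1 x2 x3 (x4 - a * x0) (x5 + a * x1) (x6 + a * x2) (x7 - a * x3).
Proof. by act_tac. Qed.

Lemma short2_c8 a x0 x1 x2 x3 x4 x5 x6 x7 :
  unip e0 f2 a *m c8 x0 x1 x2 x3 x4 x5 x6 x7 =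
  c8 x0 x1 (x2 - a * x0) (x3 + a * x1) x4 x5 (x6 - a * x4) (x7 + a * x5).
Proof. by act_tac. Qed.

Lemma short3_c8 a x0 x1 x2 x3 x4 x5 x6 x7 :
  unip e0 f3 a *m c8 x0 x1 x2 x3 x4 x5 x6 x7 =
  c8 x0 (x1 - a * x0) x2 (x3 - a * x2) x4 (x5 - a * x4) x6 (x7 - a * x6).
Proof. by act_tac. Qed.

Lemma long23_c8 a x0 x1 x2 x3 x4 x5 x6 x7 :
  unip f2 f3 a *m c8 x0 x1 x2 x3 x4 x5 x6 x7 =
  c8 x0 x1 x2 (x3 + a * x0) x4 x5 x6 (x7 + a * x4).
Proof. by act_tac. Qed.

Lemma long13_c8 a x0 x1 x2 x3 x4 x5 x6 x7 :
  unip f1 f3 a *m c8 x0 x1 x2 x3 x4 x5 x6 x7 =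
  c8 x0 x1 x2 x3 x4 (x5 + a * x0) x6 (x7 - a * x2).
Proof. by act_tac. Qed.

Lemma long12_c8 a x0 x1 x2 x3 x4 x5 x6 x7 :
  unip f1 f2 a *m c8 x0 x1 x2 x3 x4 x5 x6 x7 =
  c8 x0 x1 x2 x3 x4 x5 (x6 + a * x0) (x7 + a * x1).
Proof. by act_tac. Qed.

Lemma chart_highest y1 y2 y3 :
  chart y1 y2 y3 *m c8 1 0 0 0 0 0 0 0 = c8 1 y1 y2 1 y3 1 1 (y1 - y2 + y3).
Proof.
rewrite /chart -!mulmxA long12_c8 long13_c8 long23_c8 short3_c8 short2_c8 short1_c8.
congr c8; ring.
Qed.

(** On the coordinates 0, 1, 2, 4 the chart acts by a translation proportional to the coordinate 0.
    These are the coordinates occupied by columns 1 and 2 of an element preserving the highest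
    weight line. *)
Lemma chart_c8 y1 y2 y3 x0 x1 x2 x3 x4 x5 x6 x7 : exists z3 z5 z6 z7,
  chart y1 y2 y3 *m c8 x0 x1 x2 x3 x4 x5 x6 x7 =
  c8 x0 (x1 + y1 * x0) (x2 + y2 * x0) z3 (x4 + y3 * x0) z5 z6 z7.
Proof.
rewrite /chart -!mulmxA long12_c8 long13_c8 long23_c8 short3_c8 short2_c8 short1_c8.
by do 4!eexists; congr c8; try reflexivity; ring.
Qed.

Lemma lower1_spin a : unip f1 e2 a \in spin. Proof. by unip_tac. Qed.
Lemma lower2_spin a : unip f2 e3 a \in spin. Proof. by unip_tac. Qed.
Lemma lower12_spin a : unip f1 e3 a \in spin. Proof. by unip_tac. Qed.
Lemma upper1_spin a : unip f2 e1 a \in spin. Proof. by unip_tac. Qed.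
Lemma upper2_spin a : unip f3 e2 a \in spin. Proof. by unip_tac. Qed.

Lemma lower1_c8 a x0 x1 x2 x3 x4 x5 x6 x7 :
  unip f1 e2 a *m c8 x0 x1 x2 x3 x4 x5 x6 x7 =
  c8 x0 x1 x2 x3 (x4 + a * x2) (x5 + a * x3) x6 x7.
Proof. by act_tac. Qed.

Lemma lower2_c8 a x0 x1 x2 x3 x4 x5 x6 x7 :
  unip f2 e3 a *m c8 x0 x1 x2 x3 x4 x5 x6 x7 =
  c8 x0 x1 (x2 + a * x1) x3 x4 x5 (x6 + a * x5) x7.
Proof. by act_tac. Qed.

Lemma lower12_c8 a x0 x1 x2 x3 x4 x5 x6 x7 :
  unip f1 e3 a *m c8 x0 x1 x2 x3 x4 x5 x6 x7 =
  c8 x0 x1 x2 x3 (x4 + a * x1) x5 (x6 - a * x3) x7.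
Proof. by act_tac. Qed.

Lemma upper1_c8 a x0 x1 x2 x3 x4 x5 x6 x7 :
  unip f2 e1 a *m c8 x0 x1 x2 x3 x4 x5 x6 x7 =
  c8 x0 x1 (x2 + a * x4) (x3 + a * x5) x4 x5 x6 x7.
Proof. by act_tac. Qed.

Lemma upper2_c8 a x0 x1 x2 x3 x4 x5 x6 x7 :
  unip f3 e2 a *m c8 x0 x1 x2 x3 x4 x5 x6 x7 =
  c8 x0 (x1 + a * x2) x2 x3 x4 (x5 + a * x6) x6 x7.
Proof. by act_tac. Qed.

(** The usual SL_2 representative x(1) y(-1) x(1) of a simple reflection. *)
Definition refl1 : 'M[C]_8 := unip f2 e1 1 * unip f1 e2 (-1) * unip f2 e1 1.
Definition refl2 : 'M[C]_8 := unip f3 e2 1 * unip f2 e3 (-1) * unip f3 e2 1.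

Lemma refl1_spin : refl1 \in spin.
Proof. by repeat apply: spin7_predM; unip_tac. Qed.

Lemma refl2_spin : refl2 \in spin.
Proof. by repeat apply: spin7_predM; unip_tac. Qed.

Lemma refl1_c8 x0 x1 x2 x3 x4 x5 x6 x7 :
  refl1 *m c8 x0 x1 x2 x3 x4 x5 x6 x7 = c8 x0 x1 x4 x5 (- x2) (- x3) x6 x7.
Proof.
rewrite /refl1 -!mulmxA; repeat (erewrite upper1_c8 || erewrite lower1_c8); congr c8; ring.
Qed.

Lemma refl2_c8 x0 x1 x2 x3 x4 x5 x6 x7 :
  refl2 *m c8 x0 x1 x2 x3 x4 x5 x6 x7 = c8 x0 x2 (- x1) x3 x4 x6 (- x5) x7.
Proof.
rewrite /refl2 -!mulmxA; repeat (erewrite upper2_c8 || erewrite lower2_c8); congr c8; ring.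
Qed.

(** The parabolic is only known to contain the Borel subgroup and reflection representatives; this
    conjugation and the next two place lower root elements in it. *)
Lemma refl2_upper2 a : refl2 * unip f3 e2 (- a) = unip f2 e3 a * refl2.
Proof.
apply: mx8P => *; rewrite -mulmxA -[RHS]mulmxA.
repeat (erewrite upper2_c8 || erewrite lower2_c8 || erewrite refl2_c8); congr c8; ring.
Qed.

Lemma refl1_upper1 a : refl1 * unip f2 e1 (- a) = unip f1 e2 a * refl1.
Proof.
apply: mx8P => *; rewrite -mulmxA -[RHS]mulmxA.
repeat (erewrite upper1_c8 || erewrite lower1_c8 || erewrite refl1_c8); congr c8; ring.
Qed.

Lemma refl1_lower2 a : refl1 * unip f2 e3 (- a) = unip f1 e3 a * refl1.
Proof.
apply: mx8P => *; rewrite -mulmxA -[RHS]mulmxA.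
repeat (erewrite lower2_c8 || erewrite lower12_c8 || erewrite refl1_c8); congr c8; ring.
Qed.

(** The coroot of the short root eps1, not of alpha1, evaluated at the inverse of [c]; likewise
    below for eps2 and eps3. *)
Definition coroot1 (c : C) : 'M[C]_8 := gam (e1 + f1) * gam (c *: e1 + c^-1 *: f1).
Definition coroot2 (c : C) : 'M[C]_8 := gam (e2 + f2) * gam (c *: e2 + c^-1 *: f2).
Definition coroot3 (c : C) : 'M[C]_8 := gam (e3 + f3) * gam (c *: e3 + c^-1 *: f3).

Ltac torus_spin c0 :=
  apply: gamma_pair_spin; rewrite /e0 /e1 /e2 /e3 /f1 /f2 /f3 ?vec7Z ?vec7D qform_vec7;
  rewrite ?(mulr0, mulr1, mul0r, addr0, add0r, expr0n) //= ?divff ?addr0 ?add0r.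

Lemma coroot1_spin c : c != 0 -> coroot1 c \in spin.
Proof. by move=> c0; torus_spin c0. Qed.
Lemma coroot2_spin c : c != 0 -> coroot2 c \in spin.
Proof. by move=> c0; torus_spin c0. Qed.
Lemma coroot3_spin c : c != 0 -> coroot3 c \in spin.
Proof. by move=> c0; torus_spin c0. Qed.

Ltac coroot_tac :=
  rewrite -mulmxA /e1 /e2 /e3 /f1 /f2 /f3 ?vec7Z ?vec7D;
  repeat erewrite gam_c8; congr c8; ring.

Lemma coroot1_c8 c x0 x1 x2 x3 x4 x5 x6 x7 :
  coroot1 c *m c8 x0 x1 x2 x3 x4 x5 x6 x7 =
  c8 (c^-1 * x0) (c^-1 * x1) (c^-1 * x2) (c^-1 * x3)
     (c * x4) (c * x5) (c * x6) (c * x7).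
Proof. by coroot_tac. Qed.

Lemma coroot2_c8 c x0 x1 x2 x3 x4 x5 x6 x7 :
  coroot2 c *m c8 x0 x1 x2 x3 x4 x5 x6 x7 =
  c8 (c^-1 * x0) (c^-1 * x1) (c * x2) (c * x3)
     (c^-1 * x4) (c^-1 * x5) (c * x6) (c * x7).
Proof. by coroot_tac. Qed.

Lemma coroot3_c8 c x0 x1 x2 x3 x4 x5 x6 x7 :
  coroot3 c *m c8 x0 x1 x2 x3 x4 x5 x6 x7 =
  c8 (c^-1 * x0) (c * x1) (c^-1 * x2) (c * x3)
     (c^-1 * x4) (c * x5) (c^-1 * x6) (c * x7).
Proof. by coroot_tac. Qed.

(** The three products are chosen so that the coordinates 3, 5, 6 are multiplied independently by
    the squares of [a], [b], [c]. *)
Definition torus_elt (a b c : C) : 'M[C]_8 :=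
  coroot1 (b * c) * coroot2 (a * c) * coroot3 (a * b).

Lemma torus_elt_spin a b c : a != 0 -> b != 0 -> c != 0 ->
  torus_elt a b c \in spin.
Proof.
move=> a0 b0 c0; apply: spin7_predM; first apply: spin7_predM.
- by apply: coroot1_spin; rewrite mulf_neq0.
- by apply: coroot2_spin; rewrite mulf_neq0.
- by apply: coroot3_spin; rewrite mulf_neq0.
Qed.

Lemma torus_elt_c8 a b c x0 x1 x2 x3 x4 x5 x6 x7 :
  a != 0 -> b != 0 -> c != 0 ->
  torus_elt a b c *m c8 x0 x1 x2 x3 x4 x5 x6 x7 =
  c8 (x0 / (a * b * c) ^+ 2) (x1 / c ^+ 2) (x2 / b ^+ 2) (a ^+ 2 * x3)
     (x4 / a ^+ 2) (b ^+ 2 * x5) (c ^+ 2 * x6) ((a * b * c) ^+ 2 * x7).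
Proof.
move=> a0 b0 c0; rewrite /torus_elt -mulmxA -(mulmxA (coroot1 _)).
rewrite coroot3_c8 coroot2_c8 coroot1_c8.
by congr c8; field; rewrite ?a0 ?b0 ?c0.
Qed.

(** The reflections in e_i + f_i negate eps1, eps2, eps3; [e0] is added to make the number of
    factors even. *)
Definition longest : 'M[C]_8 :=
  gam e0 * gam (e1 + f1) * (gam (e2 + f2) * gam (e3 + f3)).

Lemma longest_spin : longest \in spin.
Proof. by apply: spin7_predM; apply: gamma_pair_spin; qsolve. Qed.

Lemma longest_c8 x0 x1 x2 x3 x4 x5 x6 x7 :
  longest *m c8 x0 x1 x2 x3 x4 x5 x6 x7 =
  c8 (- x7) x6 (- x5) x4 x3 (- x2) x1 (- x0).
Proof. 
rewrite -!mulmxA /e0 /e1 /e2 /e3 /f1 /f2 /f3; repeat erewrite vec7D; repeat erewrite gam_c8.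
by congr c8; ring. Qed.

End RootElements.

(** * Regular functions and irreducibility of the group *)

Section PolynomialMaps.
Variables (C : fieldType) (n : nat).

Definition polyf (F : ('I_n -> C) -> C) : Prop :=
  exists P : {mpoly C[n]}, forall v, F v = P.@[v].

Lemma polyf_cst c : polyf (fun=> c).
Proof. by exists c%:MP => v; rewrite mevalC. Qed.

Lemma polyf_var i : polyf (fun v => v i).
Proof. by exists 'X_i => v; rewrite mevalXU. Qed.

Lemma polyfD F F' : polyf F -> polyf F' -> polyf (fun v => F v + F' v).
Proof. by move=> [P E] [P' E']; exists (P + P') => v; rewrite mevalD E E'. Qed.

Lemma polyfM F F' : polyf F -> polyf F' -> polyf (fun v => F v * F' v).
Proof. by move=> [P E] [P' E']; exists (P * P') => v; rewrite mevalM E E'. Qed.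

Lemma polyfN F : polyf F -> polyf (fun v => - F v).
Proof. by move=> [P E]; exists (- P) => v; rewrite mevalN E. Qed.

Lemma polyf_sum (I : finType) (F : I -> ('I_n -> C) -> C) :
  (forall i, polyf (F i)) -> polyf (fun v => \sum_i F i v).
Proof.
move=> H; have [P E] := fin_all_exists H.
by exists (\sum_i P i) => v; rewrite raddf_sum /=; apply: eq_bigr.
Qed.

Definition polym (A : ('I_n -> C) -> 'M[C]_8) : Prop :=
  forall i j, polyf (fun v => A v i j).

Lemma polym_cst A : polym (fun=> A).
Proof. by move=> i j; exact: polyf_cst. Qed.

Lemma polymD A B : polym A -> polym B -> polym (fun v => A v + B v).
Proof.
move=> pA pB i j; have [P E] := polyfD (pA i j) (pB i j).
by exists P => v; rewrite mxE.
Qed.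

Lemma polymZ F A : polyf F -> polym A -> polym (fun v => F v *: A v).
Proof.
move=> pF pA i j; have [P E] := polyfM pF (pA i j).
by exists P => v; rewrite mxE.
Qed.

Lemma polymM A B : polym A -> polym B -> polym (fun v => A v * B v).
Proof.
move=> pA pB i j.
have [P E] := polyf_sum (fun k => polyfM (pA i k) (pB k j)).
by exists P => v; rewrite mxE.
Qed.

End PolynomialMaps.

Section Regular.
Variable C : numClosedFieldType.
Local Notation G := (Spin7 C).
Implicit Types (f : G -> C) (g : G).

Lemma char0_units_numField (F : numFieldType) : char0_units F.
Proof. by move=> n; rewrite unitfE pnatr_eq0. Qed.

Lemma regular_polyf n f (c : ('I_n -> C) -> G) :
  regular f -> polym (fun v => val (c v)) -> polyf (fun v => f (c v)).
Proof.
move=> [p E] pc.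
have H (k : 'I_(8 * 8)) : polyf (fun v => mxvec (val (c v)) 0 k).
  have [i j] := mxvec_indexP k.
  by have [P EP] := pc i j; exists P => v; rewrite mxvecE.
have [P EP] := fin_all_exists H.
exists (p \mPo [tuple P k | k < 8 * 8]) => v.
rewrite E comp_mpoly_meval; apply: meval_eq => k.
by rewrite tnth_mktuple.
Qed.

Lemma regular_entry (i j : 'I_8) : regular (fun g => val g i j).
Proof.
exists 'X_(mxvec_index i j) => g.
by rewrite mevalXU mxvecE.
Qed.

Lemma regular_matrix_comp f (c : G -> G) : regular f ->
  (forall i j, regular (fun g => val (c g) i j)) -> regular (fun g => f (c g)).
Proof.
move=> [p E] pc.
have H (k : 'I_(8 * 8)) : regular (fun g => mxvec (val (c g)) 0 k).
  have [i j] := mxvec_indexP k.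
  by have [P EP] := pc i j; exists P => v; rewrite mxvecE.
have [P EP] := fin_all_exists H.
exists (p \mPo [tuple P k | k < 8 * 8]) => g.
rewrite E comp_mpoly_meval; apply: meval_eq => k.
by rewrite tnth_mktuple.
Qed.

Lemma regular_sum (I : finType) (F : I -> G -> C) :
  (forall i, regular (F i)) -> regular (fun g => \sum_i F i g).
Proof.
move=> H; have [P E] := fin_all_exists H.
by exists (\sum_i P i) => g; rewrite raddf_sum /=; apply: eq_bigr.
Qed.

Lemma regular_mulmx (A B : 'M[C]_8) i j : regular (fun g => (A *m val g *m B) i j).
Proof.
have H k l : regular (fun g => A i l * val g l k * B k j).
  apply: regularM; last exact: regular_cst.
  by apply: regularM; [exact: regular_cst|exact: regular_entry].
have := regular_sum (fun k => regular_sum (H k)).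
congr regular; apply/funext => g; rewrite mxE; apply: eq_bigr => k _.
by rewrite mxE mulr_suml.
Qed.

Lemma regular_translate f a b : regular f -> regular (fun g => f (a * g * b)%g).
Proof.
move=> rf; apply: regular_matrix_comp rf _ => i j.
exact: regular_mulmx (val a) (val b) i j.
Qed.

End Regular.

(** * Irreducibility of the group along rational curves *)

Section Irreducible.
Variable C : numClosedFieldType.
Local Notation G := (Spin7 C).
Implicit Types (f : G -> C) (g r : G).

Lemma val_mulg g g' : val (g * g')%g = val g * val g' :> 'M[C]_8.
Proof. by []. Qed.

(** The second variable stands for the inverse of D(s): polynomials in both are the regular
    functions on the line without the roots of D. *)
Definition par2 (s r : C) (i : 'I_2) : C := if i == 0 then s else r.

Lemma clear_denominators (D : {poly C}) (P : {mpoly C[2]}) :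
  exists k (R : {poly C}), forall s, D.[s] != 0 ->
    P.@[par2 s D.[s]^-1] * D.[s] ^+ k = R.[s].
Proof.
elim/mpolyind: P => [|c m P _ _ [k [R E]]].
  by exists 0%N, 0 => s _; rewrite meval0 horner0 mul0r.
pose m1 := m (@ord_max 1).
exists (k + m1)%N, (c *: 'X^(m 0) * D ^+ k + R * D ^+ m1) => s Ds.
have X (r : C) : ('X_[m]).@[par2 s r] = s ^+ m 0 * r ^+ m1.
  rewrite mevalX big_ord_recl big_ord1 /par2 /m1 /=.
  by rewrite (_ : lift ord0 ord0 = ord_max) //; exact: val_inj.
rewrite !hornerE -(E s Ds) mevalD mevalZ X exprD exprVn.
by field; rewrite expf_neq0.
Qed.

(** If all pairs are joinable, any two nonempty basic open sets meet, which is irreducibility. *)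
Definition joinable g g' : Prop :=
  forall f f', regular f -> regular f' -> f g != 0 -> f' g' != 0 ->
  exists g'', f g'' != 0 /\ f' g'' != 0.

(** Along the curve both functions have polynomial numerators, each nonzero because of one endpoint;
    their product with [D] is nonzero at some parameter. *)
Lemma rational_curve_joinable (c : C -> G) (A : ('I_2 -> C) -> 'M[C]_8)
    (D : {poly C}) (s0 s1 : C) g :
  polym A -> (forall s, D.[s] != 0 -> val (c s) = A (par2 s D.[s]^-1)) ->
  D.[s0] != 0 -> D.[s1] != 0 -> joinable (g * c s0)%g (g * c s1)%g.
Proof.
move=> pA cA D0 D1 f f' [p pf] [p' pf'] n0 n1.
have pol (F : G -> C) (q : {mpoly C[8 * 8]}) :
    (forall g, F g = q.@[fun k => mxvec (val g) 0 k]) ->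
    exists k (R : {poly C}), forall s, D.[s] != 0 ->
      F (g * c s)%g * D.[s] ^+ k = R.[s].
  move=> qF.
  have pgA : polym (fun v => val g * A v) by apply: polymM => //; exact: polym_cst.
  have H (k : 'I_(8 * 8)) : polyf (fun v => mxvec (val g * A v) 0 k).
    have [i j] := mxvec_indexP k.
    by have [P EP] := pgA i j; exists P => v; rewrite mxvecE.
  have [P EP] := fin_all_exists H.
  have [k [R E]] := clear_denominators D (q \mPo [tuple P k | k < 8 * 8]).
  exists k, R => s Ds; rewrite -E // qF comp_mpoly_meval; congr (_ * _).
  apply: meval_eq => l; rewrite tnth_mktuple -EP.
  by rewrite val_mulg cA.
have [k [R E]] := pol f p pf.
have [k' [R' E']] := pol f' p' pf'.
have R0 : R != 0.
  by apply: contraNneq n0 => RE; have := E s0 D0;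
    rewrite RE horner0 => /eqP; rewrite mulf_eq0 expf_eq0 (negbTE D0) andbF orbF.
have R1 : R' != 0.
  by apply: contraNneq n1 => RE; have := E' s1 D1;
    rewrite RE horner0 => /eqP; rewrite mulf_eq0 expf_eq0 (negbTE D1) andbF orbF.
have Dn : D != 0 by apply: contraNneq D0 => ->; rewrite horner0.
have [s ns] : exists s, (D * R * R').[s] != 0.
  apply: contrapT => H; have /eqP : D * R * R' = 0.
    apply: poly_eval_eq0 => [|s]; first exact: char0_units_numField.
    by apply/eqP; apply: contraPT H => ns; apply; exists s.
  by rewrite !mulf_eq0 (negbTE Dn) (negbTE R0) (negbTE R1).
move: ns; rewrite !hornerM !mulf_eq0 !negb_or => /andP[/andP[nD nR] nR'].
exists (g * c s)%g; split.
  by apply: contraNneq nR => z; rewrite -E // z mul0r.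
by apply: contraNneq nR' => z; rewrite -E' // z mul0r.
Qed.

(* Irreducibility is propagated along rational curves: being [spreading] is stable
   under products, and holds for the generators, which lie on such curves. *)
Definition spreading r : Prop := forall g, joinable g (g * r)%g.

Lemma spreading1 : spreading 1%g.
Proof. by move=> g f f' _ _ n n'; rewrite mulg1 in n'; exists g. Qed.

(** Translating f' by r' lets the first curve end at a point g1 where f(g1) and f'(g1 r') are both
    nonzero; the second starts there. *)
Lemma spreadingM r r' : spreading r -> spreading r' -> spreading (r * r')%g.
Proof.
move=> sr sr' g f f' rf rf' n n'.
pose f2 g := f' (1 * g * r')%g.
have [|g1 [n1 n1']] := sr g f f2 rf (regular_translate 1%g r' rf') n.
  by rewrite /f2 mul1g -mulgA.
by have [|g2] := sr' g1 f f' rf rf' n1; [move: n1'; rewrite /f2 mul1g|exists g2].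
Qed.

Definition unit_vec := {v : 'rV[C]_7 | qform v == 1}.

Definition pair_elt (v w : unit_vec) : G :=
  MkSpin7 (gamma_pair_spin (eqP (valP v)) (eqP (valP w))).

Lemma pair_eltM (u v w : unit_vec) :
  pair_elt u w = (pair_elt u v * pair_elt v w)%g.
Proof.
apply: val_inj; rewrite val_mulg /=.
by rewrite mulrA -(mulrA (gam (val u))) gam_sqr (eqP (valP v)) mulr1.
Qed.

Lemma scalar_mx_inj8 (a b : C) : a%:M = b%:M :> 'M[C]_8 -> a = b.
Proof. by move/matrixP/(_ 0 0); rewrite !mxE eqxx. Qed.

Lemma gam_sandwich (u w : 'rV[C]_7) :
  gam u * gam w * gam u = gam (polar u w *: u - qform u *: w).
Proof.
have -> : gam u * gam w = (polar u w)%:M - gam w * gam u.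
  by rewrite -gamma_anticomm addrK.
rewrite mulrBl -mulrA gam_sqr gamD gamN !gamZ.
by rewrite -scalemx1 -[_%:M in X in _ - X]scalemx1 -scalerAl -scalerAr mul1r mulr1.
Qed.

(** With u_s = w + s v, the unit vectors u_s w u_s / q(u_s) move from w at s = 0 to v at s = 1, the
    hypothesis being that the curve is defined at s = 1. Multiplied by w, they join 1 to v w. *)
Lemma pair_spreading_generic (v w : unit_vec) :
  qform (val v + val w) != 0 -> spreading (pair_elt v w).
Proof.
case: v w => [v qv] [w qw] /= q0 g.
pose u s := w + s *: v.
have qZ s : qform (s *: v) = s ^+ 2 * qform v.
  have [a1 [a2 [a3 [c [b3 [b2 [b1 ->]]]]]]] := vec7P v.
  by rewrite vec7Z !qform_vec7; ring.
have pZ s : polar w (s *: v) = s * polar w v.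
  have [a1 [a2 [a3 [c [b3 [b2 [b1 ->]]]]]]] := vec7P v.
  have [a1' [a2' [a3' [c' [b3' [b2' [b1' ->]]]]]]] := vec7P w.
  by rewrite /polar vec7Z !vec7D !qform_vec7; ring.
pose D : {poly C} := 1 + 'X^2 + polar w v *: 'X.
have DE s : D.[s] = qform (u s).
  rewrite /u qformD qZ pZ (eqP qv) (eqP qw) /D !hornerE; ring.
pose vs s := (qform (u s))^-1 *: (polar (u s) w *: u s - qform (u s) *: w).
have gvs s : gam (vs s) = (qform (u s))^-1 *: (gam (u s) * gam w * gam (u s)).
  by rewrite gamZ gam_sandwich.
have qvs s : qform (u s) != 0 -> qform (vs s) == 1.
  move=> qn; apply/eqP/scalar_mx_inj8; rewrite -gam_sqr gvs.
  rewrite -scalerAl -scalerAr -!mulrA (mulrA (gam (u s)) (gam (u s))) gam_sqr.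
  rewrite -[_%:M in LHS]scalemx1 -scalerAl mul1r -!scalerAr.
  rewrite (mulrA (gam w) (gam w)) gam_sqr (eqP qw) mul1r gam_sqr.
  by rewrite !scalerA -scalemx1 scalerA (mulVf qn) mulr1 mulVf // scale1r.
(* The default value is taken only where q(u_s) = 0, outside the domain of the curve. *)
pose cv s : unit_vec := insubd (exist _ w qw : unit_vec) (vs s).
have cvE s : qform (u s) != 0 -> val (cv s) = vs s.
  by move=> qn; rewrite /cv val_insubd qvs.
pose W : unit_vec := exist _ w qw; pose V : unit_vec := exist _ v qv.
pose A (x : 'I_2 -> C) : 'M[C]_8 :=
  x 1 *: ((gam w + x 0 *: gam v) * gam w * (gam w + x 0 *: gam v) * gam w).
have pA : polym A.
  have pu : polym (fun x : 'I_2 -> C => gam w + x 0 *: gam v).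
    apply: polymD; first exact: polym_cst.
    by apply: polymZ; [exact: polyf_var|exact: polym_cst].
  apply: polymZ; first exact: polyf_var.
  have pw := @polym_cst C 2 (gam w).
  exact: polymM (polymM (polymM pu pw) pu) pw.
have D0 : D.[0] != 0 by rewrite DE /u scale0r addr0 (eqP qw) oner_neq0.
have D1 : D.[1] != 0 by rewrite DE /u scale1r addrC.
have := @rational_curve_joinable (fun s => pair_elt (cv s) W) A D 0 1 g pA _ D0 D1.
have c0 : pair_elt (cv 0) W = 1%g.
  apply: val_inj; rewrite /= cvE -?DE // gvs /u scale0r addr0 (eqP qw).
  by rewrite invr1 scale1r gam_sqr (eqP qw) mul1r gam_sqr (eqP qw).
have c1 : pair_elt (cv 1) W = pair_elt V W.
  apply: val_inj; rewrite /= cvE -?DE // gvs /u scale1r; congr (_ * _).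
  have -> : gam (w + v) * gam w = gam v * gam (w + v).
    by rewrite !gamD mulrDl mulrDr !gam_sqr (eqP qw) (eqP qv) addrC.
  rewrite -mulrA gam_sqr -[_%:M]scalemx1 -scalerAr mulr1 scalerA mulVf ?scale1r //.
  by rewrite addrC.
rewrite c0 c1 mulg1; apply=> s Ds.
rewrite /= cvE -?DE // gvs -DE /A /par2 /= /u gamD gamZ.
by rewrite -scalerAl.
Qed.

(** Since q(x + e0) + q(x - e0) = 4, every unit vector is generic with respect to e0 or -e0; these
    two are connected through e1 + f1, which is orthogonal to both. *)
Lemma pair_spreading (v w : unit_vec) : spreading (pair_elt v w).
Proof.
have q0 : qform (e0 C) == 1 by rewrite qform_vec7 /=; apply/eqP; ring.
have q0N : qform (- e0 C) == 1.
  by rewrite -scaleN1r vec7Z qform_vec7 /=; apply/eqP; ring.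
have q1 : qform (e1 C + f1 C) == 1.
  by rewrite vec7D qform_vec7 /=; apply/eqP; ring.
pose E0 : unit_vec := Sub (e0 C) q0; pose E0N : unit_vec := Sub (- e0 C) q0N.
pose E1 : unit_vec := Sub (e1 C + f1 C) q1.
have two : (2 : C) != 0 by rewrite pnatr_eq0.
have four : (4 : C) != 0 by rewrite pnatr_eq0.
have s1 : spreading (pair_elt E1 E0).
  apply: pair_spreading_generic => /=; rewrite !vec7D qform_vec7.
  by rewrite (_ : _ + _ = 2) //; ring.
have s1N : spreading (pair_elt E1 E0N).
  apply: pair_spreading_generic => /=; rewrite -scaleN1r vec7Z !vec7D qform_vec7.
  by rewrite (_ : _ + _ = 2) //; ring.
have s1' : spreading (pair_elt E0 E1).
  by apply: pair_spreading_generic => /=; rewrite addrC !vec7D qform_vec7;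
    rewrite (_ : _ + _ = 2) //; ring.
have s1N' : spreading (pair_elt E0N E1).
  apply: pair_spreading_generic => /=; rewrite addrC -scaleN1r vec7Z !vec7D qform_vec7.
  by rewrite (_ : _ + _ = 2) //; ring.
have case2 (x : unit_vec) : qform (val x + e0 C) != 0 \/ qform (val x - e0 C) != 0.
  have H : qform (val x + e0 C) + qform (val x - e0 C) = 4.
    case: x => x /= /eqP qx; rewrite -[4](_ : 2 * qform x + 2 = 4); last by rewrite qx; ring.
    have [a1 [a2 [a3 [c [b3 [b2 [b1 ->]]]]]]] := vec7P x.
    by rewrite -scaleN1r vec7Z !vec7D !qform_vec7; ring.
  have [z|] := eqVneq (qform (val x + e0 C)) 0; [right|by left].
  by move: H; rewrite z add0r => ->.
have A1 (x : unit_vec) : spreading (pair_elt x E0).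
  case: (case2 x) => q; first exact: pair_spreading_generic.
  rewrite (pair_eltM x E0N) (pair_eltM E0N E1).
  apply: spreadingM; first exact: pair_spreading_generic.
  exact: spreadingM.
have A2 (x : unit_vec) : spreading (pair_elt E0 x).
  case: (case2 x) => q; first by apply: pair_spreading_generic; rewrite addrC.
  rewrite (pair_eltM E0 E1) (pair_eltM E1 E0N).
  apply: spreadingM => //; apply: spreadingM => //.
  by apply: pair_spreading_generic; rewrite addrC.
by rewrite (pair_eltM v E0); exact: spreadingM.
Qed.

Lemma spreading_all r : spreading r.
Proof.
suff H n (s : seq 'rV[C]_7) : (size s <= n)%N -> ~~ odd (size s) ->
    all (fun v => qform v == 1) s ->
    forall r, val r = \prod_(v <- s) gam v -> spreading r.
  by have /spinP[s [os us E]] := valP r; exact: (H (size s) s).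
elim: n s => [|n IH] [|v [|w s]] //=.
- by move=> _ _ _ x E; rewrite (_ : x = 1%g); [exact: spreading1|];
    apply: val_inj; apply: (etrans E); rewrite big_nil.
- by move=> _ _ _ x E; rewrite (_ : x = 1%g); [exact: spreading1|];
    apply: val_inj; apply: (etrans E); rewrite big_nil.
rewrite ltnS negbK => sz os /and3P[qv qw us] x E.
pose V : unit_vec := exist _ v qv; pose W : unit_vec := exist _ w qw.
have sps : \prod_(v <- s) gam v \in spin7_pred (C := C).
  by apply/spinP; exists s.
have -> : x = (pair_elt V W * MkSpin7 sps)%g.
  apply: val_inj; apply: (etrans E); rewrite !big_cons mulrA.
  by [].
apply: spreadingM; first exact: pair_spreading.
by apply: (IH s) => //; apply: ltnW.
Qed.

Lemma regular_domain f f' : regular f -> regular f' ->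
  (forall g, f g * f' g = 0) -> (forall g, f g = 0) \/ (forall g, f' g = 0).
Proof.
move=> rf rf' E; apply: contrapT => /not_orP[/existsNP[g /eqP n] /existsNP[g' /eqP n']].
have [|g'' [m m']] := @spreading_all (g^-1 * g')%g g f f' rf rf' n.
  by rewrite mulgA mulgV mul1g.
by have /eqP := E g''; rewrite mulf_eq0 (negbTE m) (negbTE m').
Qed.

End Irreducible.

(** * The parabolic subgroup *)

Section Columns.
Variable C : fieldType.
Implicit Types A B : 'M[C]_8.

Definition v0 : 'cV[C]_8 := c8 1 0 0 0 0 0 0 0.
Definition v1 : 'cV[C]_8 := c8 0 1 0 0 0 0 0 0.
Definition v2 : 'cV[C]_8 := c8 0 0 1 0 0 0 0 0.
Definition v3 : 'cV[C]_8 := c8 0 0 0 1 0 0 0 0.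
Definition v4 : 'cV[C]_8 := c8 0 0 0 0 1 0 0 0.
Definition v5 : 'cV[C]_8 := c8 0 0 0 0 0 1 0 0.
Definition v6 : 'cV[C]_8 := c8 0 0 0 0 0 0 1 0.
Definition v7 : 'cV[C]_8 := c8 0 0 0 0 0 0 0 1.

Lemma c8_delta : (v0 = delta_mx (inord 0) 0) * (v1 = delta_mx (inord 1) 0) *
  (v2 = delta_mx (inord 2) 0) * (v3 = delta_mx (inord 3) 0) *
  (v4 = delta_mx (inord 4) 0) * (v5 = delta_mx (inord 5) 0) *
  (v6 = delta_mx (inord 6) 0) * (v7 = delta_mx (inord 7) 0).
Proof.
by do !split; apply/colP => i; rewrite !mxE eqxx andbT -val_eqE /= inordK //;
  case: i; do 8![case=> //].
Qed.

Lemma mulmx_c8E A k : A *m delta_mx (inord k) 0 =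
  c8 (A (inord 0) (inord k)) (A (inord 1) (inord k)) (A (inord 2) (inord k))
     (A (inord 3) (inord k)) (A (inord 4) (inord k)) (A (inord 5) (inord k))
     (A (inord 6) (inord k)) (A (inord 7) (inord k)).
Proof.
rewrite -colE; apply/colP => i; rewrite !mxE -[in LHS](inord_val i).
by case: i; do 8![case=> //].
Qed.

Lemma diag_c8 A x0 x1 x2 x3 x4 x5 x6 x7 : is_diag_mx A ->
  A *m c8 x0 x1 x2 x3 x4 x5 x6 x7 =
  c8 (A (inord 0) (inord 0) * x0) (A (inord 1) (inord 1) * x1)
     (A (inord 2) (inord 2) * x2) (A (inord 3) (inord 3) * x3)
     (A (inord 4) (inord 4) * x4) (A (inord 5) (inord 5) * x5)
     (A (inord 6) (inord 6) * x6) (A (inord 7) (inord 7) * x7).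
Proof.
move=> /is_diag_mxP dA; apply/colP => i; rewrite mxE (bigD1 i) //= big1 => [|j ji].
  rewrite addr0 !mxE -[in A i i](inord_val i).
  by case: i; do 8![case=> //].
by rewrite dA ?mul0r // eq_sym.
Qed.

Lemma c8_diag A d0 d1 d2 d3 d4 d5 d6 d7 :
  (forall x0 x1 x2 x3 x4 x5 x6 x7, A *m c8 x0 x1 x2 x3 x4 x5 x6 x7 =
    c8 (d0 * x0) (d1 * x1) (d2 * x2) (d3 * x3)
       (d4 * x4) (d5 * x5) (d6 * x6) (d7 * x7)) ->
  A = diag_mx (\row_i [:: d0; d1; d2; d3; d4; d5; d6; d7]`_i).
Proof.
move=> E; apply: mx8P => *; rewrite E mul_diag_mx.
by apply/colP => i; rewrite !mxE; case: i; do 8![case=> //].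
Qed.

(** Moving [A] past [gam w] gives a vector times the highest weight vector, and such products are
    spanned by the basis vectors 0, 1, 2, 4. *)
Lemma stab_level1 A w s : A \in spin7_pred (C := C) -> A *m v0 = s *: v0 ->
  exists a b c d, A *m (gam w *m v0) = c8 a b c 0 d 0 0 0.
Proof.
move=> /spin_conj - /(_ w) [w' E] Ev.
have -> : A *m (gam w *m v0) = s *: (gam w' *m v0).
  by rewrite mulmxA (_ : A *m gam w = A * gam w) // E -mulmxA Ev -scalemxAr.
have [a1 [a2 [a3 [c [b3 [b2 [b1 ->]]]]]]] := vec7P w'.
rewrite gam_c8 c8Z; exists (s * c), (s * b3), (s * b2), (s * b1).
by congr c8; ring.
Qed.

(** Columns 0, 1, 2 determine the shape of the others: column 4 is restricted by [stab_level1], and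
    columns 3, 5, 6 by orthogonality to earlier ones for the invariant form. *)
Lemma stab_upper_triangular A s a1 b1 a2 b2 c2 : A \in spin7_pred (C := C) ->
  2 != 0 :> C -> s != 0 -> b1 != 0 -> c2 != 0 ->
  A *m v0 = s *: v0 -> A *m v1 = c8 a1 b1 0 0 0 0 0 0 ->
  A *m v2 = c8 a2 b2 c2 0 0 0 0 0 ->
  forall i j : 'I_8, (j < i)%N -> A i j = 0.
Proof.
move=> sA two s0 b10 c20 E0 E1 E2.
have E4 : exists a b c d, A *m v4 = c8 a b c 0 d 0 0 0.
  have -> : v4 = gam (f1 C) *m v0 by rewrite gam_c8; congr c8; ring.
  exact: stab_level1 sA E0.
have [a4 [b4 [c4 [d4 {}E4]]]] := E4.
have B := fun x y => bform_spin x y sA.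
have [p0 [p1 [p2 [p3 [p4 [p5 [p6 [p7 E3]]]]]]]] := c8P (A *m v3).
have [q0 [q1 [q2 [q3 [q4 [q5 [q6 [q7 E5]]]]]]]] := c8P (A *m v5).
have [r0 [r1 [r2 [r3 [r4 [r5 [r6 [r7 E6]]]]]]]] := c8P (A *m v6).
rewrite /v0 c8Z !mulr0 in E0.
have p70 : p7 = 0.
  have := B v0 v3; rewrite E0 E3 !bform_c8 => e; apply: (mulfI s0).
  by move: e; rewrite !(mulr1, mulr0, mul0r, add0r, addr0, subr0, sub0r, oppr0).
have p60 : p6 = 0.
  have := B v1 v3; rewrite E1 E3 !bform_c8 p70 => e; apply: (mulfI b10); apply: oppr_inj.
  by move: e; rewrite !(mulr1, mulr0, mul0r, add0r, addr0, subr0, sub0r, oppr0).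
have p50 : p5 = 0.
  have := B v2 v3; rewrite E2 E3 !bform_c8 p70 p60 => e; apply: (mulfI c20).
  by move: e; rewrite !(mulr1, mulr0, mul0r, add0r, addr0, subr0, sub0r, oppr0).
have p30 : p3 != 0.
  have := B v4 v3; rewrite E4 E3 !bform_c8 p70 p60 p50 => e.
  apply/eqP => z; move/eqP: e; rewrite z.
  rewrite !(mulr1, mulr0, mul0r, add0r, addr0, subr0, sub0r, oppr0).
  by rewrite eq_sym oppr_eq0 oner_eq0.
(* The image of [v3] is isotropic, and its norm has been reduced to -2 p3 p4. *)
have p40 : p4 = 0.
  have := B v3 v3; rewrite E3 !bform_c8 p70 p60 p50 => e.
  apply: (mulfI p30); apply: (mulfI two); rewrite !mulr0; apply: oppr_inj.
  rewrite oppr0.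
  transitivity (p0 * 0 - p1 * 0 + p2 * 0 - p3 * p4 - p4 * p3 + 0 * p2 - 0 * p1 + 0 * p0).
    by ring.
  by rewrite e; ring.
have q70 : q7 = 0.
  have := B v0 v5; rewrite E0 E5 !bform_c8 => e; apply: (mulfI s0).
  by move: e; rewrite !(mulr1, mulr0, mul0r, add0r, addr0, subr0, sub0r, oppr0).
have q60 : q6 = 0.
  have := B v1 v5; rewrite E1 E5 !bform_c8 q70 => e; apply: (mulfI b10); apply: oppr_inj.
  by move: e; rewrite !(mulr1, mulr0, mul0r, add0r, addr0, subr0, sub0r, oppr0).
have r70 : r7 = 0.
  have := B v0 v6; rewrite E0 E6 !bform_c8 => e; apply: (mulfI s0).
  by move: e; rewrite !(mulr1, mulr0, mul0r, add0r, addr0, subr0, sub0r, oppr0).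
subst p7 p6 p5 p4 q7 q6 r7.
move: E0 E1 E2 E3 E4 E5 E6; rewrite -/v0 !c8_delta !mulmx_c8E.
move=> /c8_inj[[_ ? ? ?] [? ? ? ?]] /c8_inj[[_ _ ? ?] [? ? ? ?]].
move=> /c8_inj[[_ _ _ ?] [? ? ? ?]] /c8_inj[[_ _ _ _] [? ? ? ?]].
move=> /c8_inj[[_ _ _ _] [_ ? ? ?]] /c8_inj[[_ _ _ _] [_ _ ? ?]].
move=> /c8_inj[[_ _ _ _] [_ _ _ ?]] i j.
rewrite -[i in A i]inord_val -[j in A _ j]inord_val.
case: i => [[|[|[|[|[|[|[|[|i]]]]]]]] Hi] //;
  case: j => [[|[|[|[|[|[|[|[|j]]]]]]]] Hj] // _; assumption.
Qed.

End Columns.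

Section Parabolic.
Variable C : numClosedFieldType.
Local Notation G := (Spin7 C).
Variable h : G.
Implicit Types (f : G -> C) (g p t n : G).
Local Notation fr := (frame h).
Local Notation dc := (dcoef h).

Lemma frameM g g' : fr (g * g')%g = fr g * fr g'.
Proof. by rewrite /frame conjMg. Qed.

Lemma frame1 : fr 1%g = 1.
Proof. by rewrite /frame conj1g. Qed.

Lemma frameV g : fr g^-1%g * fr g = 1.
Proof. by rewrite -frameM mulVg frame1. Qed.

Lemma frame_spin g : fr g \in spin7_pred (C := C).
Proof. exact: valP. Qed.

Lemma frame_surj A : A \in spin7_pred (C := C) -> exists g, fr g = A.
Proof.
move=> sA; exists (MkSpin7 sA ^ h^-1)%g.
by rewrite /frame -conjgM mulVg conjg1.
Qed.

Lemma frame_inj g g' : fr g = fr g' -> g = g'.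
Proof. by move=> E; apply: (conjg_inj h); exact: val_inj. Qed.

Lemma val_frame g : val g = val h * fr g * val h^-1%g.
Proof. by rewrite -{1}(conjgK h g) conjgE invgK !val_mulg mulrA. Qed.

Lemma frame_val g : fr g = val h^-1%g *m val g *m val h.
Proof. by rewrite /frame conjgE !val_mulg mulrA. Qed.

Definition coord (i : nat) g : C := fr g (inord i) (inord 0).

Local Notation X := coord.

Lemma regular_frame i j : regular (fun g => fr g i j).
Proof.
have := regular_mulmx (val h^-1%g) (val h) i j.
by congr regular; apply/funext => g; rewrite frame_val.
Qed.

Lemma frame_v0 g : fr g *m v0 C =
  c8 (X 0 g) (X 1 g) (X 2 g) (X 3 g) (X 4 g) (X 5 g) (X 6 g) (X 7 g).
Proof. by rewrite c8_delta mulmx_c8E. Qed.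

Lemma torus_c8 t x0 x1 x2 x3 x4 x5 x6 x7 : torus h t ->
  fr t *m c8 x0 x1 x2 x3 x4 x5 x6 x7 =
  c8 (dc 0 t * x0) (dc 1 t * x1) (dc 2 t * x2) (dc 3 t * x3)
     (dc 4 t * x4) (dc 5 t * x5) (dc 6 t * x6) (dc 7 t * x7).
Proof. exact: diag_c8. Qed.

Lemma torusP t d0 d1 d2 d3 d4 d5 d6 d7 :
  (forall x0 x1 x2 x3 x4 x5 x6 x7, fr t *m c8 x0 x1 x2 x3 x4 x5 x6 x7 =
    c8 (d0 * x0) (d1 * x1) (d2 * x2) (d3 * x3)
       (d4 * x4) (d5 * x5) (d6 * x6) (d7 * x7)) ->
  torus h t /\ [/\ dc 0 t = d0, dc 1 t = d1, dc 2 t = d2 & dc 3 t = d3] /\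
  [/\ dc 4 t = d4, dc 5 t = d5, dc 6 t = d6 & dc 7 t = d7].
Proof.
move=> /c8_diag E; split; first by rewrite /torus /= E; exact: diag_mx_is_diag.
by rewrite /dcoef E !mxE !eqxx !inordK.
Qed.

Lemma bform_frame g x y : bform (fr g *m x) (fr g *m y) = bform x y.
Proof. exact/bform_spin/frame_spin. Qed.

Lemma torus_opp t : torus h t ->
  [/\ dc 0 t * dc 7 t = 1, dc 1 t * dc 6 t = 1,
      dc 2 t * dc 5 t = 1 & dc 3 t * dc 4 t = 1].
Proof.
move=> Tt; have B := bform_frame t.
have S := (mulr0, mul0r, mulr1, subr0, sub0r, addr0, add0r, oppr0).
split.
- by have := B (v0 C) (v7 C); rewrite !torus_c8 // !bform_c8 !S.
- by have := B (v1 C) (v6 C); rewrite !torus_c8 // !bform_c8 !S => /oppr_inj.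
- by have := B (v2 C) (v5 C); rewrite !torus_c8 // !bform_c8 !S.
- by have := B (v3 C) (v4 C); rewrite !torus_c8 // !bform_c8 !S => /oppr_inj.
Qed.

Lemma torus_neq0 t : torus h t ->
  [/\ dc 0 t != 0, dc 1 t != 0, dc 2 t != 0 & dc 3 t != 0] /\
  [/\ dc 4 t != 0, dc 5 t != 0, dc 6 t != 0 & dc 7 t != 0].
Proof.
case/torus_opp.
have H (x y : C) : x * y = 1 -> x != 0 /\ y != 0.
  by move=> E; apply/andP; rewrite -negb_or -mulf_eq0 E oner_eq0.
move=> /H[? ?] /H[? ?] /H[? ?] /H[? ?]; by split; split.
Qed.

(** Conjugation by [t] sends [gam f2] or [gam f1] to some [gam w], one coefficient of which can be
    read on two basis vectors; equating the readings relates four weights. *)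
Lemma torus_mul t : torus h t ->
  [/\ dc 0 t * dc 3 t = dc 1 t * dc 2 t, dc 0 t * dc 5 t = dc 1 t * dc 4 t,
      dc 0 t * dc 6 t = dc 2 t * dc 4 t & dc 0 t * dc 7 t = dc 3 t * dc 4 t].
Proof.
move=> Tt.
have S := (mulr0, mul0r, mulr1, subr0, sub0r, addr0, add0r, oppr0).
have H v : exists w, forall x : 'cV[C]_8, fr t *m (gam v *m x) = gam w *m (fr t *m x).
  have [w E] := spin_conj v (frame_spin t).
  by exists w => x; rewrite mulmxA [RHS]mulmxA; exact: (congr1 (fun A : 'M_8 => A *m x) E).
have [[n0 n1 n2 n3] [n4 _ _ _]] := torus_neq0 Tt.
split.
- have [w] := H (f2 C); have [a1 [a2 [a3 [c [b3 [b2 [b1 ->]]]]]]] := vec7P w => E.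
  have := E (v0 C); rewrite gam_c8 !torus_c8 // gam_c8 !S.
  case/c8_inj=> [[_ _ e2 _] _].
  have := E (v1 C); rewrite gam_c8 !torus_c8 // gam_c8 !S.
  by case/c8_inj=> [[_ _ _ ->] _]; rewrite e2; ring.
- have [w] := H (f1 C); have [a1 [a2 [a3 [c [b3 [b2 [b1 ->]]]]]]] := vec7P w => E.
  have := E (v0 C); rewrite gam_c8 !torus_c8 // gam_c8 !S.
  case/c8_inj=> [_ [e4 _ _ _]].
  have := E (v1 C); rewrite gam_c8 !torus_c8 // gam_c8 !S.
  by case/c8_inj=> [_ [_ -> _ _]]; rewrite e4; ring.
- have [w] := H (f1 C); have [a1 [a2 [a3 [c [b3 [b2 [b1 ->]]]]]]] := vec7P w => E.
  have := E (v0 C); rewrite gam_c8 !torus_c8 // gam_c8 !S.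
  case/c8_inj=> [_ [e4 _ _ _]].
  have := E (v2 C); rewrite gam_c8 !torus_c8 // gam_c8 !S.
  by case/c8_inj=> [_ [_ _ -> _]]; rewrite e4; ring.
- have [w] := H (f1 C); have [a1 [a2 [a3 [c [b3 [b2 [b1 ->]]]]]]] := vec7P w => E.
  have := E (v0 C); rewrite gam_c8 !torus_c8 // gam_c8 !S.
  case/c8_inj=> [_ [e4 _ _ _]].
  have := E (v3 C); rewrite gam_c8 !torus_c8 // gam_c8 !S.
  by case/c8_inj=> [_ [_ _ _ ->]]; rewrite e4; ring.
Qed.

Lemma torus_highest t : torus h t -> dc 1 t * dc 2 t * dc 4 t = dc 0 t.
Proof.
move=> Tt; have [[n0 _ _ _] _] := torus_neq0 Tt.
have [E1 _ _ E2] := torus_mul Tt; have [E3 _ _ _] := torus_opp Tt.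
by rewrite -E1 -mulrA -E2 E3 mulr1.
Qed.

(** The weights are the vertices of a cube centred at zero, and so are the barycentres of its two
    inscribed tetrahedra equal to zero. *)
Lemma torus_tetrahedra t : torus h t ->
  dc 0 t * dc 3 t * dc 5 t * dc 6 t = 1 /\ dc 1 t * dc 2 t * dc 4 t * dc 7 t = 1.
Proof.
move=> Tt; have [[n0 n1 n2 n3] _] := torus_neq0 Tt.
have [E1 E2 E3 E4] := torus_opp Tt; have H := torus_highest Tt.
split; last by rewrite H E1.
have Q : (dc 0 t * dc 3 t * dc 5 t * dc 6 t) * (dc 1 t * dc 2 t * dc 4 t * dc 7 t)
    = (dc 0 t * dc 7 t) * (dc 1 t * dc 6 t) * (dc 2 t * dc 5 t) * (dc 3 t * dc 4 t).
  by ring.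
by move: Q; rewrite H E1 E2 E3 E4 !mulr1.
Qed.

Lemma X_torus t g : torus h t ->
  [/\ X 0 (t * g)%g = dc 0 t * X 0 g, X 1 (t * g)%g = dc 1 t * X 1 g,
      X 2 (t * g)%g = dc 2 t * X 2 g & X 3 (t * g)%g = dc 3 t * X 3 g] /\
  [/\ X 4 (t * g)%g = dc 4 t * X 4 g, X 5 (t * g)%g = dc 5 t * X 5 g,
      X 6 (t * g)%g = dc 6 t * X 6 g & X 7 (t * g)%g = dc 7 t * X 7 g].
Proof.
move=> Tt; apply: c8_inj.
by rewrite -frame_v0 frameM -mulmxA frame_v0 torus_c8.
Qed.

Local Notation P := (P_alpha3 h).

Lemma P_sub (j : 'I_3) n : j != ord_max -> reflection_rep h j n -> P n.
Proof. by move=> jm rn S [_ GS]; apply: GS; right; exists j. Qed.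

Lemma P_borel g : borel h g -> P g.
Proof. by move=> bg S [_ GS]; apply: GS; left. Qed.

Lemma P_div g g' : P g -> P g' -> P (g * g'^-1)%g.
Proof. by move=> pg pg' S HS; case: (HS) => [[_ D] _]; apply: D; [exact: pg|exact: pg']. Qed.

Lemma P_one : P 1%g.
Proof. by move=> S [[]]. Qed.

Lemma P_inv g : P g -> P g^-1%g.
Proof. by move=> pg; rewrite -[X in P X]mul1g; exact: P_div P_one pg. Qed.

Lemma P_mul g g' : P g -> P g' -> P (g * g')%g.
Proof. by move=> pg pg'; rewrite -[g']invgK; apply: P_div => //; exact: P_inv. Qed.

End Parabolic.

(** * Lower root elements of the parabolic *)

Section LowerRootSubgroups.
Variable C : numClosedFieldType.
Local Notation G := (Spin7 C).
Variable h : G.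
Implicit Types (f : G -> C) (g p t n : G).
Local Notation fr := (frame h).
Local Notation dc := (dcoef h).
Local Notation P := (P_alpha3 h).
Local Notation X := (coord h).

Lemma cartan_entry (i j : 'I_3) : cartan_B3 i j =
  nth 0 (nth [::] [:: [:: 2; -1; 0]; [:: -1; 2; -2]; [:: 0; -1; 2]] i) j.
Proof. by rewrite mxE. Qed.

Lemma frame_mul_inj n (x y : 'cV[C]_8) : fr n *m x = fr n *m y -> x = y.
Proof.
have V z : fr n^-1%g *m (fr n *m z) = z :> 'cV_8.
  by rewrite mulmxA (frameV h n : _ *m _ = _) mul1mx.
by move=> E; rewrite -[x]V E V.
Qed.

Lemma conj_frame n t (x : 'cV[C]_8) :
  fr n *m (fr (t ^ n)%g *m x) = fr t *m (fr n *m x).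
Proof.
have nt : fr n * fr (t ^ n)%g = fr t * fr n.
  by rewrite -!frameM conjgE mulgA mulgV mul1g.
by rewrite mulmxA [RHS]mulmxA (nt : _ *m _ = _).
Qed.

Lemma reflection1 n : fr n = refl1 C -> reflection_rep h (inord 0) n.
Proof.
move=> fn t Tt.
have [[n0 n1 n2 n3] [n4 n5 n6 n7]] := torus_neq0 Tt.
have E x0 x1 x2 x3 x4 x5 x6 x7 : fr (t ^ n)%g *m c8 x0 x1 x2 x3 x4 x5 x6 x7 =
    c8 (dc 0 t * x0) (dc 1 t * x1) (dc 4 t * x2) (dc 5 t * x3)
       (dc 2 t * x4) (dc 3 t * x5) (dc 6 t * x6) (dc 7 t * x7).
  apply: (@frame_mul_inj n); rewrite conj_frame fn !refl1_c8 torus_c8 //.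
  by congr c8; ring.
have [Tn [[d0 d1 d2 d3] [d4 d5 d6 d7]]] := torusP E.
split=> // i; rewrite /simple_root cartan_entry /= !inordK //=.
case: i => [[|[|[|]]]] //= _; rewrite ?d0 ?d1 ?d2 ?d4.
- by rewrite -invr_expz (_ : (2 : int) = Posz 2) // -exprnP; field; rewrite n2 n4.
- by rewrite opprK expr1z; field; rewrite n2 n4.
- by rewrite oppr0 expr0z mulr1.
Qed.

Lemma reflection2 n : fr n = refl2 C -> reflection_rep h (inord 1) n.
Proof.
move=> fn t Tt.
have [[n0 n1 n2 n3] [n4 n5 n6 n7]] := torus_neq0 Tt.
have E x0 x1 x2 x3 x4 x5 x6 x7 : fr (t ^ n)%g *m c8 x0 x1 x2 x3 x4 x5 x6 x7 =
    c8 (dc 0 t * x0) (dc 2 t * x1) (dc 1 t * x2) (dc 3 t * x3)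
       (dc 4 t * x4) (dc 6 t * x5) (dc 5 t * x6) (dc 7 t * x7).
  apply: (@frame_mul_inj n); rewrite conj_frame fn !refl2_c8 torus_c8 //.
  by congr c8; ring.
have [Tn [[d0 d1 d2 d3] [d4 d5 d6 d7]]] := torusP E.
split=> // i; rewrite /simple_root cartan_entry /= !inordK //=.
case: i => [[|[|[|]]]] //= _; rewrite ?d0 ?d1 ?d2 ?d4.
- by rewrite opprK expr1z; field; rewrite n2 n4.
- by rewrite -invr_expz (_ : (2 : int) = Posz 2) // -exprnP; field; rewrite n2 n1.
- by rewrite opprK expr1z; field; rewrite n2 n1.
Qed.

Lemma frame_lower_P A A' N n j a :
  fr n = N -> j != ord_max -> reflection_rep h j n ->
  P a -> N * fr a = A * N -> fr A' = A -> P A'.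
Proof.
move=> fn jm rn Pa E fA.
have -> : A' = (n * a * n^-1)%g.
  by apply: (can_inj (mulgK n)); rewrite -mulgA mulVg mulg1; apply: (@frame_inj _ h);
    rewrite !frameM fA fn E.
by have Pn := P_sub jm rn; apply: P_div => //; exact: P_mul.
Qed.

Lemma upper_P (A : 'M[C]_8) a : fr a = A ->
  (forall i j : 'I_8, (j < i)%N -> A i j = 0) -> P a.
Proof. by move=> fa H; apply: P_borel => i j ij; rewrite fa H. Qed.

Lemma c8_upper (A : 'M[C]_8) : (forall k i, (k < i)%N -> (i < 8)%N ->
    (A *m delta_mx (inord k) 0 : 'cV_8) (inord i) 0 = 0) ->
  forall i j : 'I_8, (j < i)%N -> A i j = 0.
Proof.
move=> H i j ij; have := H j i ij (ltn_ord i).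
by rewrite -colE mxE !inord_val.
Qed.

Lemma upper_unip1 a (i j : 'I_8) : (j < i)%N -> unip (f2 C) (e1 C) a i j = 0.
Proof.
move: i j; apply: c8_upper.
move=> [|[|[|[|[|[|[|[|k]]]]]]]] [|[|[|[|[|[|[|[|i]]]]]]]] // _ _;
  rewrite -c8_delta upper1_c8 mxE inordK //=; ring.
Qed.

Lemma upper_unip2 a (i j : 'I_8) : (j < i)%N -> unip (f3 C) (e2 C) a i j = 0.
Proof.
move: i j; apply: c8_upper.
move=> [|[|[|[|[|[|[|[|k]]]]]]]] [|[|[|[|[|[|[|[|i]]]]]]]] // _ _;
  rewrite -c8_delta upper2_c8 mxE inordK //=; ring.
Qed.

Lemma lower1_P g a : fr g = unip (f1 C) (e2 C) a -> P g.
Proof.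
move=> fg; have [n fn] := frame_surj h (refl1_spin C).
have [u fu] := frame_surj h (upper1_spin (- a)).
have Pu : P u by apply: (upper_P fu) => i j; exact: upper_unip1.
apply: (frame_lower_P fn _ (reflection1 fn) Pu _ fg); first by rewrite -val_eqE /= inordK.
by rewrite fu refl1_upper1.
Qed.

Lemma lower2_P g a : fr g = unip (f2 C) (e3 C) a -> P g.
Proof.
move=> fg; have [n fn] := frame_surj h (refl2_spin C).
have [u fu] := frame_surj h (upper2_spin (- a)).
have Pu : P u by apply: (upper_P fu) => i j; exact: upper_unip2.
apply: (frame_lower_P fn _ (reflection2 fn) Pu _ fg); first by rewrite -val_eqE /= inordK.
by rewrite fu refl2_upper2.
Qed.

(** The first simple reflection carries -alpha2 to -(alpha1 + alpha2), so this follows from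
    [lower2_P]. *)
Lemma lower12_P g a : fr g = unip (f1 C) (e3 C) a -> P g.
Proof.
move=> fg; have [n fn] := frame_surj h (refl1_spin C).
have [u fu] := frame_surj h (lower2_spin (- a)).
apply: (frame_lower_P fn _ (reflection1 fn) (lower2_P fu) _ fg).
  by rewrite -val_eqE /= inordK.
by rewrite fu refl1_lower2.
Qed.

End LowerRootSubgroups.

(** * The character of the parabolic on the highest weight line *)

Section HighestWeightLine.
Variable C : numClosedFieldType.
Local Notation G := (Spin7 C).
Variable h : G.
Implicit Types (f : G -> C) (g p t n : G).
Local Notation fr := (frame h).
Local Notation dc := (dcoef h).
Local Notation P := (P_alpha3 h).
Local Notation X := (coord h).

Lemma frame_eigen_neq0 g c : fr g *m v0 C = c *: v0 C -> c != 0.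
Proof.
move=> E; apply/eqP => c0; move: E; rewrite c0 scale0r => E.
have : v0 C = 0 by apply: (@frame_mul_inj _ h g); rewrite E mulmx0.
by move/colP/(_ (inord 0))/eqP; rewrite !mxE inordK //= oner_eq0.
Qed.

(** This is 2 varpi3 = alpha1 + 2 alpha2 + 3 alpha3. The factor 2 is forced, as varpi3 is not in the
    root lattice, whereas reflection representatives are specified only by their effect on roots. *)
Lemma simple_root_highest t : torus h t ->
  simple_root h (inord 0) t * simple_root h (inord 1) t ^+ 2 *
  simple_root h (inord 2) t ^+ 3 = dc 0 t ^+ 2.
Proof.
move=> Tt; have [[n0 n1 n2 _] [n4 _ _ _]] := torus_neq0 Tt.
rewrite /simple_root /= !inordK //=.
transitivity (dc 0 t ^+ 3 / (dc 1 t * dc 2 t * dc 4 t)).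
  by field; rewrite n1 n2 n4.
by rewrite torus_highest //; field.
Qed.

Lemma simple_root_neq0 (j : 'I_3) t : torus h t -> simple_root h j t != 0.
Proof.
move=> Tt; have [[n0 n1 n2 n3] [n4 n5 n6 n7]] := torus_neq0 Tt.
by rewrite /simple_root; case: (val j) => [|[|k]]; rewrite mulf_neq0 ?invr_eq0.
Qed.

(** The combination of simple roots equal to 2 varpi3 pairs to zero with the coroots of alpha1 and
    alpha2. *)
Lemma reflection_fixes_highest j n t : j != ord_max -> reflection_rep h j n ->
  torus h t -> dc 0 (t ^ n)%g ^+ 2 = dc 0 t ^+ 2.
Proof.
move=> jm rn Tt; have [Tn E] := rn t Tt.
have an := simple_root_neq0 j Tt.
rewrite -!simple_root_highest // !E !cartan_entry !inordK //.
move: an; move: (simple_root h j t) => a an.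
case: j jm {E rn} => [[|[|[|]]]] //= Hj _.
- have -> : a ^ (- (2 : int)) = (a ^+ 2)^-1 by rewrite -invr_expz.
  by rewrite opprK expr1z oppr0 expr0z mulr1; field.
- have -> : a ^ (- (2 : int)) = (a ^+ 2)^-1 by rewrite -invr_expz.
  by rewrite !opprK !expr1z; field.
Qed.

(* The weight of [n v0] has the same square as the highest weight; the coroots at
   the value 2 separate this square from those of the other weights. *)
Lemma reflection_line j n : j != ord_max -> reflection_rep h j n ->
  exists c, fr n *m v0 C = c *: v0 C.
Proof.
move=> jm rn.
have two : (2 : C) != 0 by rewrite pnatr_eq0.
have [x0 [x1 [x2 [x3 [x4 [x5 [x6 [x7 E]]]]]]]] := c8P (fr n *m v0 C).
have act t : torus h t -> fr t *m (fr n *m v0 C) = dc 0 (t ^ n)%g *: (fr n *m v0 C).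
  move=> Tt; have [Tn _] := rn t Tt.
  rewrite -conj_frame /v0 torus_c8 // scalemxAr c8Z; congr (_ *m _).
  by congr c8; ring.
have zero (d e x : C) : d * x = e * x -> d ^+ 2 != e ^+ 2 -> x = 0.
  move=> /eqP; rewrite -subr_eq0 -mulrBl mulf_eq0 subr_eq0 => /orP[/eqP ->|/eqP //].
  by rewrite eqxx.
have four : (2 : C) ^+ 2 != (2^-1) ^+ 2.
  rewrite exprVn; apply/eqP => e.
  have : (2 : C) ^+ 2 * 2 ^+ 2 == 1 by rewrite {1}e mulVf // expf_neq0.
  by rewrite -exprD -natrX pnatr_eq1.
have tor (A : 'M[C]_8) (sA : A \in spin7_pred (C := C)) d0 d1 d2 d3 d4 d5 d6 d7 :
    (forall y0 y1 y2 y3 y4 y5 y6 y7, A *m c8 y0 y1 y2 y3 y4 y5 y6 y7 =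
      c8 (d0 * y0) (d1 * y1) (d2 * y2) (d3 * y3)
         (d4 * y4) (d5 * y5) (d6 * y6) (d7 * y7)) -> d0 = 2^-1 ->
    exists d, [/\ d ^+ 2 = (2^-1) ^+ 2,
      [/\ d0 * x0 = d * x0, d1 * x1 = d * x1, d2 * x2 = d * x2 & d3 * x3 = d * x3] &
      [/\ d4 * x4 = d * x4, d5 * x5 = d * x5, d6 * x6 = d * x6 & d7 * x7 = d * x7]].
  move=> AE d0E; have [t ft] := frame_surj h sA.
  have AE' := AE; rewrite -ft in AE'.
  have [Tt [[e0 _ _ _] _]] := torusP AE'.
  have := act t Tt; rewrite E ft AE c8Z => /c8_inj[H1 H2].
  exists (dc 0 (t ^ n)%g); split=> //.
  by rewrite (reflection_fixes_highest jm rn Tt) e0 d0E.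
have [c [c2 [_ _ _ _] [z4 z5 z6 z7]]] := tor _ (coroot1_spin two) _ _ _ _ _ _ _ _
  (fun y0 y1 y2 y3 y4 y5 y6 y7 => coroot1_c8 2 y0 y1 y2 y3 y4 y5 y6 y7) erefl.
have [d [d2 [_ _ z2 z3] _]] := tor _ (coroot2_spin two) _ _ _ _ _ _ _ _
  (fun y0 y1 y2 y3 y4 y5 y6 y7 => coroot2_c8 2 y0 y1 y2 y3 y4 y5 y6 y7) erefl.
have [e [ee2 [_ z1 _ _] _]] := tor _ (coroot3_spin two) _ _ _ _ _ _ _ _
  (fun y0 y1 y2 y3 y4 y5 y6 y7 => coroot3_c8 2 y0 y1 y2 y3 y4 y5 y6 y7) erefl.
exists x0; rewrite E c8Z !mulr0 mulr1.
by rewrite (zero _ _ _ z1) ?ee2 // (zero _ _ _ z2) ?d2 // (zero _ _ _ z3) ?d2 //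
  (zero _ _ _ z4) ?c2 // (zero _ _ _ z5) ?c2 // (zero _ _ _ z6) ?c2 //
  (zero _ _ _ z7) ?c2.
Qed.

Lemma P_line p : P p -> fr p *m v0 C = varpi3 h p *: v0 C.
Proof.
move=> Pp; suff [c E] : exists c, fr p *m v0 C = c *: v0 C.
  have := E; rewrite {1}frame_v0 {2}/v0 c8Z => /c8_inj[[e _ _ _] _].
  by rewrite E; congr (_ *: _); rewrite -[c]mulr1 -e.
(* The stabilizer of the line is a subgroup containing the generators, hence contains the smallest
   one. *)
suff : [set q : G | exists c, fr q *m v0 C = c *: v0 C]%classic p by [].
apply: Pp; split.
  split=> [|x y [c cE] [d dE]] /=; first by exists 1; rewrite frame1 mul1mx scale1r.
  have d0 := frame_eigen_neq0 dE.
  have V : fr y^-1%g *m v0 C = d^-1 *: v0 C.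
    apply: (@frame_mul_inj _ h y); rewrite -scalemxAr dE scalerA mulVf // scale1r.
    by rewrite mulmxA -[fr y *m _]/(fr y * fr y^-1%g) -frameM mulgV frame1 mul1mx.
  by exists (d^-1 * c); rewrite frameM -mulmxA V -scalemxAr cE scalerA.
move=> g [bg|[j /= jm rn]]; last exact: reflection_line jm rn.
have Z k : (0 < k)%N -> (k < 8)%N -> X k g = 0.
  by move=> k0 k8; apply: bg; rewrite !inordK.
by exists (X 0 g); rewrite frame_v0 c8Z !mulr0 mulr1 !(Z 1, Z 2, Z 3, Z 4, Z 5, Z 6, Z 7)%N.
Qed.

Lemma X_P i g p : P p -> X i (g * p)%g = varpi3 h p * X i g.
Proof.
move=> Pp; have := P_line Pp; rewrite c8_delta => E.
have : fr (g * p)%g *m delta_mx (inord 0) 0 =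
    varpi3 h p *: (fr g *m delta_mx (inord 0) 0 : 'cV_8).
  by rewrite frameM -mulmxA E -scalemxAr.
have H (A : 'M[C]_8) : col (inord 0) A (inord i) 0 = A (inord i) (inord 0).
  by rewrite mxE.
have HZ c (u : 'cV[C]_8) k : (c *: u) k 0 = c * u k 0 by rewrite mxE.
by rewrite -!colE => /colP/(_ (inord i)); rewrite HZ !H.
Qed.

End HighestWeightLine.

(** * Weighted homogeneous polynomials *)

Section Evaluation.
Variable C : numClosedFieldType.
Local Notation R3 := {mpoly C[3]}.
Implicit Types (A B : {poly R3}) (v : 'I_3 -> C) (t s : C).

Definition ev A v t : C := (map_poly (meval v) A).[t].

Lemma evM A B v t : ev (A * B) v t = ev A v t * ev B v t.
Proof. by rewrite /ev rmorphM hornerM. Qed.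

Lemma evC c v t : ev c%:P v t = c.@[v].
Proof. by rewrite /ev map_polyC hornerC. Qed.

Lemma evXn n v t : ev 'X^n v t = t ^+ n.
Proof. by rewrite /ev map_polyXn hornerXn. Qed.

Lemma ev_sum (I : Type) (r : seq I) (Q : pred I) (F : I -> {poly R3}) v t :
  ev (\sum_(i <- r | Q i) F i) v t = \sum_(i <- r | Q i) ev (F i) v t.
Proof. by rewrite /ev rmorph_sum horner_sum. Qed.

Lemma ev_coef A n v t : (size A <= n)%N ->
  ev A v t = \sum_(i < n) (A`_i).@[v] * t ^+ i.
Proof.
move=> sz; rewrite /ev (@horner_coef_wide _ n); last first.
  exact: leq_trans (size_poly _ _) sz.
by apply: eq_bigr => i _; rewrite coef_map.
Qed.

Lemma ev_eq0 A : (forall v t, t != 0 -> ev A v t = 0) -> A = 0.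
Proof.
(* The factor ['X] makes the evaluation vanish at t = 0 as well. *)
move=> H; suff : 'X * A = 0 by move/eqP; rewrite mulf_eq0 polyX_eq0 => /eqP.
apply/polyP => i; rewrite coef0; apply: meval_eq0 => [|v].
  exact: char0_units_numField.
have E : map_poly (meval v) ('X * A) = 0.
  apply: poly_eval_eq0 => [|t]; first exact: char0_units_numField.
  rewrite -/(ev _ v t) evM -[X in ev X]expr1 evXn expr1.
  by have [->|t0] := eqVneq t 0; rewrite ?mul0r // H // mulr0.
by rewrite -coef_map /= E coef0.
Qed.

Lemma ev_inj A B : (forall v t, t != 0 -> ev A v t = ev B v t) -> A = B.
Proof.
move=> H; apply/eqP; rewrite -subr_eq0; apply/eqP/ev_eq0 => v t t0.
have -> : ev (A - B) v t = ev A v t - ev B v t by rewrite /ev rmorphB hornerD hornerN.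
by rewrite H ?subrr.
Qed.

(** Weighted homogeneity of degree 4k, the three variables having degree 2 and the polynomial
    variable, which stands for T_0 or T_1, degree 4. *)
Definition whomog k A : Prop := forall i,
  ((i <= k)%N -> A`_i \is (2 * (k - i))%N.-homog) /\ ((k < i)%N -> A`_i = 0).

Lemma whomog_size k A : whomog k A -> (size A <= k.+1)%N.
Proof. by move=> H; apply/leq_sizeP => i ki; apply: (H i).2. Qed.

Definition mon_value v (m : 'X_{1..3}) : C := \prod_i v i ^+ m i.

Lemma monv_scale v m a : mon_value (fun i => a * v i) m = a ^+ mdeg m * mon_value v m.
Proof.
rewrite /mon_value mdegE -prodrXr -big_split /=.
by apply: eq_bigr => i _; rewrite exprMn.
Qed.

(* The even part of [F], homogenized with the help of a variable of degree 4,
   the variables of [F] having degree 2. *)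
Definition homogenize M (F : R3) : {poly R3} :=
  \sum_(m <- msupp F | ~~ odd (mdeg m))
    (F@_m *: 'X_[m])%:P * 'X^(M - (mdeg m)./2).

Lemma whomog_homogenize M F : (msize F <= M)%N -> whomog M (homogenize M F).
Proof.
move=> sM i; rewrite /homogenize coef_sum; split=> iM.
  rewrite big_seq_cond; elim/big_rec: _ => [|m x /andP[mF om] Hx].
    exact: dhomog0.
  apply: dhomogD => //; rewrite coefCM coefXn.
  case: eqP => [e|_]; last by rewrite mulr0 dhomog0.
  have mM := leq_trans (msize_mdeg_lt mF) sM.
  rewrite mulr1 dhomogZ // dhomogX; apply/eqP.
  have := odd_double_half (mdeg m); rewrite (negbTE om) add0n -muln2.
  by transitivity (mdeg m) => //; move: mM e iM; lia.
apply: big1_seq => m /andP[om mF]; rewrite coefCM coefXn.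
by case: eqP => [e|_]; rewrite ?mulr0 //; lia.
Qed.

(** Adding the values at opposite points kills the odd monomials; in an even degree 2d the factor
    s^(4M) / s^(4d) is t^(M - d). *)
Lemma ev_homogenize M F v t s : (msize F <= M)%N -> s != 0 -> s ^+ 4 = t ->
  2 * ev (homogenize M F) v t =
  s ^+ (4 * M) * (F.@[fun i => (s ^+ 2)^-1 * v i] +
                  F.@[fun i => - (s ^+ 2)^-1 * v i]).
Proof.
move=> sM s0 st; rewrite /homogenize ev_sum !mevalE -big_split /= !mulr_sumr.
rewrite [RHS](bigID (fun m : 'X_{1..3} => ~~ odd (mdeg m))) /= [X in _ + X]big1 ?addr0.
  rewrite [LHS]big_seq_cond [RHS]big_seq_cond; apply: eq_bigr => m /andP[mF om].
  have mM := leq_trans (msize_mdeg_lt mF) sM.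
  rewrite evM evC evXn mevalZ mevalX -/(mon_value v m).
  rewrite -/(mon_value (fun i => (s ^+ 2)^-1 * v i) m).
  rewrite -/(mon_value (fun i => - (s ^+ 2)^-1 * v i) m) !monv_scale.
  rewrite exprNn -signr_odd (negbTE om) expr0 mul1r.
  have -> : s ^+ (4 * M) = (s ^+ 2) ^+ mdeg m * t ^+ (M - (mdeg m)./2).
    rewrite -st -!exprM -exprD; congr (_ ^+ _).
    have := odd_double_half (mdeg m); rewrite (negbTE om) add0n -muln2.
    by move: mM; lia.
  by rewrite exprVn; field; rewrite expf_neq0 // expf_neq0.
move=> m; rewrite negbK => om.
rewrite -/(mon_value (fun i => (s ^+ 2)^-1 * v i) m).
rewrite -/(mon_value (fun i => - (s ^+ 2)^-1 * v i) m) !monv_scale.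
by rewrite [in X in _ + X]exprNn -signr_odd om expr1; ring.
Qed.

Lemma homogenize_even M F v :
  (msize F <= M)%N -> (forall w, F.@[w] = F.@[fun i => - w i]) ->
  ev (homogenize M F) v 1 = F.@[v].
Proof.
move=> sM ev_F; have two : (2 : C) != 0 by rewrite pnatr_eq0.
have E1 : F.@[fun i => (1 ^+ 2)^-1 * v i] = F.@[v].
  by apply: meval_eq => i; rewrite expr1n invr1 mul1r.
have E2 : F.@[fun i => - (1 ^+ 2)^-1 * v i] = F.@[v].
  by rewrite (ev_F v); apply: meval_eq => i; rewrite expr1n invr1 mulN1r.
apply: (mulfI two).
rewrite (@ev_homogenize M F v 1 1 sM (oner_neq0 _) (expr1n _ 4)) E1 E2 expr1n.
by ring.
Qed.

Lemma meval_exp v (p : R3) n : (p ^+ n).@[v] = p.@[v] ^+ n.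
Proof. exact: rmorphXn. Qed.

Definition quadratic_coord (v : 'I_3 -> C) : C := v (inord 0) - v (inord 1) + v (inord 2).
Definition quartic (v : 'I_3 -> C) : C :=
  quadratic_coord v * v (inord 0) * v (inord 1) * v (inord 2).

Definition quartic_poly : R3 :=
  ('X_(inord 0) - 'X_(inord 1) + 'X_(inord 2)) *
  'X_(inord 0) * 'X_(inord 1) * 'X_(inord 2).

Lemma quartic_polyE v : quartic_poly.@[v] = quartic v.
Proof. by rewrite /quartic_poly !(mevalM, mevalD, mevalN, mevalXU). Qed.

Lemma quartic_poly_neq0 : quartic_poly != 0.
Proof.
apply/eqP => z; have := quartic_polyE (fun=> 1); rewrite z meval0 /quartic /quadratic_coord.
by rewrite !mulr1 subrr add0r => /eqP; rewrite eq_sym oner_eq0.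
Qed.

(** Multiplied by t^(N+M), both sides become polynomials in t. The coefficient of t^(i+M) on the
    right comes from j = 2N - i, and the N-th power of the quartic cancels. *)
Lemma glue_coef N M A B : whomog M A -> whomog M B ->
  (forall v t, t != 0 ->
     (quartic v / t) ^+ N * ev A v t = t ^+ N * ev B v (quartic v / t)) ->
  forall i, (i < N)%N -> A`_i = B`_(2 * N - i) * quartic_poly ^+ (N - i).
Proof.
move=> wA wB E i iN.
pose L := (quartic_poly ^+ N)%:P * A * 'X^M.
pose R := \sum_(j < M.+1) (B`_j * quartic_poly ^+ j)%:P * 'X^(2 * N + M - j).
have LR : L = R.
  apply: ev_inj => v t t0.
  rewrite /L /R !evM evC evXn meval_exp quartic_polyE ev_sum.
  transitivity (t ^+ (N + M) * ((quartic v / t) ^+ N * ev A v t)).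
    by rewrite exprD expr_div_n; field; rewrite expf_neq0.
  rewrite E // (ev_coef _ _ (whomog_size wB)) mulrA mulr_sumr.
  apply: eq_bigr => j _; rewrite evM evC evXn mevalM meval_exp quartic_polyE.
  have -> : t ^+ (2 * N + M - j) = t ^+ (N + M) * t ^+ N / t ^+ j.
    apply: (mulIf (expf_neq0 j t0)); rewrite divfK ?expf_neq0 // -!exprD.
    by congr (_ ^+ _); have := ltn_ord j; lia.
  by rewrite expr_div_n; ring.
have := congr1 (fun p : {poly R3} => p`_(i + M)) LR.
rewrite /L /R coefMXn ltnNge leq_addl /= addnK coefCM coef_sum => H.
have qn0 := quartic_poly_neq0; apply: (mulfI (expf_neq0 N qn0)); rewrite H.
have [jM|jM] := leqP (2 * N - i) M; last first.
  rewrite (wB _).2 // mul0r mulr0 big1 // => j _.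
  by rewrite coefCM coefXn; case: eqP => [e|_]; rewrite ?mulr0 //; have := ltn_ord j; lia.
have jM' : (2 * N - i < M.+1)%N by [].
rewrite (bigD1 (Ordinal jM')) //= big1 => [|j ne].
  rewrite coefCM coefXn (_ : (i + M == 2 * N + M - (2 * N - i))%N) ?mulr1 ?addr0; last lia.
  rewrite mulrCA -exprD; congr (_ * _ ^+ _); lia.
rewrite coefCM coefXn; case: eqP => [e|_]; rewrite ?mulr0 //.
by case/eqP: ne; apply: val_inj => /=; have := ltn_ord j; lia.
Qed.

(** The terms of [A] of degree at least N are visibly divisible by t^N. A lower term i carries a
    factor (t t')^(N-i) by [glue_coef], so it is t^N times a term of degree N - i in t'. *)
Lemma glue_charts N M A B : (N <= M)%N -> whomog M A -> whomog M B ->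
  (forall v t, t != 0 ->
     (quartic v / t) ^+ N * ev A v t = t ^+ N * ev B v (quartic v / t)) ->
  exists A' B', [/\ whomog (M - N) A', whomog (M - N) B' &
    forall v t t', t * t' = quartic v ->
      ev A v t = t ^+ N * (ev A' v t + ev B' v t')].
Proof.
move=> NM wA wB E; have AB := glue_coef wA wB E.
pose A' := \poly_(i < (M - N).+1) A`_(N + i).
(* The constant term is set to zero because the term of degree N is already in [A']. *)
pose B' := \poly_(i < N.+1) (if i == 0%N then 0 else B`_(N + i)).
have wA' : whomog (M - N) A'.
  move=> i; rewrite coef_poly ltnS; split=> iM; last by rewrite leqNgt iM.
  rewrite iM (_ : M - N - i = M - (N + i))%N; last lia.
  by apply: (wA _).1; lia.
have wB' : whomog (M - N) B'.
  move=> i; rewrite coef_poly; split=> iM; last first.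
    by case: ifP => // _; case: ifP => // _; apply: (wB _).2; lia.
  case: ifP => _; last exact: dhomog0.
  case: ifP => _; first exact: dhomog0.
  rewrite (_ : M - N - i = M - (N + i))%N; last lia.
  by apply: (wB _).1; lia.
exists A', B'; split=> // v t t' tt'.
have szB' : (size B' <= N.+1)%N by exact: size_poly.
rewrite (ev_coef _ _ (whomog_size wA)) (ev_coef _ _ (whomog_size wA')) (ev_coef _ _ szB').
rewrite -(big_mkord xpredT (fun i => (A`_i).@[v] * t ^+ i)).
rewrite (@big_cat_nat _ _ _ N) /= ?(leqW NM) // addrC mulrDr; congr (_ + _).
  rewrite -{1}[N]add0n big_addn subSn // big_mkord mulr_sumr.
  apply: eq_bigr => i _; rewrite coef_poly ltn_ord exprD [(i + N)%N]addnC.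
  by ring.
rewrite big_ord_recl coef_poly /= meval0 mul0r add0r mulr_sumr.
rewrite -(big_mkord xpredT (fun i => t ^+ N * ((B'`_i.+1).@[v] * t' ^+ i.+1))) /=.
rewrite big_nat_rev /= big_nat_cond [RHS]big_nat_cond.
apply: eq_bigr => i /andP[/andP[_ iN] _]; rewrite add0n AB; last lia.
rewrite coef_poly ltnS iN /= mevalM meval_exp quartic_polyE -tt' exprMn.
rewrite (_ : 2 * N - (N - i.+1) = N + i.+1)%N; last lia.
rewrite (_ : N - (N - i.+1) = i.+1)%N; last lia.
have -> : t ^+ N = t ^+ (N - i.+1) * t ^+ i.+1.
  by rewrite -exprD; congr (_ ^+ _); lia.
by ring.
Qed.

End Evaluation.

(** * The slice through the open cell *)

Section Slice.
Variable C : numClosedFieldType.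
Local Notation G := (Spin7 C).
Variable h : G.
Implicit Types (f : G -> C) (g p t n : G).
Local Notation fr := (frame h).
Local Notation dc := (dcoef h).
Local Notation P := (P_alpha3 h).
Local Notation X := (coord h).

Definition ycoord g (i : 'I_3) : C := X i.+1 g * X (6 - i) g.
Definition tetra0 g : C := X 0 g * X 3 g * X 5 g * X 6 g.
Definition tetra1 g : C := X 1 g * X 2 g * X 4 g * X 7 g.

Local Notation Yv := ycoord.
Local Notation T0 := tetra0.
Local Notation T1 := tetra1.

Lemma YvE g : (Yv g (inord 0) = X 1 g * X 6 g) * (Yv g (inord 1) = X 2 g * X 5 g) *
  (Yv g (inord 2) = X 3 g * X 4 g).
Proof. by rewrite /Yv !inordK. Qed.

(** The highest weight vector is isotropic for the invariant form, and so is its image. *)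
Lemma quadric g : X 0 g * X 7 g = quadratic_coord (Yv g).
Proof.
have := bform_frame h g (v0 C) (v0 C); rewrite !(frame_v0 h) !bform_c8 => E.
have two : (2 : C) != 0 by rewrite pnatr_eq0.
apply/eqP; rewrite -subr_eq0 -(mulrI_eq0 _ (mulfI two)); apply/eqP.
transitivity (1 * 0 - 0 * 0 + 0 * 0 - 0 * 0 - 0 * 0 + 0 * 0 - 0 * 0 + 0 * 1 : C).
  by rewrite -E /quadratic_coord !YvE; ring.
by ring.
Qed.

Lemma T0T1 g : T0 g * T1 g = quartic (Yv g).
Proof. by rewrite /quartic -quadric !YvE /T0 /T1; ring. Qed.

Lemma regular_X i : regular (X i).
Proof. exact: regular_frame. Qed.

Lemma invariants_Yv i : invariants h 2 (Yv^~ i).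
Proof.
split; last first.
  move=> t g Tt; have [[x0 x1 x2 x3] [x4 x5 x6 x7]] := X_torus g Tt.
  have [E0 E1 E2 E3] := torus_opp Tt.
  rewrite /Yv; case: i => [[|[|[|]]]] //= _; rewrite ?x1 ?x2 ?x3 ?x4 ?x5 ?x6.
  - by rewrite mulrACA E1 mul1r.
  - by rewrite mulrACA E2 mul1r.
  - by rewrite mulrACA E3 mul1r.
split; first by apply: regularM; exact: regular_X.
by move=> g p Pp; rewrite /Yv !X_P //; ring.
Qed.

Lemma invariants_T0 : invariants h 4 T0.
Proof.
split; last first.
  move=> t g Tt; have [[x0 x1 x2 x3] [x4 x5 x6 x7]] := X_torus g Tt.
  have [E _] := torus_tetrahedra Tt.
  by rewrite -[RHS]mul1r -E /T0 x0 x3 x5 x6; ring.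
split; first by do 3![apply: regularM; last exact: regular_X]; exact: regular_X.
by move=> g p Pp; rewrite /T0 !X_P //; ring.
Qed.

Lemma invariants_T1 : invariants h 4 T1.
Proof.
split; last first.
  move=> t g Tt; have [[x0 x1 x2 x3] [x4 x5 x6 x7]] := X_torus g Tt.
  have [_ E] := torus_tetrahedra Tt.
  by rewrite -[RHS]mul1r -E /T1 x1 x2 x4 x7; ring.
split; first by do 3![apply: regularM; last exact: regular_X]; exact: regular_X.
by move=> g p Pp; rewrite /T1 !X_P //; ring.
Qed.

Definition chart_pt (v : 'I_3 -> C) : G :=
  (MkSpin7 (chart_spin (v (inord 0)) (v (inord 1)) (v (inord 2))) ^ h^-1)%g.

Lemma frame_chart_pt v :
  fr (chart_pt v) = chart (v (inord 0)) (v (inord 1)) (v (inord 2)).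
Proof. by rewrite /frame -conjgM mulVg conjg1. Qed.

Lemma X_chart_pt v : [/\ X 0 (chart_pt v) = 1, X 1 (chart_pt v) = v (inord 0),
    X 2 (chart_pt v) = v (inord 1) & X 3 (chart_pt v) = 1] /\
  [/\ X 4 (chart_pt v) = v (inord 2), X 5 (chart_pt v) = 1, X 6 (chart_pt v) = 1
    & X 7 (chart_pt v) = quadratic_coord v].
Proof. by apply: c8_inj; rewrite -frame_v0 frame_chart_pt chart_highest. Qed.

Lemma ord3_ind (Q : 'I_3 -> Prop) : Q (inord 0) -> Q (inord 1) -> Q (inord 2) ->
  forall i, Q i.
Proof. by move=> Q0 Q1 Q2 i; rewrite -(inord_val i); case: i => [[|[|[|]]]]. Qed.

Lemma Yv_chart_pt v : Yv (chart_pt v) = v.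
Proof.
have [[x0 x1 x2 x3] [x4 x5 x6 x7]] := X_chart_pt v.
by apply/funext; apply: ord3_ind; rewrite YvE ?x1 ?x2 ?x3 ?x4 ?x5 ?x6 ?mulr1 ?mul1r.
Qed.

Lemma T0_chart_pt v : T0 (chart_pt v) = 1.
Proof.
have [[x0 x1 x2 x3] [x4 x5 x6 x7]] := X_chart_pt v.
by rewrite /T0 x0 x3 x5 x6 !mulr1.
Qed.

Lemma polyf_chart f : regular f -> polyf (fun v => f (chart_pt v)).
Proof.
move=> rf; apply: regular_polyf => //.
have -> : (fun v => val (chart_pt v)) = (fun v => val h * fr (chart_pt v) * val h^-1%g).
  by apply/funext => v; exact: val_frame.
have pU w e (F : ('I_3 -> C) -> C) : polyf F -> polym (fun v => unip w e (F v)).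
  move=> pF; apply: polymD; first exact: polym_cst.
  by apply: polymZ => //; exact: polym_cst.
have pX (i : 'I_3) : polyf (fun v : 'I_3 -> C => v i) by exact: polyf_var.
have p1 (i j : 'I_3) : polyf (fun v : 'I_3 -> C => 1 + v i * v j).
  by apply: polyfD; [exact: polyf_cst|exact: polyfM].
have pN (i : 'I_3) : polyf (fun v : 'I_3 -> C => - v i) by exact: polyfN.
apply: polymM; last exact: polym_cst.
apply: polymM; first exact: polym_cst.
have -> : (fun v => fr (chart_pt v)) =
    (fun v => chart (v (inord 0)) (v (inord 1)) (v (inord 2))).
  by apply/funext => v; exact: frame_chart_pt.
by do 5![apply: polymM; last exact: pU]; exact: pU.
Qed.

Definition minor i j g : C :=
  fr g (inord 0) (inord 0) * fr g (inord i) (inord j)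
  - fr g (inord i) (inord 0) * fr g (inord 0) (inord j).
Definition minor3 g : C := minor 1 1 g * minor 2 2 g - minor 1 2 g * minor 2 1 g.

(** The nonzero pivots of the elimination in [slice_value]: [minor 1 1] is the leading 2 x 2 minor
    and, by Chio's identity, [minor3] is X_0 times the leading 3 x 3 minor. *)
Definition generic g : Prop := [/\ T0 g != 0, minor 1 1 g != 0 & minor3 g != 0].

Lemma regularB f f' : regular f -> regular f' -> regular (fun g => f g - f' g).
Proof. by move=> rf rf'; apply: regularD => //; exact: regularN. Qed.

Lemma regular_minor i j : regular (minor i j).
Proof. by apply: regularB; apply: regularM; exact: regular_frame. Qed.

(** Irreducibility removes the conditions one at a time. The minors are nonzero at 1, but T_0
    vanishes there, so a chart point is its witness. *)
Lemma regular_generic f : regular f -> (forall g, generic g -> f g = 0) ->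
  forall g, f g = 0.
Proof.
move=> rf H.
have r3 : regular minor3.
  by apply: regularB; apply: regularM; exact: regular_minor.
have fr1 i j : fr 1%g (inord i) (inord j) = (inord i == inord j :> 'I_8)%:R.
  by rewrite frame1 mxE.
have m1 : minor 1 1 1%g = 1.
  by rewrite /minor !fr1 -!val_eqE /= !inordK //=; ring.
have m3 : minor3 1%g = 1.
  by rewrite /minor3 m1 /minor !fr1 -!val_eqE /= !inordK //=; ring.
have rT : regular T0 by have [[]] := invariants_T0.
have {}H g : f g * T0 g * minor 1 1 g * minor3 g = 0.
  have [gg|] := pselect (generic g); first by rewrite H // !mul0r.
  move=> ng; have [z|n0] := eqVneq (T0 g) 0; first by rewrite z mulr0 !mul0r.
  have [z|n1] := eqVneq (minor 1 1 g) 0; first by rewrite z mulr0 mul0r.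
  have [z|n2] := eqVneq (minor3 g) 0; first by rewrite z mulr0.
  by case: ng; split.
have [|E|E] := @regular_domain C (f * T0 * minor 1 1) minor3 _ r3 H.
- by apply: regularM; [apply: regularM|exact: regular_minor].
- have [||{}E|{}E] := @regular_domain C (f * T0) (minor 1 1) _ _ E.
  + exact: regularM.
  + exact: regular_minor.
  + have [//|{}E] := @regular_domain C f T0 rf rT E.
    by have := E (chart_pt (fun=> 0)); rewrite T0_chart_pt => /eqP; rewrite oner_eq0.
  + by have := E 1%g; rewrite m1 => /eqP; rewrite oner_eq0.
- by have := E 1%g; rewrite m3 => /eqP; rewrite oner_eq0.
Qed.

End Slice.

(** * Reduction of a generic element to the slice *)

Section Decomposition.
Variable C : numClosedFieldType.
Local Notation G := (Spin7 C).
Variable h : G.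
Implicit Types (f : G -> C) (g p t n : G).
Local Notation fr := (frame h).
Local Notation dc := (dcoef h).
Local Notation P := (P_alpha3 h).
Local Notation X := (coord h).
Local Notation Yv := (ycoord h).
Local Notation T0 := (tetra0 h).
Local Notation T1 := (tetra1 h).
Local Notation chart_pt := (chart_pt h).

Lemma torus_exists a b c : a != 0 -> b != 0 -> c != 0 ->
  exists2 t, torus h t & fr t = torus_elt a b c.
Proof.
move=> a0 b0 c0; have [t ft] := frame_surj h (torus_elt_spin a0 b0 c0).
exists t => //; apply: (proj1 (@torusP _ h t ((a * b * c) ^+ 2)^-1 (c ^+ 2)^-1
  (b ^+ 2)^-1 (a ^+ 2) (a ^+ 2)^-1 (b ^+ 2) (c ^+ 2) ((a * b * c) ^+ 2) _)) => *.
by rewrite ft torus_elt_c8 //; congr c8; rewrite mulrC.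
Qed.

(** The square roots make the coordinates 3, 5, 6 equal to s; the coordinate 0 then becomes T_0 /
    s^3 = s too, and the quadric fixes the coordinate 7. *)
Lemma normalize_torus g s : T0 g != 0 -> s ^+ 4 = T0 g ->
  exists a b c, [/\ [/\ a != 0, b != 0 & c != 0], a ^+ 2 = s / X 3 g,
    b ^+ 2 = s / X 5 g, c ^+ 2 = s / X 6 g &
    torus_elt a b c *m (fr g *m v0 C) =
    s *: (chart (Yv g (inord 0) / s ^+ 2) (Yv g (inord 1) / s ^+ 2)
      (Yv g (inord 2) / s ^+ 2) *m v0 C)].
Proof.
move=> n0 s4; have := n0; rewrite /tetra0 !mulf_eq0 !negb_or.
case/andP=> [/andP[/andP[x0 x3] x5] x6].
have s0 : s != 0 by apply: contraNneq n0 => z; rewrite -s4 z expr0n.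
have q (x : C) : x != 0 -> exists2 a, a != 0 & a ^+ 2 = s / x.
  move=> xn; exists (sqrtC (s / x)); last exact: sqrtCK.
  by rewrite sqrtC_eq0 mulf_neq0 // invr_eq0.
have [a a0 a2] := q _ x3; have [b b0 b2] := q _ x5; have [c c0 c2] := q _ x6.
exists a, b, c; split=> //.
have abc : (a * b * c) ^+ 2 = X 0 g / s.
  rewrite !exprMn a2 b2 c2; apply: (mulfI s0); rewrite [RHS]mulrC divfK //.
  apply: (mulIf x3); apply: (mulIf x5); apply: (mulIf x6).
  transitivity (s ^+ 4); first by field; rewrite x3 x5 x6.
  by rewrite s4 /tetra0.
rewrite (frame_v0 h) torus_elt_c8 // abc a2 b2 c2 /v0 chart_highest c8Z.
rewrite !(YvE h).
have E7 : X 0 g * X 7 g = X 1 g * X 6 g - X 2 g * X 5 g + X 3 g * X 4 g.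
  by rewrite quadric /quadratic_coord !YvE.
congr c8; try by field; rewrite ?x0 ?x3 ?x5 ?x6 ?s0.
transitivity ((X 0 g * X 7 g) / s); first by field.
by rewrite E7; field.
Qed.

(** The element B = u^-1 t g scales the highest weight vector by s, but membership in the parabolic
    must come from its generators: lower root elements reduce B to the Borel subgroup. *)
Lemma slice_value f m g s : invariants h m f -> generic h g -> s ^+ 4 = T0 g ->
  f g = s ^+ m * f (chart_pt (fun i => Yv g i / s ^+ 2)).
Proof.
move=> [[rf Pf] Tf] [n0 n1 n3] s4.
have := n0; rewrite /tetra0 !mulf_eq0 !negb_or => /andP[/andP[/andP[x0 x3] x5] x6].
have s0 : s != 0 by apply: contraNneq n0 => z; rewrite -s4 z expr0n.
have [a [b [c [[a0 b0 c0] a2 b2 c2 E]]]] := normalize_torus n0 s4.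
have [t Tt ft] := torus_exists a0 b0 c0.
rewrite -(Tf t g Tt).
set v := fun i => _; set y1 := _ / _ in E; set y2 := _ / _ in E; set y3 := _ / _ in E.
pose u := chart_pt v; pose B := (u^-1 * (t * g))%g.
have uB : (t * g)%g = (u * B)%g by rewrite /B mulgA mulgV mul1g.
have fu : fr u = chart y1 y2 y3 by exact: frame_chart_pt.
have tgE (x : 'cV[C]_8) : torus_elt a b c *m (fr g *m x) = chart y1 y2 y3 *m (fr B *m x).
  by rewrite -fu -ft mulmxA [RHS]mulmxA -[_ *m fr B]/(_ * fr B) -frameM -uB frameM.
have Bv0 : fr B *m v0 C = s *: v0 C.
  by apply: (@frame_mul_inj _ h u); rewrite -scalemxAr fu -tgE.
have [p0 [p1 [p2 [p4 Bv1]]]] : exists a b c d, fr B *m v1 C = c8 a b c 0 d 0 0 0.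
  have -> : v1 C = gam (f3 C) *m v0 C by rewrite gam_c8; congr c8; ring.
  exact: stab_level1 (frame_spin h B) Bv0.
have [q0 [q1 [q2 [q4 Bv2]]]] : exists a b c d, fr B *m v2 C = c8 a b c 0 d 0 0 0.
  have -> : v2 C = gam (f2 C) *m v0 C by rewrite gam_c8; congr c8; ring.
  exact: stab_level1 (frame_spin h B) Bv0.
have abc : (a * b * c) ^+ 2 = X 0 g / s.
  rewrite !exprMn a2 b2 c2; apply: (mulfI s0); rewrite [RHS]mulrC divfK //.
  apply: (mulIf x3); apply: (mulIf x5); apply: (mulIf x6).
  transitivity (s ^+ 4); first by field; rewrite x3 x5 x6.
  by rewrite s4 /tetra0.
(* Undoing the chart on the coordinates 0, 1, 2 expresses entries of [B] by minors of [g], which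
   makes the pivots nonzero. *)
have entries k z0 z1 z2 z4 : fr B *m delta_mx (inord k) 0 = c8 z0 z1 z2 0 z4 0 0 0 ->
    z1 = X 6 g / (s * X 0 g) * minor h 1 k g /\ z2 = X 5 g / (s * X 0 g) * minor h 2 k g.
  move=> Ez; have := tgE (delta_mx (inord k) 0); rewrite Ez mulmx_c8E.
  rewrite torus_elt_c8 // abc c2 b2.
  have [w3 [w5 [w6 [w7 ->]]]] := chart_c8 y1 y2 y3 z0 z1 z2 0 z4 0 0 0.
  case/c8_inj=> [[e0 e1 e2 _] _].
  have s4' : s ^+ 4 = X 0 g * X 3 g * X 5 g * X 6 g by [].
  have -> : z1 = z1 + y1 * z0 - y1 * z0 by rewrite addrK.
  have -> : z2 = z2 + y2 * z0 - y2 * z0 by rewrite addrK.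
  rewrite -e1 -e2 -e0 /y1 /y2 !YvE /minor -/(X 0 g) -/(X 1 g) -/(X 2 g).
  by split; field; rewrite ?x0 ?x5 ?x6 ?s0.
have v1E : v1 C = delta_mx (inord 1) 0 by rewrite c8_delta.
have v2E : v2 C = delta_mx (inord 2) 0 by rewrite c8_delta.
have [p1E p2E] : p1 = X 6 g / (s * X 0 g) * minor h 1 1 g /\
    p2 = X 5 g / (s * X 0 g) * minor h 2 1 g by apply: entries; rewrite -v1E; exact: Bv1.
have [q1E q2E] : q1 = X 6 g / (s * X 0 g) * minor h 1 2 g /\
    q2 = X 5 g / (s * X 0 g) * minor h 2 2 g by apply: entries; rewrite -v2E; exact: Bv2.
have p10 : p1 != 0 by rewrite p1E !mulf_neq0 ?invr_eq0 ?mulf_neq0.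
pose r2 := q2 - p2 / p1 * q1; pose r4 := q4 - p4 / p1 * q1.
have r20 : r2 != 0.
  have : p1 * r2 != 0.
    have -> : p1 * r2 = X 5 g * X 6 g / (s * X 0 g) ^+ 2 * minor3 h g.
      transitivity (p1 * q2 - p2 * q1); first by rewrite /r2; field.
      by rewrite p1E p2E q1E q2E /minor3; field; rewrite s0 x0.
    by rewrite !mulf_neq0 ?invr_eq0 ?expf_neq0 ?mulf_neq0.
  by rewrite mulf_eq0 negb_or => /andP[].
(* Elimination: [l2] and [l12] clear the entries 2 and 4 of column 1 with pivot [p1], then [l1]
   clears the entry 4 of column 2 with pivot [r2]. *)
have [l2 fl2] := frame_surj h (lower2_spin (- (p2 / p1))).
have [l12 fl12] := frame_surj h (lower12_spin (- (p4 / p1))).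
have [l1 fl1] := frame_surj h (lower1_spin (- (r4 / r2))).
pose D := (l1 * (l12 * (l2 * B)))%g.
have DE (x : 'cV[C]_8) : fr D *m x = unip (f1 C) (e2 C) (- (r4 / r2)) *m
    (unip (f1 C) (e3 C) (- (p4 / p1)) *m (unip (f2 C) (e3 C) (- (p2 / p1)) *m (fr B *m x))).
  rewrite -fl1 -fl12 -fl2 /D frameM -mulmxA frameM -(mulmxA (fr l12)) frameM.
  by rewrite -(mulmxA (fr l2)).
have PD : P D.
  apply: P_borel.
  have two : (2 : C) != 0 by rewrite pnatr_eq0.
  apply: (@stab_upper_triangular C (fr D) s p0 p1 q0 q1 r2) => //.
  - exact: frame_spin.
  - rewrite DE Bv0 /v0 c8Z lower2_c8 lower12_c8 lower1_c8; congr c8; ring.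
  - rewrite DE Bv1 lower2_c8 lower12_c8 lower1_c8; congr c8; try ring.
    by field.
    by field; rewrite p10 r20.
  - rewrite DE Bv2 lower2_c8 lower12_c8 lower1_c8 /r2; congr c8; try ring.
    transitivity (r4 - r4 / r2 * r2); first by rewrite /r2 /r4; ring.
    by rewrite divfK // subrr.
have PB : P B.
  have -> : B = (l2^-1 * (l12^-1 * (l1^-1 * D)))%g by rewrite /D !mulKg.
  apply: P_mul; first exact: P_inv (lower2_P fl2).
  apply: P_mul; first exact: P_inv (lower12_P fl12).
  by apply: P_mul PD; exact: P_inv (lower1_P fl1).
rewrite uB (Pf u B PB); congr (_ ^+ _ * _).
by have := P_line PB; rewrite Bv0 /v0 !c8Z => /c8_inj[[]]; rewrite !mulr1.
Qed.

(** Right multiplication by a torus element of highest weight s multiplies every coordinate by s,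
    hence Y by s^2 and T_0 by s^4; the slice already realizes every Y with T_0 = 1. *)
Lemma slice_points (v : 'I_3 -> C) (t : C) : t != 0 ->
  exists g, Yv g = v /\ T0 g = t.
Proof.
move=> t0; pose s := 4.-root t.
have s4 : s ^+ 4 = t by rewrite /s rootCK.
have s0 : s != 0 by apply: contraNneq t0 => z; rewrite -s4 z expr0n.
have si0 : s^-1 != 0 by rewrite invr_eq0.
have [p fp] := frame_surj h (coroot1_spin si0).
have Tp : torus h p /\ [/\ dc 0 p = s, dc 1 p = s, dc 2 p = s & dc 3 p = s] /\
    [/\ dc 4 p = s^-1, dc 5 p = s^-1, dc 6 p = s^-1 & dc 7 p = s^-1].
  by apply: torusP => *; rewrite fp coroot1_c8 invrK.
have [Dp [[d0 _ _ _] _]] := Tp.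
have Pp : P p.
  apply: P_borel => i j ij; move: Dp; rewrite /torus /= => /is_diag_mxP; apply.
  by rewrite gtn_eqF.
pose w := fun i => v i / s ^+ 2.
have XE i : X i (chart_pt w * p)%g =
    s * X i (chart_pt w) by rewrite X_P // /varpi3 d0.
exists (chart_pt w * p)%g; split.
  apply/funext => i; rewrite /ycoord !XE.
  transitivity (s ^+ 2 * Yv (chart_pt w) i).
    by rewrite /ycoord; ring.
  by rewrite Yv_chart_pt /w mulrC divfK // expf_neq0.
rewrite /tetra0 !XE.
transitivity (s ^+ 4 * T0 (chart_pt w)).
  by rewrite /tetra0; ring.
by rewrite T0_chart_pt mulr1.
Qed.

End Decomposition.

(** * Invariant sections *)

Section Structure.
Variable C : numClosedFieldType.
Local Notation G := (Spin7 C).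
Variable h : G.
Local Notation R3 := {mpoly C[3]}.
Implicit Types (f : G -> C) (g p t n : G) (A B : {poly R3}) (F : R3).
Local Notation fr := (frame h).
Local Notation X := (coord h).
Local Notation Yv := (ycoord h).
Local Notation T0 := (tetra0 h).
Local Notation T1 := (tetra1 h).
Local Notation chart_pt := (chart_pt h).
Local Notation inv := (invariants h).

Lemma dhomog_scale F d a (v : 'I_3 -> C) : F \is d.-homog ->
  F.@[fun i => a * v i] = a ^+ d * F.@[v].
Proof.
move=> hF; rewrite !mevalE mulr_sumr big_seq [RHS]big_seq.
apply: eq_bigr => m mF; rewrite -/(mon_value (fun i => a * v i) m) monv_scale -/(mon_value v m).
by rewrite (dhomog_mf hF mF : mdeg m = d); ring.
Qed.

Lemma whomog_scale k A a (v : 'I_3 -> C) (t : C) : whomog k A ->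
  ev A (fun i => a ^+ 2 * v i) (a ^+ 4 * t) = a ^+ (4 * k) * ev A v t.
Proof.
move=> wA; rewrite !(ev_coef _ _ (whomog_size wA)) mulr_sumr; apply: eq_bigr => i _.
have ik : (i <= k)%N by rewrite -ltnS.
rewrite (dhomog_scale _ _ ((wA i).1 ik)) (exprMn i (a ^+ 4) t).
have -> : a ^+ (4 * k) = (a ^+ 2) ^+ (2 * (k - i)) * (a ^+ 4) ^+ i.
  by rewrite -!exprM -exprD; congr (_ ^+ _); lia.
exact: mulrACA.
Qed.

Lemma regular_meval F : regular (fun g => F.@[Yv g]).
Proof.
have H i : regular (Yv^~ i) by have [[]] := invariants_Yv h i.
have [Q E] := fin_all_exists H.
exists (F \mPo [tuple Q i | i < 3]) => g; rewrite comp_mpoly_meval.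
by apply: meval_eq => i; rewrite tnth_mktuple E.
Qed.

Lemma regularX f k : regular f -> regular (fun g => f g ^+ k).
Proof.
move=> rf; elim: k => [|k IH]; first exact: regular_cst.
have := regularM rf IH; congr regular.
by apply/funext => g; rewrite exprS.
Qed.

Lemma regular_ev A f : regular f -> regular (fun g => ev A (Yv g) (f g)).
Proof.
move=> rf; have -> : (fun g => ev A (Yv g) (f g)) =
    (fun g => \sum_(i < size A) (A`_i).@[Yv g] * f g ^+ i).
  by apply/funext => g; rewrite (ev_coef _ _ (leqnn _)).
by apply: regular_sum => i; apply: regularM; [exact: regular_meval|exact: regularX].
Qed.

Lemma Yv_P g p : P_alpha3 h p -> Yv (g * p)%g = fun i => varpi3 h p ^+ 2 * Yv g i.
Proof. by move=> Pp; apply/funext => i; have [[_ ->]] := invariants_Yv h i. Qed.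

Lemma invariants_ev k A f : whomog k A -> inv 4 f -> inv (4 * k) (fun g => ev A (Yv g) (f g)).
Proof.
move=> wA [[rf Pf] Tf]; split; last first.
  move=> t g Tt; rewrite Tf //; congr (ev A _ _).
  by apply/funext => i; have [_ ->] := invariants_Yv h i.
split; first exact: regular_ev.
by move=> g p Pp; rewrite Yv_P // Pf // (whomog_scale _ _ _ wA).
Qed.

(** Averaging [slice_value] over the fourth roots s and i s leaves only the even part of [F]; the
    power T_0^N makes its homogenization polynomial. *)
Lemma generic_chart k f F N g : inv (4 * k) f -> (forall v, f (chart_pt v) = F.@[v]) ->
  (msize F <= N + k)%N ->
  T0 g ^+ N * f g = ev (homogenize (N + k) F) (Yv g) (T0 g).
Proof.
move=> If EF sF; apply/eqP; rewrite -subr_eq0; apply/eqP; move: g.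
have rT : regular T0 by have [[]] := invariants_T0 h.
apply: (regular_generic (h := h)).
  apply: regularB; last exact: regular_ev.
  by apply: regularM; [exact: regularX|have [[]] := If].
move=> g gg; apply/eqP; rewrite subr_eq0; apply/eqP.
pose s := 4.-root (T0 g); have s4 : s ^+ 4 = T0 g by rewrite /s rootCK.
have s0 : s != 0 by case: gg => n0 _ _; apply: contraNneq n0 => z; rewrite -s4 z expr0n.
have i4 : ('i * s) ^+ 4 = T0 g.
  have i4 : ('i : C) ^+ 4 = 1 by rewrite (exprM _ 2 2) sqrCi sqrrN expr1n.
  by rewrite exprMn i4 mul1r.
have two : (2 : C) != 0 by rewrite pnatr_eq0.
apply: (mulfI two); rewrite (ev_homogenize _ sF s0 s4) mulr2n !mulrDl mul1r.
rewrite {1}(slice_value If gg s4) (slice_value If gg i4) !EF mulrDr.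
have -> : s ^+ (4 * (N + k)) = T0 g ^+ N * s ^+ (4 * k).
  by rewrite -s4 -exprM -exprD mulnDr.
rewrite -!mulrA; congr (_ * (_ * _) + _ * _).
  by apply: meval_eq => i; rewrite mulrC.
rewrite exprM i4 -s4 -exprM; congr (_ * _).
apply: meval_eq => i; rewrite exprMn sqrCi mulN1r invrN mulrC.
by [].
Qed.

(** At a chart point T_0 = 1, and [generic_chart] says that [F] equals its even part. *)
Lemma chart_even k f F : inv (4 * k) f -> (forall v, f (chart_pt v) = F.@[v]) ->
  forall v, F.@[v] = F.@[fun i => - v i].
Proof.
move=> If EF; pose N := msize F.
have E (v : 'I_3 -> C) : 2 * F.@[v] = F.@[v] + F.@[fun i => - v i].
  have sF : (msize F <= N + k)%N by rewrite leq_addr.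
  have := generic_chart (chart_pt v) If EF sF.
  rewrite T0_chart_pt Yv_chart_pt expr1n mul1r EF => E1.
  rewrite {1}E1 (@ev_homogenize _ _ F v 1 1 sF (oner_neq0 _) (expr1n _ 4)) expr1n mul1r.
  by congr (_ + _); apply: meval_eq => i; rewrite expr1n invr1 ?mul1r ?mulN1r.
by move=> v; apply: (addrI F.@[v]); rewrite -E mulr2n mulrDl mul1r.
Qed.

Definition w0 : G := sval (cid (frame_surj h (longest_spin C))).

Lemma frame_w0 : fr w0 = longest C.
Proof. exact: svalP (cid (frame_surj h (longest_spin C))). Qed.

Lemma w0K : (w0 * w0 = 1)%g.
Proof.
apply: (@frame_inj _ h); rewrite frameM frame_w0 frame1.
apply: mx8P => *; rewrite -mulmxA !longest_c8 mul1mx; congr c8; ring.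
Qed.

Lemma w0KK g : (w0 * (w0 * g))%g = g.
Proof. by rewrite mulgA w0K mul1g. Qed.

Lemma X_w0 g : [/\ X 0 (w0 * g)%g = - X 7 g, X 1 (w0 * g)%g = X 6 g,
    X 2 (w0 * g)%g = - X 5 g & X 3 (w0 * g)%g = X 4 g] /\
  [/\ X 4 (w0 * g)%g = X 3 g, X 5 (w0 * g)%g = - X 2 g, X 6 (w0 * g)%g = X 1 g &
    X 7 (w0 * g)%g = - X 0 g].
Proof.
by apply: c8_inj; rewrite -frame_v0 frameM -mulmxA frame_v0 frame_w0 longest_c8.
Qed.

Lemma Yv_w0 g : Yv (w0 * g)%g = Yv g.
Proof.
have [[x0 x1 x2 x3] [x4 x5 x6 x7]] := X_w0 g.
by apply/funext; apply: ord3_ind; rewrite !YvE ?x1 ?x2 ?x3 ?x4 ?x5 ?x6; ring.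
Qed.

Lemma T0_w0 g : T0 (w0 * g)%g = T1 g.
Proof.
have [[x0 x1 x2 x3] [x4 x5 x6 x7]] := X_w0 g.
by rewrite /tetra0 /tetra1 x0 x3 x5 x6; ring.
Qed.

Lemma torus_w0 t : torus h t -> torus h (t ^ w0)%g.
Proof.
move=> Tt; apply: (proj1 (@torusP _ h (t ^ w0)%g (dcoef h 7 t) (dcoef h 6 t)
  (dcoef h 5 t) (dcoef h 4 t) (dcoef h 3 t) (dcoef h 2 t) (dcoef h 1 t)
  (dcoef h 0 t) _)) => *.
apply: (@frame_mul_inj _ h w0); rewrite conj_frame frame_w0 !longest_c8 torus_c8 //.
by congr c8; ring.
Qed.

Lemma invariants_w0 m f : inv m f -> inv m (fun g => f (w0 * g)%g).
Proof.
move=> [[rf Pf] Tf]; split; last first.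
  move=> t g Tt; have -> : (w0 * (t * g) = (t ^ w0) * (w0 * g))%g.
    have wV : (w0^-1 = w0)%g by rewrite -[LHS]mulg1 -w0K mulKg.
    rewrite conjgE wV -(mulgA w0 (t * w0)%g) -(mulgA t w0) (mulgA w0 w0 g).
    by rewrite w0K mul1g.
  by apply: Tf; exact: torus_w0.
split; last by move=> g p Pp; rewrite -(Pf (w0 * g)%g p Pp) (mulgA w0 g p).
have := regular_translate w0 1%g rf; congr regular.
by apply/funext => g; rewrite mulg1.
Qed.

Lemma glue_functions N M A B : (N <= M)%N -> whomog M A -> whomog M B ->
  (forall g, T1 g ^+ N * ev A (Yv g) (T0 g) = T0 g ^+ N * ev B (Yv g) (T1 g)) ->
  exists A' B', [/\ whomog (M - N) A', whomog (M - N) B' & forall g,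
    ev A (Yv g) (T0 g) = T0 g ^+ N * (ev A' (Yv g) (T0 g) + ev B' (Yv g) (T1 g))].
Proof.
move=> NM wA wB E.
have [|A' [B' [wA' wB' E']]] := glue_charts NM wA wB.
  move=> v t t0; have [g [<- Tg]] := slice_points h v t0.
  have -> : quartic (Yv g) / t = T1 g by rewrite -T0T1 Tg mulrC mulKf.
  by rewrite -Tg.
by exists A', B'; split=> // g; apply: E'; exact: T0T1.
Qed.

Lemma T0_neq0 : exists g, T0 g != 0.
Proof. by exists (chart_pt (fun=> 0)); rewrite T0_chart_pt oner_neq0. Qed.

Lemma regular_cancel f f' : regular f -> regular f' ->
  (exists g, f g != 0) -> (forall g, f g * f' g = 0) -> forall g, f' g = 0.
Proof.
move=> rf rf' [g fg] E; case: (regular_domain rf rf' E) => // H.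
by rewrite H eqxx in fg.
Qed.

Lemma invariants_normal_form k f : inv (4 * k) f ->
  exists A B, [/\ whomog k A, whomog k B &
    forall g, f g = ev A (Yv g) (T0 g) + ev B (Yv g) (T1 g)].
Proof.
move=> If; have Iw := invariants_w0 If.
have [F EF] := polyf_chart h If.1.1; have [F' EF'] := polyf_chart h Iw.1.1.
pose N := maxn (msize F) (msize F').
have sF : (msize F <= N + k)%N by rewrite (leq_trans (leq_maxl _ _) (leq_addr _ _)).
have sF' : (msize F' <= N + k)%N by rewrite (leq_trans (leq_maxr _ _) (leq_addr _ _)).
have E g := generic_chart g If EF sF.
have E' g := generic_chart g Iw EF' sF'.
have NM : (N <= N + k)%N by rewrite leq_addr.
have [|A [B [wA wB EAB]]] := glue_functions NM (whomog_homogenize sF) (whomog_homogenize sF').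
  (* Evaluating the formula for the translate of f at w0 g gives the formula for f itself, with T_1
     in place of T_0. *)
  move=> g; have E1 := E' (w0 * g)%g; rewrite Yv_w0 T0_w0 w0KK in E1.
  apply: (etrans (congr1 ( *%R _) (esym (E g)))).
  by apply: (etrans _ (congr1 ( *%R _) E1)); exact: mulrCA.
rewrite addKn in wA wB; exists A, B; split=> // g.
have rT0 : regular T0 by have [[]] := invariants_T0 h.
have rT1 : regular T1 by have [[]] := invariants_T1 h.
apply/eqP; rewrite -subr_eq0; apply/eqP; move: g.
apply: (@regular_cancel (fun g => T0 g ^+ N)).
- exact: regularX.
- apply: regularB; first exact: If.1.1.
  by apply: regularD; exact: regular_ev.
- by have [g0 n0] := T0_neq0; exists g0; rewrite expf_neq0.
- by move=> g; rewrite mulrBr E EAB subrr.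
Qed.

End Structure.

(** * Generation in degree one *)

Section Generation.
Variable C : numClosedFieldType.
Local Notation G := (Spin7 C).
Variable h : G.
Local Notation R3 := {mpoly C[3]}.
Local Notation Yv := (ycoord h).
Local Notation T0 := (tetra0 h).
Local Notation T1 := (tetra1 h).
Local Notation inv := (invariants h).

Variable S : set {poly (G -> C)}.
Hypothesis S_alg : Csubalgebra S.
Hypothesis S_gen : forall f : G -> C, inv 4 f -> S (f *: 'X).

Let gen k (f : G -> C) := S (f *: 'X^k).

Let S_cst c : S (cst c)%:P. Proof. by have [H _ _] := S_alg. Qed.
Let S_add u v : S u -> S v -> S (u + v). Proof. by have [_ H _] := S_alg; exact: H. Qed.
Let S_mul u v : S u -> S v -> S (u * v). Proof. by have [_ _ H] := S_alg; exact: H. Qed.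

Lemma gen_cst c : gen 0 (fun=> c).
Proof. by rewrite /gen expr0 -mul_polyC mulr1; exact: S_cst. Qed.

Lemma gen_zero k : gen k (fun=> 0).
Proof.
rewrite /gen (_ : (fun=> 0) = 0 :> (G -> C)) // scale0r.
by have := S_cst 0; rewrite (_ : cst 0 = 0 :> (G -> C)) ?polyC0.
Qed.

Lemma gen_add k (f f' : G -> C) : gen k f -> gen k f' -> gen k (fun g => f g + f' g).
Proof.
move=> gf gf'; rewrite /gen (_ : (fun g => _) = f + f') // scalerDl.
exact: S_add.
Qed.

Lemma gen_mul k l (f f' : G -> C) : gen k f -> gen l f' -> gen (k + l) (fun g => f g * f' g).
Proof.
move=> gf gf'; rewrite /gen (_ : (fun g => _) = f * f') //.
by rewrite exprD -scalerA scalerAr scalerAl; exact: S_mul.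
Qed.

Lemma gen_sum (I : Type) (r : seq I) (Q : pred I) k (F : I -> G -> C) :
  (forall i, Q i -> gen k (F i)) -> gen k (fun g => \sum_(i <- r | Q i) F i g).
Proof.
move=> H; elim: r => [|i r IH].
  by rewrite (_ : (fun g => _) = fun=> 0); [exact: gen_zero|apply/funext => g; rewrite big_nil].
case Qi : (Q i); last first.
  rewrite (_ : (fun g => _) = fun g => \sum_(j <- r | Q j) F j g) //.
  by apply/funext => g; rewrite big_cons Qi.
rewrite (_ : (fun g => _) = fun g => F i g + \sum_(j <- r | Q j) F j g).
  by apply: gen_add => //; exact: H.
by apply/funext => g; rewrite big_cons Qi.
Qed.

Lemma gen_exp (f : G -> C) k : gen 1 f -> gen k (fun g => f g ^+ k).
Proof.
move=> gf; elim: k => [|k IH]; first exact: gen_cst.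
rewrite (_ : (fun g => _) = fun g => f g * f g ^+ k).
  exact: (@gen_mul 1).
by apply/funext => g; rewrite exprS.
Qed.

Lemma gen_degree1 (f : G -> C) : inv 4 f -> gen 1 f.
Proof. by move=> If; rewrite /gen expr1; exact: S_gen. Qed.

(** The factors are taken two at a time, since a single Y_i has half the degree of a generator. *)
Lemma gen_seq l (r : seq 'I_3) : size r = (2 * l)%N ->
  gen l (fun g => \prod_(i <- r) Yv g i).
Proof.
elim: l r => [|l IH] [|i [|j r]] //=.
- move=> _; rewrite (_ : (fun g => _) = fun=> 1); first exact: gen_cst.
  by apply/funext => g; rewrite big_nil.
- by lia.
move=> sz; rewrite (_ : (fun g => _) =
  fun g => (Yv g i * Yv g j) * \prod_(i <- r) Yv g i); last first.
  by apply/funext => g; rewrite !big_cons mulrA.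
apply: (@gen_mul 1); last by apply: IH; lia.
by apply: gen_degree1; exact: (invariantsM (invariants_Yv h i) (invariants_Yv h j)).
Qed.

Lemma gen_monv l (m : 'X_{1..3}) : mdeg m = (2 * l)%N -> gen l (fun g => mon_value (Yv g) m).
Proof.
move=> dm; pose r := flatten [seq nseq (m i) i | i <- enum 'I_3].
rewrite (_ : (fun g => _) = fun g => \prod_(i <- r) Yv g i).
  apply: gen_seq; rewrite -dm mdegE size_flatten /shape -map_comp sumnE big_map big_enum /=.
  by apply: eq_bigr => i _; rewrite size_nseq.
apply/funext => g; rewrite /r big_flatten big_map big_enum /=.
by apply: eq_bigr => i _; rewrite big_nseq iter_mulr_1.
Qed.

Lemma gen_homog l (F : R3) : F \is (2 * l)%N.-homog -> gen l (fun g => F.@[Yv g]).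
Proof.
move=> hF; rewrite (_ : (fun g => _) =
  fun g => \sum_(m <- msupp F | m \in msupp F) F@_m * mon_value (Yv g) m); last first.
  by apply/funext => g; rewrite mevalE big_seq.
apply: gen_sum => m mF; apply: (@gen_mul 0); first exact: gen_cst.
by apply: gen_monv; exact: (dhomog_mf hF mF).
Qed.

Lemma gen_ev k A (f : G -> C) : whomog k A -> inv 4 f -> gen k (fun g => ev A (Yv g) (f g)).
Proof.
move=> wA If; rewrite (_ : (fun g => _) =
  fun g => \sum_(i < k.+1) (A`_i).@[Yv g] * f g ^+ i); last first.
  by apply/funext => g; rewrite (ev_coef _ _ (whomog_size wA)).
apply: gen_sum => i _; have ik : (i <= k)%N by rewrite -ltnS.
have := gen_mul (gen_homog ((wA i).1 ik)) (@gen_exp f i (gen_degree1 If)).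
by rewrite (subnK ik).
Qed.

Lemma gen_invariants k (f : G -> C) : inv (4 * k) f -> gen k f.
Proof.
move=> /invariants_normal_form[A [B [wA wB E]]].
rewrite (_ : f = fun g => ev A (Yv g) (T0 g) + ev B (Yv g) (T1 g)); last exact/funext.
by apply: gen_add; apply: gen_ev => //; [exact: invariants_T0|exact: invariants_T1].
Qed.

Lemma git_ring_sub (u : git_ring h 4) : S (git_val u).
Proof.
have /asboolP iu := valP u; rewrite -[git_val u]coefK poly_def.
elim/big_rec: _ => [|i v _ Sv].
  by have := S_cst 0; rewrite (_ : cst 0 = 0 :> (G -> C)) ?polyC0.
by apply: S_add => //; exact: gen_invariants (iu i).
Qed.

End Generation.

Lemma git_ring_generated (C : numClosedFieldType) (h : Spin7 C) :
  generated_in_degree_one h 4.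
Proof.
move=> u S [Salg Sgen]; apply: git_ring_sub => //.
by move=> f If; apply: Sgen; exists f.
Qed.

(** * Normality *)

Section Normality.
Variable C : numClosedFieldType.
Local Notation G := (Spin7 C).
Variable h : G.
Local Notation R3 := {mpoly C[3]}.
Local Notation Yv := (ycoord h).
Local Notation T0 := (tetra0 h).
Local Notation T1 := (tetra1 h).
Local Notation chart_pt := (chart_pt h).
Local Notation inv := (invariants h).
Local Notation A := (git_ring h 4).
Local Notation w0 := (w0 h).

Lemma mpoly_eval_inj (F F' : R3) : (forall v, F.@[v] = F'.@[v]) -> F = F'.
Proof.
move=> H; apply/eqP; rewrite -subr_eq0; apply/eqP.
apply: meval_eq0 => [|v]; first exact: char0_units_numField.
by rewrite mevalB H subrr.
Qed.

Definition chart_poly (f : G -> C) : set R3 :=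
  [set F : R3 | forall v, f (chart_pt v) = F.@[v]]%classic.

Definition pull (f : G -> C) : R3 := xget 0 (chart_poly f).

Lemma pullE f : regular f -> forall v, f (chart_pt v) = (pull f).@[v].
Proof.
move=> rf; have [F EF] := polyf_chart h rf.
exact: (@xgetPex _ 0 (chart_poly f) (ex_intro _ F EF)).
Qed.

Lemma pull_unique f F : (forall v, f (chart_pt v) = F.@[v]) -> pull f = F.
Proof.
move=> EF; apply: mpoly_eval_inj => v; rewrite -EF.
exact/esym/(@xgetPex _ 0 (chart_poly f) (ex_intro _ F EF)).
Qed.

Lemma pull0 : pull 0 = 0.
Proof. by apply: pull_unique => v; rewrite meval0. Qed.

Lemma git_coef (u : A) k : inv (4 * k) (git_val u)`_k.
Proof. by have /asboolP := valP u. Qed.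

Lemma git_coef_regular (u : A) k : regular (git_val u)`_k.
Proof. by have [[]] := git_coef u k. Qed.

(** Coefficientwise restriction to the slice. Since T_0 = 1 there, the element [T0 *: 'X] goes to
    the indeterminate. *)
Definition restr (u : A) : {poly R3} := \poly_(i < size (git_val u)) pull (git_val u)`_i.

Lemma coef_restr u i : (restr u)`_i = pull (git_val u)`_i.
Proof.
by rewrite coef_poly; case: ltnP => // /(nth_default 0) ->; rewrite pull0.
Qed.

Lemma restrE u i v : ((restr u)`_i).@[v] = (git_val u)`_i (chart_pt v).
Proof. by rewrite coef_restr -pullE //; exact: git_coef_regular. Qed.

Lemma git_valB (u v : A) : git_val (u - v) = git_val u - git_val v.
Proof. exact: (rmorphB (val : A -> {poly (G -> C)})). Qed.
Lemma git_valM (u v : A) : git_val (u * v) = git_val u * git_val v.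
Proof. exact: (rmorphM (val : A -> {poly (G -> C)})). Qed.
Lemma git_val0 : git_val (0 : A) = 0.
Proof. exact: (raddf0 (val : A -> {poly (G -> C)})). Qed.
Lemma git_val1 : git_val (1 : A) = 1.
Proof. exact: (rmorph1 (val : A -> {poly (G -> C)})). Qed.

Lemma restr_is_zmod_morphism : zmod_morphism restr.
Proof.
move=> u v; apply/polyP => i; rewrite coefB; apply: mpoly_eval_inj => x.
by rewrite mevalB !restrE git_valB coefB.
Qed.

Lemma restr_is_monoid_morphism : monoid_morphism restr.
Proof.
split=> [|u v]; apply/polyP => i; apply: mpoly_eval_inj => x.
  by rewrite restrE git_val1 !coef1; case: (i == 0%N); rewrite ?meval1 ?meval0.
rewrite restrE git_valM !coefM raddf_sum /= fct_sumE; apply: eq_bigr => j _.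
by rewrite mevalM !restrE.
Qed.

HB.instance Definition _ := GRing.isZmodMorphism.Build A {poly R3} restr
  restr_is_zmod_morphism.
HB.instance Definition _ := GRing.isMonoidMorphism.Build A {poly R3} restr
  restr_is_monoid_morphism.

(** The chart formula with N = 0 and F = 0 recovers a homogeneous component that vanishes on the
    slice. *)
Lemma restr_inj : injective restr.
Proof.
apply: raddf_inj => u u0; apply: val_inj; apply/polyP => k.
rewrite -[val u]/(git_val u) -[val 0]/(git_val 0) git_val0 coef0.
have E v : (git_val u)`_k (chart_pt v) = (0 : R3).@[v] by rewrite -restrE u0 coef0.
apply/funext => g; have := @generic_chart _ h k (git_val u)`_k 0 0 g (git_coef u k) E.
rewrite msize0 => /(_ isT); rewrite expr0 mul1r => ->.
by rewrite /homogenize msupp0 big_nil /ev raddf0 horner0.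
Qed.

Lemma git_domain (u v : A) : u * v = 0 -> u = 0 \/ v = 0.
Proof.
move=> uv; have : restr u * restr v = 0 by rewrite -rmorphM uv rmorph0.
move/eqP; rewrite mulf_eq0 => /orP[/eqP z|/eqP z]; [left|right]; apply: restr_inj.
  by rewrite z rmorph0.
by rewrite z rmorph0.
Qed.

Lemma git_cancel (u v w : A) : u != 0 -> u * v = u * w -> v = w.
Proof.
move=> u0 E; have : u * (v - w) = 0 by rewrite mulrBr E subrr.
case/git_domain=> [z|/eqP]; first by rewrite z eqxx in u0.
by rewrite subr_eq0 => /eqP.
Qed.

Lemma git_poly n (E : nat -> G -> C) : (forall i, inv (4 * i) (E i)) ->
  exists u : A, forall i, (git_val u)`_i = if (i < n)%N then E i else 0.
Proof.
move=> IE; have mem : \poly_(i < n) E i \in git_pred h 4.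
  apply/asboolP => i; rewrite coef_poly; case: ifP => _ //.
  exact: invariants0.
by exists (MkGitRing mem) => i; rewrite /= coef_poly.
Qed.

Lemma tau_exists (f : G -> C) : inv 4 f -> exists u : A, git_val u = f *: 'X.
Proof.
move=> If; have mem : f *: 'X \in git_pred h 4.
  apply/asboolP => i; rewrite coefZ coefX; case: eqP => [->|_].
    by rewrite mulr1 muln1.
  by rewrite mulr0; exact: invariants0.
by exists (MkGitRing mem).
Qed.

Lemma git_valX (u : A) n : git_val (u ^+ n) = git_val u ^+ n.
Proof. exact: (rmorphXn (val : A -> {poly (G -> C)})). Qed.

Lemma coef_tau (f : G -> C) (tau : A) N (u : A) k : git_val tau = f *: 'X ->
  (git_val (tau ^+ N * u))`_(N + k) = (fun g => f g ^+ N * (git_val u)`_k g).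
Proof.
move=> E; rewrite git_valM git_valX E exprZn -scalerAl coefZ coefXnM.
rewrite ltnNge leq_addr /= addKn; apply/funext => g.
rewrite /= -[(_ * _) g]/((f ^+ N) g * (git_val u)`_k g); congr (_ * _).
by elim: N => [|N IH] //; rewrite !exprS -IH.
Qed.

Lemma coef_tau_low (f : G -> C) (tau : A) N (u : A) k : git_val tau = f *: 'X ->
  (k < N)%N -> (git_val (tau ^+ N * u))`_k = 0.
Proof.
by move=> E kN; rewrite git_valM git_valX E exprZn -scalerAl coefZ coefXnM kN mulr0.
Qed.

Lemma quot_closed_restr : quot_closed {poly R3}.
Proof.
apply: quot_closed_poly.
  by apply: char0_units_mpoly; exact: char0_units_numField.
by apply: quot_closed_mpoly; [exact: char0_units_numField|exact: quot_closed_field].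
Qed.

Definition neg_vars : R3 -> R3 := comp_mpoly [tuple - 'X_i | i < 3].
HB.instance Definition _ := GRing.RMorphism.on neg_vars.

Lemma neg_varsE F v : (neg_vars F).@[v] = F.@[fun i => - v i].
Proof.
rewrite comp_mpoly_meval; apply: meval_eq => i.
by rewrite tnth_mktuple mevalN mevalXU.
Qed.

Lemma restr_even (u : A) : map_poly neg_vars (restr u) = restr u.
Proof.
apply/polyP => i; rewrite coef_map /=; apply: mpoly_eval_inj => v.
rewrite neg_varsE; apply: esym.
exact: (@chart_even _ h i (git_val u)`_i _ (git_coef u i) (fun v => esym (restrE u i v))).
Qed.

(** The quotient [q] of the restrictions exists in a polynomial ring, but a coefficient may have too
    large a degree in Y to come from an invariant of its degree. Multiplication by T_0^N raises that
    degree until [homogenize] applies. *)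
Lemma chart_quotient (a b tau : A) (p : {poly A}) :
  git_val tau = T0 *: 'X -> p \is monic -> b != 0 -> hom_eq p a b = 0 ->
  exists N0, forall N, (N0 <= N)%N -> exists c : A,
    tau ^+ N * a = b * c /\
    forall k, ((k < N)%N -> (git_val c)`_k = 0) /\
      exists2 P, whomog k P & (N <= k)%N ->
        (git_val c)`_k = fun g => ev P (Yv g) (T0 g).
Proof.
move=> tauE mp b0 E.
have rb0 : restr b != 0.
  by apply: contraNneq b0 => z; apply/eqP; apply: restr_inj; rewrite z rmorph0.
have [|||q Eq] := quot_closed_restr (p := map_poly restr p) (a := restr a) (b := restr b).
- exact: monic_map.
- exact: rb0.
- by rewrite (hom_eq_map restr) // E rmorph0.
(* The restrictions of [a] and [b] are fixed by the sign change, hence so is their quotient;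
   otherwise [homogenize] would lose its odd part. *)
have q_even i v : (q`_i).@[v] = (q`_i).@[fun j => - v j].
  have Q : map_poly neg_vars q = q.
    apply: (mulfI rb0); rewrite -Eq -(restr_even a) Eq rmorphM /=.
    by rewrite restr_even.
  by rewrite -neg_varsE -[in LHS]Q coef_map.
exists (\max_(i < size q) msize q`_i) => N leN.
have sq k : (msize q`_k <= N + k)%N.
  have [kq|qk] := ltnP k (size q); last by rewrite nth_default // msize0.
  apply: leq_trans (leq_addr _ _); apply: leq_trans leN.
  exact: (@leq_bigmax _ (fun i : 'I_(size q) => msize q`_i) (Ordinal kq)).
pose P k := homogenize k (if (N <= k)%N then q`_(k - N) else 0).
have wP k : whomog k (P k).
  apply: whomog_homogenize; case: ifP => [Nk|_]; last by rewrite msize0.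
  by apply: leq_trans (sq _) _; rewrite subnKC.
have [c Ec] := git_poly (N + size q) (fun k => invariants_ev (wP k) (invariants_T0 h)).
have c_high k : (N + size q <= k)%N -> (fun g => ev (P k) (Yv g) (T0 g)) = 0 :> (G -> C).
  move=> k_big; apply/funext => g; rewrite /P; case: ifP => [Nk|_].
    rewrite nth_default; last by rewrite leq_subRL.
    by rewrite /homogenize msupp0 big_nil /ev raddf0 horner0.
  by rewrite /homogenize msupp0 big_nil /ev raddf0 horner0.
have Ec' k : (git_val c)`_k = fun g => ev (P k) (Yv g) (T0 g).
  by rewrite Ec; case: ltnP => // /c_high ->.
exists c; split; last first.
  move=> k; split=> [kN|]; last by exists (P k).
  rewrite Ec' /P leqNgt kN /=; apply/funext => g.
  by rewrite /homogenize msupp0 big_nil /ev raddf0 horner0.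
apply: restr_inj; rewrite !rmorphM rmorphXn /=.
have -> : restr tau = 'X.
  apply/polyP => i; apply: mpoly_eval_inj => v; rewrite restrE tauE coefZ !coefX.
  rewrite -[(_ * _) _]/(T0 (chart_pt v) * ((i == 1%N)%:R : G -> C) (chart_pt v)).
  by rewrite T0_chart_pt mul1r; case: (i == 1%N); rewrite ?meval1 ?meval0.
have -> : restr c = 'X^N * q.
  apply/polyP => i; apply: mpoly_eval_inj => v; rewrite restrE Ec' coefXnM.
  rewrite Yv_chart_pt T0_chart_pt /P leqNgt; case: (ltnP i N) => iN /=.
    by rewrite /homogenize msupp0 big_nil /ev raddf0 horner0 meval0.
  rewrite homogenize_even //.
  by apply: leq_trans (sq _) _; rewrite subnKC.
by rewrite Eq mulrCA.
Qed.

Definition flip_fun (f : G -> C) : G -> C := fun g => f (w0 * g)%g.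

Lemma flip_mem (u : A) : map_poly flip_fun (git_val u) \in git_pred h 4.
Proof.
apply/asboolP => k; rewrite coef_map_id0 //.
exact: invariants_w0 (git_coef u k).
Qed.

Definition flip (u : A) : A := MkGitRing (flip_mem u).

Lemma flip_coef u k : (git_val (flip u))`_k = flip_fun (git_val u)`_k.
Proof. by rewrite coef_map_id0. Qed.

Lemma flipK : involutive flip.
Proof.
move=> u; apply: val_inj; apply/polyP => k /=; rewrite coef_map_id0 // flip_coef.
by apply/funext => g; rewrite /flip_fun w0KK.
Qed.

Lemma flip_is_zmod_morphism : zmod_morphism flip.
Proof.
move=> u v; apply: val_inj; apply/polyP => k.
rewrite -[val (flip u - flip v)]/(git_val (flip u - flip v)) git_valB coefB.
by rewrite -[val (flip (u - v))]/(git_val (flip (u - v))) !flip_coef git_valB coefB.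
Qed.

Lemma flip_is_monoid_morphism : monoid_morphism flip.
Proof.
split=> [|u v]; apply: val_inj; apply/polyP => k.
  rewrite -[val 1]/(git_val 1) -[val (flip 1)]/(git_val (flip 1)) flip_coef.
  by rewrite git_val1 coef1; case: (k == 0%N).
rewrite -[val (flip u * flip v)]/(git_val (flip u * flip v)) git_valM coefM.
rewrite -[val (flip (u * v))]/(git_val (flip (u * v))) flip_coef git_valM coefM.
apply/funext => g; rewrite /flip_fun !fct_sumE; apply: eq_bigr => j _.
by rewrite !flip_coef.
Qed.

HB.instance Definition _ := GRing.isZmodMorphism.Build A A flip flip_is_zmod_morphism.
HB.instance Definition _ := GRing.isMonoidMorphism.Build A A flip
  flip_is_monoid_morphism.

Lemma git_quotient (a b : A) (p : {poly A}) :
  p \is monic -> b != 0 -> hom_eq p a b = 0 -> exists q, a = b * q.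
Proof.
move=> mp b0 E.
have [tau tauE] := tau_exists (invariants_T0 h).
have [tau' tau'E] := tau_exists (invariants_T1 h).
have ftau : flip tau = tau'.
  apply: val_inj; apply/polyP => k.
  rewrite -[val (flip tau)]/(git_val (flip tau)) flip_coef tauE.
  rewrite -[val tau']/(git_val tau') tau'E !coefZ coefX.
  apply/funext => g; rewrite /flip_fun -[LHS]/(T0 (w0 * g)%g * ((k == 1%N)%:R : G -> C) (w0 * g)%g).
  rewrite T0_w0 -[RHS]/(T1 g * ((k == 1%N)%:R : G -> C) g).
  by case: (k == 1%N).
have tau0 : tau != 0.
  apply/eqP => z; have [g Tg] := T0_neq0 h.
  have : (git_val tau)`_1 g = 0 by rewrite z coef0.
  rewrite tauE coefZ coefX -[LHS]/(T0 g * 1) mulr1 => /eqP.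
  by rewrite (negbTE Tg).
have [N0 H0] := chart_quotient tauE mp b0 E.
have fb0 : flip b != 0 by rewrite -(rmorph0 flip) (inj_eq (inv_inj flipK)).
have fE : hom_eq (map_poly flip p) (flip a) (flip b) = 0.
  by rewrite (hom_eq_map flip) // E rmorph0.
have [N1 H1] := chart_quotient tauE (monic_map flip mp) fb0 fE.
pose N := maxn N0 N1.
have [c [Ec cP]] := H0 N (leq_maxl _ _).
have [d' [Ed dP]] := H1 N (leq_maxr _ _).
pose d := flip d'.
have {}Ed : tau' ^+ N * a = b * d.
  have := congr1 flip Ed; rewrite !rmorphM rmorphXn /= ftau.
  by rewrite !(flipK : forall x, flip (flip x) = x).
(* Both sides times [b] are T_0^N T_1^N a. *)
have cd : tau' ^+ N * c = tau ^+ N * d.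
  by apply: (git_cancel b0); rewrite mulrCA -Ec [RHS]mulrCA -Ed mulrCA.
have rT0 : regular T0 by have [[]] := invariants_T0 h.
(* In each degree [c] is a polynomial in Y, T_0 and [d] one in Y, T_1, so [cd] is the gluing
   hypothesis and T_0^N can be extracted from [c]. *)
have ex k : exists e : G -> C, inv (4 * k) e /\
    (git_val c)`_(N + k) = fun g => T0 g ^+ N * e g.
  have [_ [P wP EP]] := cP (N + k)%N; have [_ [Q wQ EQ]] := dP (N + k)%N.
  have {}EP := EP (leq_addr _ _); have {}EQ := EQ (leq_addr _ _).
  have [|P' [Q' [wP' wQ' E']]] := glue_functions (h := h) (leq_addr k N) wP wQ.
    move=> g.
    have H : (fun g => T1 g ^+ N * (git_val c)`_(N + k) g) =
        (fun g => T0 g ^+ N * (git_val d)`_(N + k) g).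
      by rewrite -(coef_tau N c (N + k) tau'E) -(coef_tau N d (N + k) tauE) cd.
    have := congr1 (fun f : G -> C => f g) H.
    by rewrite /= EP /d flip_coef EQ /flip_fun Yv_w0 T0_w0.
  rewrite addKn in wP' wQ'.
  exists (fun g => ev P' (Yv g) (T0 g) + ev Q' (Yv g) (T1 g)); split.
    apply: (@invariantsD _ h _ (fun g => ev P' (Yv g) (T0 g))
      (fun g => ev Q' (Yv g) (T1 g))); apply: invariants_ev => //.
      exact: invariants_T0.
    exact: invariants_T1.
  by rewrite EP; apply/funext => g; exact: E'.
have [e eP] := choice ex.
have [q Eq] := git_poly (size (git_val c)) (fun k => (eP k).1).
have cq : c = tau ^+ N * q.
  apply: val_inj; apply/polyP => k.
  rewrite -[val c]/(git_val c) -[val (_ * _)]/(git_val (tau ^+ N * q)).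
  have [kN|Nk] := ltnP k N; first by rewrite (coef_tau_low _ tauE kN) (cP k).1.
  rewrite -(subnKC Nk) (coef_tau _ _ _ tauE) (eP _).2 Eq.
  case: ltnP => [//|big]; apply/funext => g.
  rewrite -[0 g]/(0 : C) mulr0.
  have := congr1 (fun f : G -> C => f g) (eP (k - N)%N).2 => /= <-.
  by rewrite nth_default // (leq_trans big) // leq_addl.
exists q; apply: (@git_cancel (tau ^+ N)).
  apply: (contraNneq _ tau0) => z; apply/eqP.
  elim: N {c Ec cP d' dP d Ed cd ex e eP q Eq cq} z => [|N IH].
    rewrite expr0 => z; have : git_val (1 : A) = 0 by rewrite z.
    by rewrite git_val1 => /eqP; rewrite oner_eq0.
  by rewrite exprS => /git_domain[].
by rewrite Ec cq mulrCA.
Qed.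

Lemma git_ring_integrally_closed : integrally_closed A.
Proof.
split; first exact: git_domain.
move=> K iota iotaI frac u [p mp /eqP up].
have [a [b Eu]] := frac u.
have [b0|b0] := eqVneq b 0; first by exists 0; rewrite Eu b0 rmorph0 invr0 mulr0.
have ib0 : iota b != 0 by rewrite -(rmorph0 iota) (inj_eq iotaI).
have [|q Eq] := git_quotient mp b0 (a := a).
  apply: iotaI; rewrite rmorph0 -(hom_eq_map iota) //.
  have -> : iota a = u * iota b by rewrite Eu divfK.
  (* With a = u b and b = 1 b, a power of b splits off and the value of the monic polynomial at u
     remains. *)
  rewrite -[X in hom_eq _ _ X]mul1r hom_eqM.
  suff -> : hom_eq (map_poly iota p) u 1 = 0 by rewrite mul0r.
  rewrite -up horner_coef; apply: eq_bigr => i _; by rewrite expr1n mulr1.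
by exists q; rewrite Eu Eq rmorphM /= mulrC mulKf.
Qed.

End Normality.

Local Open Scope complex_scope.

Theorem theorem8p2 (R : realType) (h : Spin7 R[i]) :
  git_quotient_projectively_normal h 4.
Proof.
by split; [exact: git_ring_integrally_closed|exact: git_ring_generated].
Qed.
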